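(* For every real $\alpha<0$ and every $r>0$, the space $V_{-\infty}$ is dense in the Banach space $V_{\alpha,r}$ (with respect to the norm $\|\cdot\|_{\alpha,r}$), and $V_{-\infty}$ is dense in the Fréchet space $V_{\alpha}$.
   Context: $C^{1}[0,\infty)$ denotes the complex-valued continuously differentiable functions on $[0,\infty)$ (one-sided derivative at $0$). The Laplace transform is $\mathcal{L}\{\tau;s\}=\int_0^\infty \tau(x)e^{-sx}\,dx$; if $\tau\in C^1[0,\infty)$ and $\tau'(x)\to0$ as $x\to\infty$, it converges for $\operatorname{Re}s>0$. When an analytic or continuous extension of $\mathcal{L}\{\tau;s\}$ exists, the extension is denoted by the same symbol. For real $\alpha<0$ and $r>0$, let $R_{\alpha,r}=\{s\in\mathbb{C}: \alpha<\operatorname{Re}s<1,\ |\operatorname{Im}s|<r\}$, with closure $\overline{R}_{\alpha,r}$, and $$\|\tau\|_{\alpha,r}=\|\tau'\|_{L^\infty[0,\infty)}+\sup_{s\in\overline{R}_{\alpha,r}}|\mathcal{L}\{\tau;s\}|.$$ $V_{\alpha,r}$ is the space of all $\tau\in C^1[0,\infty)$ such that $\tau'(x)\to 0$ as $x\to\infty$ and $\mathcal{L}\{\tau;s\}$ has analytic continuation to $R_{\alpha,r}$ and continuous extension to $\overline{R}_{\alpha,r}$; it is a Banach space with the norm $\|\cdot\|_{\alpha,r}$. For $\beta\in[-\infty,0)$, let $\mathbb{H}_\beta=\{s\in\mathbb{C}:\operatorname{Re}s>\beta\}$ (so $\mathbb{H}_{-\infty}=\mathbb{C}$). $V_\beta$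 is the space of all $\tau\in C^1[0,\infty)$ such that $\tau'(x)\to0$ as $x\to\infty$ and $\mathcal{L}\{\tau;s\}$ has analytic extension to $\mathbb{H}_\beta$; it is a Fréchet space with the topology generated by the norms $\|\cdot\|_{\alpha,r}$, $\beta<\alpha<0$, $r>0$. *)

(* Defs.v *)
From Stdlib Require Import Reals List.
From Coquelicot Require Import Coquelicot.
Open Scope R_scope.

(** Functions on [0,+oo) are represented by total functions [R -> C]; every
    notion below depends only on the values at nonnegative arguments. *)

Definition half_line (x : R) : Prop := 0 <= x.

(** Differentiation relative to [0,+oo): the usual derivative for [0 < x], the
    right derivative at [x = 0]. *)
Definition is_half_derive (tau : R -> C) (x : R) (l : C) : Prop :=
  filterdiff (K := R_AbsRing) (U := R_NormedModule) (V := C_R_NormedModule)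
    tau (within half_line (locally x))
    (fun h : R => scal (V := C_R_NormedModule) h l).

Definition half_derive (tau : R -> C) (x : R) : C :=
  iota (T := C_R_CompleteNormedModule) (is_half_derive tau x).

Definition C1_half_line (tau : R -> C) : Prop :=
  (forall x : R, 0 <= x -> exists l : C, is_half_derive tau x l) /\
  continuous_on half_line (half_derive tau).

Definition derive_vanishes_at_infty (tau : R -> C) : Prop :=
  filterlim (half_derive tau) (Rbar_locally p_infty) (locally (RtoC 0)).

(** Lebesgue null sets: for every [eps > 0] there is a countable cover by open
    intervals of total length at most [eps]. *)
Definition null_set (A : R -> Prop) : Prop :=
  forall eps : R, 0 < eps ->
  exists (a b : nat -> R) (l : R),
    (forall n : nat, a n <= b n) /\
    (forall x : R, A x -> exists n : nat, a n < x < b n) /\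
    is_series (fun n : nat => b n - a n) l /\ l <= eps.

(** Essential supremum of [|f|] on [0,+oo), [p_infty] if [f] is not
    essentially bounded. *)
Definition Linfty_norm (f : R -> C) : Rbar :=
  Glb_Rbar (fun M : R =>
    0 <= M /\ null_set (fun x : R => 0 <= x /\ M < Cmod (f x))).

Definition Cexp (z : C) : C :=
  (exp (Re z) * cos (Im z), exp (Re z) * sin (Im z)).

Definition laplace (tau : R -> C) (s : C) : C :=
  RInt_gen (V := C_R_CompleteNormedModule)
    (fun x : R => Cmult (tau x) (Cexp (Copp (Cmult s (RtoC x)))))
    (at_point 0) (Rbar_locally p_infty).

Definition analytic_at (F : C -> C) (z0 : C) : Prop :=
  exists a : nat -> C,
    locally z0 (fun z : C =>
      is_pseries (K := C_AbsRing) (V := C_NormedModule) a (Cminus z z0) (F z)).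

Definition rect (alpha r : R) (s : C) : Prop :=
  alpha < Re s < 1 /\ Rabs (Im s) < r.

Definition closed_rect (alpha r : R) (s : C) : Prop :=
  alpha <= Re s <= 1 /\ Rabs (Im s) <= r.

Definition is_laplace_ext_rect (alpha r : R) (tau : R -> C) (F : C -> C) : Prop :=
  (forall s : C, rect alpha r s -> analytic_at F s) /\
  continuous_on (closed_rect alpha r) F /\
  (forall s : C, closed_rect alpha r s -> 0 < Re s -> F s = laplace tau s).

(** The extension is unique on [closed_rect alpha r] by the identity theorem
    and continuity, so that [iota] selects its value at [s]. *)
Definition laplace_ext_rect (alpha r : R) (tau : R -> C) (s : C) : C :=
  iota (T := C_R_CompleteNormedModule)
    (fun w : C => exists F : C -> C, is_laplace_ext_rect alpha r tau F /\ F s = w).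

(** Both terms are nonnegative elements of [Rbar], and are finite on
    [V_rect alpha r]. *)
Definition norm_rect (alpha r : R) (tau : R -> C) : Rbar :=
  Rbar_plus (Linfty_norm (half_derive tau))
    (Lub_Rbar (fun y : R => exists s : C,
       closed_rect alpha r s /\ y = Cmod (laplace_ext_rect alpha r tau s))).

Definition V_rect (alpha r : R) (tau : R -> C) : Prop :=
  C1_half_line tau /\ derive_vanishes_at_infty tau /\
  exists F : C -> C, is_laplace_ext_rect alpha r tau F.

Definition is_laplace_ext_half_plane (beta : Rbar) (tau : R -> C) (F : C -> C) : Prop :=
  (forall s : C, Rbar_lt beta (Re s) -> analytic_at F s) /\
  (forall s : C, 0 < Re s -> F s = laplace tau s).

Definition V_half_plane (beta : Rbar) (tau : R -> C) : Prop :=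
  C1_half_line tau /\ derive_vanishes_at_infty tau /\
  exists F : C -> C, is_laplace_ext_half_plane beta tau F.

(** [U] is open in the topology on [E] generated by the family [N] of
    (semi)norms. *)
Definition norms_open (E : (R -> C) -> Prop) (N : ((R -> C) -> Rbar) -> Prop)
    (U : (R -> C) -> Prop) : Prop :=
  (forall tau, U tau -> E tau) /\
  forall tau, U tau ->
    exists (ps : list ((R -> C) -> Rbar)) (eps : R),
      (forall p, In p ps -> N p) /\ 0 < eps /\
      forall sigma, E sigma ->
        (forall p, In p ps ->
           Rbar_lt (p (fun x : R => Cminus (sigma x) (tau x))) eps) ->
        U sigma.

(** [D] is a dense subset of [E] for that topology. *)
Definition dense_in (E : (R -> C) -> Prop) (N : ((R -> C) -> Rbar) -> Prop)
    (D : (R -> C) -> Prop) : Prop :=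
  (forall tau, D tau -> E tau) /\
  forall U, norms_open E N U -> (exists tau, U tau) ->
    exists sigma, U sigma /\ D sigma.

Definition banach_norm (alpha r : R) (p : (R -> C) -> Rbar) : Prop :=
  p = norm_rect alpha r.

Definition frechet_norms (beta : Rbar) (p : (R -> C) -> Rbar) : Prop :=
  exists alpha r : R,
    Rbar_lt beta alpha /\ alpha < 0 /\ 0 < r /\ p = norm_rect alpha r.

(* Main.v *)
Require Import Defs.
From Stdlib Require Import Reals Lra Lia List Factorial FunctionalExtensionality.
From Stdlib Require Import Classical ClassicalEpsilon.
From Coquelicot Require Import Coquelicot.
Open Scope R_scope.

(** Fix [tau] in [V_rect alpha r] with Laplace transform [F].  Replacing [tau x]
    by [tau (L x) exp (- eta x)] with [L = 1 + 2 eta] changes it little in norm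
    for small [eta] (since [tau' x -> 0] makes [tau] sublinear), makes it decay
    exponentially and makes its transform analytic on a neighbourhood of the
    closed rectangle.

    Let [T] decay like [exp (- c x)] and have transform [G], with
    [|G^(k)| <= M k! B^k].  The function
    [T x * exp (- h x) * sum_(j < n) (h x)^j / j!] has as transform the Taylor
    polynomial of [G] at [s + h], evaluated at [s].  For fixed small [h] and
    [n -> oo] it converges to [G s] uniformly on the rectangle, and the functions
    converge together with their derivatives uniformly on [0,+oo); yet each of
    them decays like [exp (- (c + h/2) x)].  The transform at [s] only uses the
    derivatives of [G] at [s + h], so that neither [B] nor [h] has to be changed
    and the step can be iterated until the decay beats [exp (alpha x)].  Then a
    smooth cutoff far out changes the transform little on the whole rectangle,
    and the result has compact support, hence an entire transform. *)

(** * Improper integrals of exponentially decaying functions *)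

(** The obstacle is that continuation to Re s < 0 gives no decay of tau, even when F extends to a
    neighbourhood of the closed rectangle: left of 0 the transform is not an integral, and a cutoff
    of tau gives no control of it there. The damping factors turn the continuation into an integral
    further and further to the left, at the price of a Taylor remainder that only sees derivatives
    of G. The number L = 1 + 2 eta is chosen because the damped dilate has the transform F((s + eta)
    / L) / L, and s |-> (s + eta) / L contracts the plane towards its fixed point 1/2. This point
    lies inside the rectangle, so the closed rectangle goes into the open one, horizontal sides
    included; damping alone would only move s to the right. The condition h B <= 1/4 lets the
    remainder, of size (h B)^n times a binomial coefficient of order at most 2^n, decrease like
    2^(-n). All estimates concern real functions of u = Re s; the imaginary part of s is a bounded
    parameter in an oscillating factor, and the constants are uniform in it. *)

Lemma exp_le_compat (x y : R) : x <= y -> exp x <= exp y.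
Proof.
intros [H | ->]; [left; now apply exp_increasing | apply Rle_refl].
Qed.

Lemma is_RInt_exp (c a b : R) : c <> 0 ->
  is_RInt (fun x => exp (- (c * x))) a b ((exp (- (c * a)) - exp (- (c * b))) / c).
Proof.
intros Hc.
replace ((exp (- (c * a)) - exp (- (c * b))) / c)
  with (minus (- exp (- (c * b)) / c) (- exp (- (c * a)) / c)).
2:{ unfold minus, plus, opp; simpl; field; exact Hc. }
apply (is_RInt_derive (fun x => - exp (- (c * x)) / c)).
- intros x _; auto_derive; [easy | field; exact Hc].
- intros x _; apply (ex_derive_continuous (fun x => exp (- (c * x)))); auto_derive; easy.
Qed.

Lemma ex_RInt_cont (f : R -> R) (a b : R) :
  (forall x, continuous f x) -> ex_RInt f a b.
Proof.
intros Hf; apply (ex_RInt_continuous (V := R_CompleteNormedModule)).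
intros; apply Hf.
Qed.

Definition edec (f : R -> R) (C c : R) : Prop :=
  forall x, 0 <= x -> Rabs (f x) <= C * exp (- (c * x)).

Lemma RInt_tail_le (f : R -> R) (C c a b : R) :
  (forall x, continuous f x) -> edec f C c -> 0 < c -> 0 <= a <= b ->
  Rabs (RInt f a b) <= C / c * exp (- (c * a)).
Proof.
intros Hf Hd Hc [Ha Hab].
assert (HC : 0 <= C).
{ specialize (Hd 0 (Rle_refl 0)). rewrite Rmult_0_r, Ropp_0, exp_0 in Hd.
  pose proof (Rabs_pos (f 0)). lra. }
apply Rle_trans with (C * ((exp (- (c * a)) - exp (- (c * b))) / c)).
- apply (norm_RInt_le f (fun x => C * exp (- (c * x))) a b).
  + exact Hab.
  + intros x Hx. apply Hd. lra.
  + apply (RInt_correct (V := R_CompleteNormedModule)), ex_RInt_cont, Hf.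
  + apply (is_RInt_scal (V := R_NormedModule) _ _ _ C), is_RInt_exp. lra.
- unfold Rdiv. rewrite Rmult_assoc. apply Rmult_le_compat_l; [exact HC|].
  rewrite Rmult_comm.
  apply Rmult_le_compat_l; [left; apply Rinv_0_lt_compat, Hc|].
  pose proof (exp_pos (- (c * b))). lra.
Qed.

(** The improper integral over the half-line as a total function: [real] and [Lim] return a value in
    every case, so the algebraic rules below carry the decay that makes the limit exist. *)
Definition II (f : R -> R) : R := real (Lim (fun b => RInt f 0 b) p_infty).

Lemma RInt_Chasles_cont (f : R -> R) (a b c : R) :
  (forall x, continuous f x) -> RInt f a c = RInt f a b + RInt f b c.
Proof.
intros Hf; symmetry.
apply (RInt_Chasles (V := R_CompleteNormedModule)); apply ex_RInt_cont, Hf.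
Qed.

Lemma RInt_diff (f : R -> R) (a b c : R) :
  (forall x, continuous f x) -> RInt f a c - RInt f a b = RInt f b c.
Proof.
intros Hf. rewrite (RInt_Chasles_cont f a b c Hf).
apply Rplus_minus_l.
Qed.

Lemma exp_tail_small (C c eps : R) : 0 < c -> 0 < eps ->
  exists N, 0 <= N /\ forall x, N <= x -> C * exp (- (c * x)) <= eps.
Proof.
intros Hc He.
set (A := Rmax C 1).
assert (HA : 1 <= A) by apply Rmax_r.
exists (Rmax 0 (- ln (eps / A) / c)). split; [apply Rmax_l|].
intros x Hx.
apply Rle_trans with (A * exp (- (c * x))).
{ apply Rmult_le_compat_r; [left; apply exp_pos | apply Rmax_l]. }
assert (H : exp (- (c * x)) <= eps / A).
{ rewrite <- (exp_ln (eps / A)).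
  2:{ apply Rdiv_lt_0_compat; lra. }
  apply exp_le_compat.
  assert (Hx2 := Rle_trans _ _ _ (Rmax_r _ _) Hx).
  apply (Rmult_le_compat_l c) in Hx2; [|lra].
  replace (c * (- ln (eps / A) / c)) with (- ln (eps / A)) in Hx2 by (field; lra).
  lra. }
apply (Rmult_le_compat_l A) in H; [|lra].
replace (A * (eps / A)) with eps in H by (field; lra). exact H.
Qed.

Lemma II_lim (f : R -> R) (C c : R) :
  (forall x, continuous f x) -> edec f C c -> 0 < c ->
  is_lim (fun b => RInt f 0 b) p_infty (II f).
Proof.
intros Hf Hd Hc.
assert (Hex : exists l : R, filterlim (fun b => RInt f 0 b) (Rbar_locally p_infty) (locally l)).
{ apply (filterlim_locally_cauchy (U := R_CompleteSpace)
    (F := Rbar_locally p_infty) (fun b => RInt f 0 b)).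
  intros eps.
  destruct (exp_tail_small (C / c) c (eps / 2) Hc) as [N [HN HNx]].
  { destruct eps; simpl; lra. }
  exists (fun b => N < b). split; [exists N; easy|].
  assert (H : forall u v, N < u -> u <= v -> Rabs (RInt f 0 v - RInt f 0 u) < eps).
  { intros u v Hu Hv. rewrite (RInt_diff f 0 u v Hf).
    apply Rle_lt_trans with (C / c * exp (- (c * u))).
    - apply RInt_tail_le; try easy. lra.
    - specialize (HNx u ltac:(lra)). destruct eps; simpl in *; lra. }
  intros u v Hu Hv. change (Rabs (RInt f 0 v - RInt f 0 u) < eps).
  destruct (Rle_dec u v) as [Huv|Huv].
  + now apply H.
  + rewrite Rabs_minus_sym. apply H; [exact Hv|lra]. }
destruct Hex as [l Hl].
assert (HL : is_lim (fun b => RInt f 0 b) p_infty (Finite l)) by exact Hl.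
unfold II. rewrite (is_lim_unique _ _ _ HL). exact HL.
Qed.

Lemma II_tail (f : R -> R) (C c b : R) :
  (forall x, continuous f x) -> edec f C c -> 0 < c -> 0 <= b ->
  Rabs (II f - RInt f 0 b) <= C / c * exp (- (c * b)).
Proof.
intros Hf Hd Hc Hb.
assert (H := II_lim f C c Hf Hd Hc).
change (Rbar_le (Rabs (II f - RInt f 0 b)) (C / c * exp (- (c * b)))).
apply (is_lim_le_loc (fun t => Rabs (RInt f 0 t - RInt f 0 b))
  (fun _ => C / c * exp (- (c * b))) p_infty).
- exists b. intros x Hx. rewrite (RInt_diff f 0 b x Hf).
  apply RInt_tail_le; try easy. lra.
- apply (is_lim_comp_continuous (fun t => RInt f 0 t - RInt f 0 b) Rabs p_infty
    (II f - RInt f 0 b)); [|apply continuous_Rabs].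
  apply (is_lim_minus' _ _ _ _ _ H), is_lim_const.
- apply is_lim_const.
Qed.

Lemma II_bound (f : R -> R) (C c : R) :
  (forall x, continuous f x) -> edec f C c -> 0 < c -> Rabs (II f) <= C / c.
Proof.
intros Hf Hd Hc.
assert (H := II_tail f C c 0 Hf Hd Hc (Rle_refl 0)).
rewrite RInt_point, Rmult_0_r, Ropp_0, exp_0 in H.
unfold zero in H; simpl in H. rewrite Rminus_0_r in H. lra.
Qed.

Lemma II_unique (f : R -> R) (l : R) :
  is_lim (fun b => RInt f 0 b) p_infty l -> II f = l.
Proof. intros H. unfold II. now rewrite (is_lim_unique _ _ _ H). Qed.

Lemma II_ext (f g : R -> R) : (forall x, 0 <= x -> f x = g x) -> II f = II g.
Proof.
intros H. unfold II. f_equal. apply Lim_ext_loc. exists 0. intros b Hb.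
apply RInt_ext. intros x Hx. symmetry. apply H. rewrite Rmin_left in Hx; lra.
Qed.

Lemma II_plus (f g : R -> R) (C c D d : R) :
  (forall x, continuous f x) -> edec f C c -> 0 < c ->
  (forall x, continuous g x) -> edec g D d -> 0 < d ->
  II (fun x => f x + g x) = II f + II g.
Proof.
intros Hf Hfd Hc Hg Hgd Hd. apply II_unique.
apply is_lim_ext with (fun b => RInt f 0 b + RInt g 0 b).
- intros b. symmetry.
  apply (RInt_plus (V := R_CompleteNormedModule)); now apply ex_RInt_cont.
- apply (is_lim_plus' _ _ _ _ _ (II_lim f C c Hf Hfd Hc) (II_lim g D d Hg Hgd Hd)).
Qed.

Lemma II_scal (f : R -> R) (k C c : R) :
  (forall x, continuous f x) -> edec f C c -> 0 < c ->
  II (fun x => k * f x) = k * II f.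
Proof.
intros Hf Hfd Hc. apply II_unique.
apply is_lim_ext with (fun b => k * RInt f 0 b).
- intros b. symmetry.
  apply (RInt_scal (V := R_CompleteNormedModule)); now apply ex_RInt_cont.
- apply (is_lim_scal_l _ k _ _ (II_lim f C c Hf Hfd Hc)).
Qed.

Lemma edec_mono (f : R -> R) (C c d : R) : d <= c -> edec f C c -> edec f C d.
Proof.
intros Hdc H x Hx. apply Rle_trans with (1 := H x Hx).
assert (HC : 0 <= C).
{ specialize (H 0 (Rle_refl 0)). rewrite Rmult_0_r, Ropp_0, exp_0 in H.
  pose proof (Rabs_pos (f 0)). lra. }
apply Rmult_le_compat_l; [exact HC|]. apply exp_le_compat.
apply Ropp_le_contravar, Rmult_le_compat_r; lra.
Qed.

Lemma edec_nonneg (f : R -> R) (C c : R) : edec f C c -> 0 <= C.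
Proof.
intros H. specialize (H 0 (Rle_refl 0)). rewrite Rmult_0_r, Ropp_0, exp_0 in H.
pose proof (Rabs_pos (f 0)). lra.
Qed.

(** * Partial sums of the exponential series *)

Fixpoint psum (a : nat -> R) (n : nat) : R :=
  match n with O => 0 | S m => psum a m + a m end.

Lemma psum_ext (a b : nat -> R) (n : nat) :
  (forall j, (j < n)%nat -> a j = b j) -> psum a n = psum b n.
Proof.
intros H; induction n as [|n IH]; [easy|]; simpl.
rewrite IH, H; auto.
Qed.

Lemma psum_le (a b : nat -> R) (n : nat) :
  (forall j, (j < n)%nat -> a j <= b j) -> psum a n <= psum b n.
Proof.
intros H; induction n as [|n IH]; simpl; [lra|].
assert (a n <= b n) by auto. assert (psum a n <= psum b n) by auto. lra.
Qed.

Lemma psum_scal (k : R) (a : nat -> R) (n : nat) :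
  psum (fun j => k * a j) n = k * psum a n.
Proof. induction n as [|n IH]; simpl; [|rewrite IH]; ring. Qed.

Lemma psum_Rabs (a : nat -> R) (n : nat) :
  Rabs (psum a n) <= psum (fun j => Rabs (a j)) n.
Proof.
induction n as [|n IH]; simpl; [rewrite Rabs_R0; lra|].
pose proof (Rabs_triang (psum a n) (a n)). lra.
Qed.

Lemma psum_derive (f df : nat -> R -> R) (n : nat) (x : R) :
  (forall j, is_derive (f j) x (df j x)) ->
  is_derive (fun y => psum (fun j => f j y) n) x (psum (fun j => df j x) n).
Proof.
intros H; induction n as [|n IH]; simpl.
- apply (is_derive_const (K := R_AbsRing) (V := R_NormedModule) 0).
- apply (is_derive_plus (K := R_AbsRing) (V := R_NormedModule)); auto.
Qed.

Lemma INR_fact_pos (n : nat) : 0 < INR (fact n).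
Proof. apply INR_fact_lt_0. Qed.

Lemma INR_fact_S (n : nat) : INR (fact (S n)) = INR (S n) * INR (fact n).
Proof. now rewrite fact_simpl, mult_INR. Qed.

Definition exp_sum (n : nat) (y : R) : R := psum (fun j => y ^ j / INR (fact j)) n.

Lemma is_derive_pow_fact (n : nat) (y : R) :
  is_derive (fun y => y ^ (S n) / INR (fact (S n))) y (y ^ n / INR (fact n)).
Proof.
pose proof (INR_fact_pos n) as H0. pose proof (pos_INR n) as H1.
pose proof (INR_fact_S n) as H2. rewrite S_INR in H2.
generalize dependent (INR (fact (S n))). intros c Hc.
auto_derive; [easy|]. rewrite Hc.
change (match n with O => 1 | S _ => INR n + 1 end) with (INR (S n)). rewrite S_INR.
simpl Nat.pred. field. lra.
Qed.

Lemma is_derive_exp_sum (n : nat) (y : R) :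
  is_derive (exp_sum (S n)) y (exp_sum n y).
Proof.
induction n as [|n IH].
- apply is_derive_ext with (fun _ => 1).
  + intros t. unfold exp_sum. simpl. field.
  + apply (is_derive_const (K := R_AbsRing) (V := R_NormedModule) 1).
- apply (is_derive_plus (K := R_AbsRing) (V := R_NormedModule)
    (exp_sum (S n)) (fun y => y ^ (S n) / INR (fact (S n)))).
  + exact IH.
  + apply is_derive_pow_fact.
Qed.

Lemma nonneg_of_derive (f df : R -> R) (y : R) :
  (forall x, is_derive f x (df x)) -> (forall x, 0 <= x -> 0 <= df x) ->
  0 <= f 0 -> 0 <= y -> 0 <= f y.
Proof.
intros Hd Hp H0 Hy.
destruct (MVT_gen f 0 y df) as [c [Hc He]].
- intros; apply Hd.
- intros x _. apply continuity_pt_filterlim.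
  apply (ex_derive_continuous (K := R_AbsRing) (V := R_NormedModule) f).
  eexists; apply Hd.
- rewrite Rmin_left in Hc by lra. specialize (Hp c ltac:(lra)). nra.
Qed.

Lemma exp_sum_0 (n : nat) : exp_sum (S n) 0 = 1.
Proof.
induction n as [|n IH].
- unfold exp_sum; simpl; field.
- change (exp_sum (S n) 0 + 0 ^ (S n) / INR (fact (S n)) = 1).
  rewrite IH, pow_ne_zero by easy. unfold Rdiv. ring.
Qed.

(** The difference exp - [exp_sum (S n)] vanishes at 0 and has the derivative exp - [exp_sum n],
    which is nonnegative by induction. *)
Lemma exp_sum_le_exp (n : nat) (y : R) : 0 <= y -> exp_sum n y <= exp y.
Proof.
revert y. induction n as [|n IH]; intros y Hy.
- unfold exp_sum; simpl. left; apply exp_pos.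
- enough (0 <= exp y - exp_sum (S n) y) by lra.
  apply (nonneg_of_derive (fun y => exp y - exp_sum (S n) y)
    (fun y => exp y - exp_sum n y)); [| | |exact Hy].
  + intros x. apply (is_derive_minus (K := R_AbsRing) (V := R_NormedModule)).
    * apply is_derive_exp.
    * apply is_derive_exp_sum.
  + intros x Hx. specialize (IH x Hx). lra.
  + rewrite exp_sum_0, exp_0. lra.
Qed.

Lemma exp_sum_remainder (n : nat) (y : R) : 0 <= y ->
  exp y - exp_sum n y <= y ^ n / INR (fact n) * exp y.
Proof.
revert y. induction n as [|n IH]; intros y Hy.
- unfold exp_sum; simpl. lra.
- enough (0 <= y ^ (S n) / INR (fact (S n)) * exp y - (exp y - exp_sum (S n) y)) by lra.
  apply (nonneg_of_derive
    (fun y => y ^ (S n) / INR (fact (S n)) * exp y - (exp y - exp_sum (S n) y))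
    (fun y => (y ^ n / INR (fact n) * exp y + y ^ (S n) / INR (fact (S n)) * exp y)
       - (exp y - exp_sum n y))); [| | |exact Hy].
  + intros x. apply (is_derive_minus (K := R_AbsRing) (V := R_NormedModule)).
    * apply (is_derive_mult (fun y => y ^ (S n) / INR (fact (S n))) exp).
      -- apply is_derive_pow_fact.
      -- apply is_derive_exp.
      -- intros; apply Rmult_comm.
    * apply (is_derive_minus (K := R_AbsRing) (V := R_NormedModule)).
      -- apply is_derive_exp.
      -- apply is_derive_exp_sum.
  + intros x Hx. specialize (IH x Hx).
    assert (0 <= x ^ (S n) / INR (fact (S n)) * exp x).
    { apply Rmult_le_pos; [|left; apply exp_pos].
      apply Rdiv_le_0_compat; [now apply pow_le|apply INR_fact_pos]. }
    lra.
  + rewrite exp_sum_0, exp_0, pow_ne_zero by easy. unfold Rdiv. lra.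
Qed.

Lemma exp_sum_pos (n : nat) (y : R) : 0 <= y -> 0 <= exp_sum n y.
Proof.
intros Hy. induction n as [|n IH]; unfold exp_sum in *; simpl; [lra|].
assert (0 <= y ^ n / INR (fact n)).
{ apply Rdiv_le_0_compat; [now apply pow_le|apply INR_fact_pos]. }
lra.
Qed.

Lemma pow_fact_le_exp (n : nat) (y : R) : 0 <= y -> y ^ n / INR (fact n) <= exp y.
Proof.
intros Hy. apply Rle_trans with (exp_sum (S n) y).
- change (y ^ n / INR (fact n) <= exp_sum n y + y ^ n / INR (fact n)).
  pose proof (exp_sum_pos n y Hy). lra.
- now apply exp_sum_le_exp.
Qed.

(** Every term has degree below [n], so writing y^j = 2^j (y/2)^j costs at most 2^n. Multiplied by
    exp (- y) this leaves exp (- y/2): here the rate h/2 gained by each shift arises. *)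
Lemma exp_sum_half (n : nat) (y : R) : 0 <= y -> exp_sum n y <= 2 ^ n * exp (y / 2).
Proof.
intros Hy. apply Rle_trans with (2 ^ n * exp_sum n (y / 2)).
- unfold exp_sum. rewrite <- psum_scal. apply psum_le. intros j Hj.
  assert (H1 : 2 ^ j <= 2 ^ n) by (apply Rle_pow; [lra|lia]).
  assert (H2 : 0 <= (y / 2) ^ j / INR (fact j)).
  { apply Rdiv_le_0_compat; [apply pow_le; lra|apply INR_fact_pos]. }
  replace (y ^ j / INR (fact j)) with (2 ^ j * ((y / 2) ^ j / INR (fact j))).
  + now apply Rmult_le_compat_r.
  + unfold Rdiv. rewrite Rpow_mult_distr, pow_inv. field.
    split; [apply INR_fact_neq_0|apply pow_nonzero; lra].
- apply Rmult_le_compat_l; [apply pow_le; lra|]. apply exp_sum_le_exp. lra.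
Qed.

(** A single term of the exponential series at a x never exceeds exp (a x). *)
Lemma pow_exp_bound (k : nat) (a x : R) : 0 < a -> 0 <= x ->
  x ^ k * exp (- (a * x)) <= INR (fact k) / a ^ k.
Proof.
intros Ha Hx.
assert (H := pow_fact_le_exp k (a * x) ltac:(nra)).
rewrite Rpow_mult_distr in H. rewrite exp_Ropp.
assert (Hk := INR_fact_pos k). assert (Hak := pow_lt a k Ha).
assert (He := exp_pos (a * x)).
apply Rmult_le_reg_r with (a ^ k / INR (fact k) * exp (a * x)).
{ apply Rmult_lt_0_compat; [now apply Rdiv_lt_0_compat|exact He]. }
field_simplify; lra.
Qed.

Lemma exp_quad (y : R) : Rabs (exp y - 1 - y) <= y ^ 2 * exp (Rabs y).
Proof.
destruct (Rle_dec 0 y) as [Hy|Hy].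
- rewrite (Rabs_pos_eq y Hy).
  assert (H1 := exp_sum_le_exp 2 y Hy). assert (H2 := exp_sum_remainder 2 y Hy).
  assert (He : exp_sum 2 y = 1 + y) by (unfold exp_sum; simpl; field).
  rewrite He in H1, H2. simpl fact in H2. simpl INR in H2.
  assert (0 <= y ^ 2 * exp y) by (apply Rmult_le_pos; [nra|left; apply exp_pos]).
  rewrite Rabs_pos_eq; lra.
- assert (H1 := exp_ineq1_le y). assert (H2 := exp_ineq1_le (- y)).
  assert (He := exp_pos y). rewrite exp_Ropp in H2.
  (* For y < 0 this gives exp y <= 1 / (1 - y), whence exp y - 1 - y <= y^2 / (1 - y) <= y^2. *)
  assert (H3 : exp y * (1 - y) <= 1).
  { apply (Rmult_le_compat_l (exp y)) in H2; [|lra]. rewrite Rinv_r in H2; lra. }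
  rewrite (Rabs_pos_eq (exp y - 1 - y)) by lra.
  apply Rle_trans with (y ^ 2).
  + nra.
  + assert (1 <= exp (Rabs y)).
    { rewrite <- exp_0. apply exp_le_compat, Rabs_pos. }
    nra.
Qed.

(** A quadratic error bound survives integration and summation, whereas pointwise differentiability
    does not; it replaces the exchange of the derivative with integrals and series below. *)
Lemma is_derive_quad (f : R -> R) (u l d K : R) : 0 < d ->
  (forall h, Rabs h < d -> Rabs (f (u + h) - f u - h * l) <= K * h ^ 2) ->
  is_derive f u l.
Proof.
intros Hd H. apply is_derive_Reals. intros eps Heps.
assert (HK : 0 < Rabs K + 1) by (pose proof (Rabs_pos K); lra).
assert (Hdd : 0 < Rmin d (eps / (Rabs K + 1))).
{ apply Rmin_pos; [lra|now apply Rdiv_lt_0_compat]. }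
exists (mkposreal _ Hdd). simpl. intros h Hh0 Hh.
assert (Hh1 := Rlt_le_trans _ _ _ Hh (Rmin_l _ _)).
assert (Hh2 := Rlt_le_trans _ _ _ Hh (Rmin_r _ _)).
specialize (H h Hh1).
assert (Ha : 0 < Rabs h) by now apply Rabs_pos_lt.
replace ((f (u + h) - f u) / h - l) with ((f (u + h) - f u - h * l) / h) by (field; easy).
unfold Rdiv. rewrite Rabs_mult, Rabs_inv.
apply Rmult_lt_reg_r with (Rabs h); [exact Ha|].
rewrite Rmult_assoc, Rinv_l, Rmult_1_r by lra.
apply Rle_lt_trans with (1 := H).
replace (h ^ 2) with (Rabs h * Rabs h) by (rewrite <- pow2_abs; ring).
apply Rle_lt_trans with (Rabs K * Rabs h * Rabs h).
{ rewrite <- Rmult_assoc. apply Rmult_le_compat_r; [lra|].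
  apply Rmult_le_compat_r; [lra|apply Rle_abs]. }
apply Rmult_lt_compat_r; [exact Ha|].
apply (Rmult_lt_compat_l (Rabs K + 1)) in Hh2; [|exact HK].
replace ((Rabs K + 1) * (eps / (Rabs K + 1))) with eps in Hh2 by (field; lra). nra.
Qed.

(** * Laplace transforms and their derivatives along the real direction *)

Lemma cont_mult (f g : R -> R) :
  (forall x, continuous f x) -> (forall x, continuous g x) ->
  forall x, continuous (fun y => f y * g y) x.
Proof. intros Hf Hg x. apply (continuous_mult (K := R_AbsRing)); auto. Qed.

Lemma cont_derivable (f : R -> R) : (forall x, ex_derive f x) -> forall x, continuous f x.
Proof. intros H x. apply (ex_derive_continuous (K := R_AbsRing) (V := R_NormedModule)), H. Qed.

Lemma cont_psum (F : nat -> R -> R) (n : nat) :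
  (forall j x, continuous (F j) x) ->
  forall x, continuous (fun y => psum (fun j => F j y) n) x.
Proof.
intros H x. induction n as [|n IH]; simpl.
- apply continuous_const.
- apply (continuous_plus (V := R_NormedModule)); [exact IH|apply H].
Qed.

(** The integrand of the k-th derivative of the Laplace transform at a real point; (- x)^k comes
    from differentiating exp (- u x). The imaginary part of s is left to the oscillating factor
    inside [f], see [wave_at]. *)
Definition lap_int (k : nat) (f : R -> R) (u x : R) : R :=
  (- x) ^ k * f x * exp (- (u * x)).

Definition Lap (k : nat) (f : R -> R) (u : R) : R := II (lap_int k f u).

Lemma cont_lap_int (k : nat) (f : R -> R) (u : R) :
  (forall x, continuous f x) -> forall x, continuous (lap_int k f u) x.
Proof.
intros Hf. apply (cont_mult (fun x => (- x) ^ k * f x)); [apply cont_mult; [|exact Hf]|];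
  apply cont_derivable; intros; auto_derive; easy.
Qed.

(** Splitting exp (- c x) and spending the rate c - d on the power x^k costs the constant k! / (c -
    d)^k. *)
Lemma edec_pow (k : nat) (f : R -> R) (C c d : R) :
  edec f C c -> d < c -> edec (fun x => x ^ k * f x) (C * (INR (fact k) / (c - d) ^ k)) d.
Proof.
intros Hf Hd x Hx. assert (HC := edec_nonneg f C c Hf).
rewrite Rabs_mult, Rabs_pos_eq by now apply pow_le.
apply Rle_trans with (x ^ k * (C * exp (- (c * x)))).
{ apply Rmult_le_compat_l; [now apply pow_le|now apply Hf]. }
replace (- (c * x)) with (- ((c - d) * x) + - (d * x)) by ring.
rewrite exp_plus.
replace (x ^ k * (C * (exp (- ((c - d) * x)) * exp (- (d * x)))))
  with (C * (x ^ k * exp (- ((c - d) * x))) * exp (- (d * x))) by ring.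
apply Rmult_le_compat_r; [left; apply exp_pos|].
apply Rmult_le_compat_l; [exact HC|]. apply pow_exp_bound; lra.
Qed.

Lemma edec_exp (f : R -> R) (C c u : R) :
  edec f C c -> edec (fun x => f x * exp (- (u * x))) C (c + u).
Proof.
intros Hf x Hx. rewrite Rabs_mult, (Rabs_pos_eq (exp _)) by (left; apply exp_pos).
replace (- ((c + u) * x)) with (- (c * x) + - (u * x)) by ring. rewrite exp_plus, <- Rmult_assoc.
apply Rmult_le_compat_r; [left; apply exp_pos|now apply Hf].
Qed.

Lemma edec_lap_int (k : nat) (f : R -> R) (C c d u : R) :
  edec f C c -> d < c + u ->
  edec (lap_int k f u) (C * (INR (fact k) / (c + u - d) ^ k)) d.
Proof.
intros Hf Hd.
assert (H := edec_pow k _ C (c + u) d (edec_exp f C c u Hf) Hd).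
intros x Hx. specialize (H x Hx). unfold lap_int. rewrite 2!Rabs_mult.
rewrite <- RPow_abs, Rabs_Ropp, RPow_abs. now rewrite Rmult_assoc, <- 2!Rabs_mult.
Qed.

Lemma Lap_bound (k : nat) (f : R -> R) (C c u : R) :
  (forall x, continuous f x) -> edec f C c -> 0 < c + u ->
  Rabs (Lap k f u) <= C * (INR (fact k) / ((c + u) / 2) ^ k) / ((c + u) / 2).
Proof.
intros Hf Hd Hc. apply II_bound.
- now apply cont_lap_int.
- assert (H := edec_lap_int k f C c ((c + u) / 2) u Hd ltac:(lra)).
  replace (c + u - (c + u) / 2) with ((c + u) / 2) in H by field. exact H.
- lra.
Qed.

(** The second-order remainder of exp (- h x) is at most (h x)^2 exp (|h| x), so the error of the
    first-order expansion is h^2 times an integral with the power x^(k+2) and a slightly slower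
    exponential; [is_derive_quad] concludes. *)
Lemma Lap_derive (k : nat) (f : R -> R) (C c u : R) :
  (forall x, continuous f x) -> edec f C c -> 0 < c + u ->
  is_derive (Lap k f) u (Lap (S k) f u).
Proof.
(* With c + u = 4 a and |h| < a, the integrand at u + h still decays faster than exp (- 3 a x),
   which leaves room for the rates 2 a and a used below. *)
intros Hf Hd Hc. set (a := (c + u) / 4).
assert (Ha : 0 < a) by (unfold a; lra).
apply (is_derive_quad _ _ _ a (C * (INR (fact (k + 2)) / a ^ (k + 2)) / a) Ha).
intros h Hh.
assert (Hh' := Rabs_def2 _ _ Hh).
assert (HI : forall j v, - c + a < v -> exists D, edec (lap_int j f v) D a).
{ intros j v Hv. eexists. apply (edec_lap_int j f C c a v Hd). lra. }
assert (H1 : - c + a < u) by (unfold a in *; lra).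
assert (H2 : - c + a < u + h) by (unfold a in *; lra).
destruct (HI k (u + h) H2) as [D1 HD1].
destruct (HI k u H1) as [D2 HD2].
destruct (HI (S k) u H1) as [D3 HD3].
assert (Hedec : forall g D (l : R), edec g D a -> edec (fun x => l * g x) (Rabs l * D) a).
{ intros g D l Hg x Hx. rewrite Rabs_mult, Rmult_assoc.
  apply Rmult_le_compat_l; [apply Rabs_pos|now apply Hg]. }
assert (Heq : Lap k f (u + h) - Lap k f u - h * Lap (S k) f u =
  II (fun x => lap_int k f (u + h) x + (-1 * lap_int k f u x + - h * lap_int (S k) f u x))).
{ rewrite (II_plus _ _ D1 a (Rabs (-1) * D2 + Rabs (- h) * D3) a).
  - rewrite (II_plus _ _ (Rabs (-1) * D2) a (Rabs (- h) * D3) a).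
    + rewrite (II_scal _ (-1) D2 a), (II_scal _ (- h) D3 a); try easy;
        try (now apply cont_lap_int). unfold Lap. ring.
    + intros x. apply (continuous_scal_r (K := R_AbsRing) (V := R_NormedModule)).
      now apply cont_lap_int.
    + now apply Hedec.
    + easy.
    + intros x. apply (continuous_scal_r (K := R_AbsRing) (V := R_NormedModule)).
      now apply cont_lap_int.
    + now apply Hedec.
    + easy.
  - now apply cont_lap_int.
  - easy.
  - easy.
  - intros x. apply (continuous_plus (V := R_NormedModule));
    apply (continuous_scal_r (K := R_AbsRing) (V := R_NormedModule));
      now apply cont_lap_int.
  - intros x Hx. apply Rle_trans with (1 := Rabs_triang _ _).
    rewrite Rmult_plus_distr_r. apply Rplus_le_compat.
    + now apply (Hedec (lap_int k f u)).
    + now apply (Hedec (lap_int (S k) f u)).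
  - easy. }
rewrite Heq.
replace (C * (INR (fact (k + 2)) / a ^ (k + 2)) / a * h ^ 2)
  with ((h ^ 2 * (C * (INR (fact (k + 2)) / a ^ (k + 2)))) / a) by (unfold Rdiv; ring).
apply II_bound; [| |exact Ha].
- intros x. repeat apply (continuous_plus (V := R_NormedModule));
    try apply (continuous_scal_r (K := R_AbsRing) (V := R_NormedModule));
      now apply cont_lap_int.
- intros x Hx.
  (* The majorant is the integrand at 2 a - c, a point left of u - |h|; its rate 2 a exceeds [a] by
     [a], which pays for the power. *)
  assert (H := edec_lap_int (k + 2) f C c a (2 * a - c) Hd ltac:(lra) x Hx).
  replace (c + (2 * a - c) - a) with a in H by ring.
  rewrite Rmult_assoc.
  eapply Rle_trans; [|apply Rmult_le_compat_l; [apply pow2_ge_0|exact H]].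
  unfold lap_int.
  replace (exp (- ((u + h) * x))) with (exp (- (u * x)) * exp (- h * x))
    by (rewrite <- exp_plus; f_equal; ring).
  replace ((- x) ^ k * f x * (exp (- (u * x)) * exp (- h * x)) +
    (-1 * ((- x) ^ k * f x * exp (- (u * x))) +
     - h * ((- x) ^ S k * f x * exp (- (u * x)))))
  with ((- x) ^ k * f x * exp (- (u * x)) * (exp (- h * x) - 1 - - h * x)) by (simpl; ring).
  rewrite pow_add.
  rewrite !Rabs_mult.
  replace (h ^ 2 * (Rabs ((- x) ^ k) * Rabs ((- x) ^ 2) * Rabs (f x) * Rabs (exp (- ((2 * a - c) * x)))))
    with (Rabs ((- x) ^ k) * Rabs (f x) * (h ^ 2 * Rabs ((- x) ^ 2) * Rabs (exp (- ((2 * a - c) * x)))))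
    by ring.
  rewrite (Rmult_assoc (Rabs _ * Rabs _)).
  apply Rmult_le_compat_l; [apply Rmult_le_pos; apply Rabs_pos|].
  rewrite !(Rabs_pos_eq (exp _)) by (left; apply exp_pos).
  rewrite (Rabs_pos_eq ((- x) ^ 2)) by apply pow2_ge_0.
  eapply Rle_trans; [apply Rmult_le_compat_l; [left; apply exp_pos|apply exp_quad]|].
  replace ((- h * x) ^ 2) with (h ^ 2 * (- x) ^ 2) by ring.
  rewrite (Rmult_comm (exp (- (u * x)))), Rmult_assoc.
  apply Rmult_le_compat_l; [apply Rmult_le_pos; apply pow2_ge_0|].
  rewrite <- exp_plus. apply exp_le_compat.
  rewrite Rabs_mult, Rabs_Ropp, (Rabs_pos_eq x) by exact Hx.
  assert (Rabs h * x <= a * x) by (apply Rmult_le_compat_r; lra).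
  unfold a in *. nra.
Qed.

Lemma II_psum (F : nat -> R -> R) (n : nat) (c : R) : 0 < c ->
  (forall j x, continuous (F j) x) -> (forall j, exists C, edec (F j) C c) ->
  II (fun x => psum (fun j => F j x) n) = psum (fun j => II (F j)) n.
Proof.
intros Hc Hcont Hd.
enough (H : II (fun x => psum (fun j => F j x) n) = psum (fun j => II (F j)) n /\
  exists C, edec (fun x => psum (fun j => F j x) n) C c) by easy.
induction n as [|n [IH [C HC]]]; simpl.
- split.
  + apply II_unique. apply is_lim_ext with (fun _ => 0); [|apply is_lim_const].
    intros b. rewrite RInt_const. unfold scal; simpl; unfold mult; simpl; ring.
  + exists 0. intros x _. rewrite Rabs_R0. lra.
- destruct (Hd n) as [D HD]. split.
  + rewrite (II_plus (fun x => psum (fun j => F j x) n) (F n) C c D c); auto.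
    * now rewrite IH.
    * now apply cont_psum.
  + exists (C + D). intros x Hx. rewrite Rmult_plus_distr_r.
    apply Rle_trans with (1 := Rabs_triang _ _). apply Rplus_le_compat; auto.
Qed.

(** A binomial coefficient is at most 2^(n+m). The induction is Pascal's rule with denominators
    cleared: the leading factor of the factorial is split into its two summands. *)
Lemma fact_add_le (n m : nat) :
  INR (fact (n + m)) <= INR (fact n) * INR (fact m) * 2 ^ (n + m).
Proof.
remember (n + m)%nat as s eqn:Es. revert n m Es.
induction s as [|s IH]; intros n m Es.
- assert (n = 0%nat) by lia. assert (m = 0%nat) by lia. subst. simpl. lra.
- assert (Hp : 1 <= 2 ^ (S s)) by (apply pow_R1_Rle; lra).
  destruct n as [|n]; [|destruct m as [|m]].
  + simpl in Es. subst m. pose proof (INR_fact_pos (S s)). simpl (INR (fact 0)). nra.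
  + rewrite Nat.add_0_r in Es. rewrite <- Es.
    pose proof (INR_fact_pos (S s)). simpl (INR (fact 0)). nra.
  + assert (H1 := IH n (S m) ltac:(lia)). assert (H2 := IH (S n) m ltac:(lia)).
    rewrite INR_fact_S. replace (INR (S s)) with (INR (S n) + INR (S m))
      by (now rewrite Es, plus_INR).
    rewrite (INR_fact_S n) in *. rewrite (INR_fact_S m) in *.
    pose proof (lt_0_INR (S n) ltac:(lia)). pose proof (lt_0_INR (S m) ltac:(lia)).
    change (2 ^ (S s)) with (2 * 2 ^ s) in *.
    apply (Rmult_le_compat_l (INR (S n))) in H1; [|lra].
    apply (Rmult_le_compat_l (INR (S m))) in H2; [|lra].
    lra.
Qed.

(** The Taylor polynomial is differentiated in its centre [t], not in the evaluation point [u]: the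
    terms telescope and only the last survives. *)
Lemma taylor_sum_derive (g : nat -> R -> R) (n : nat) (u t : R) :
  (forall j, is_derive (g j) t (g (S j) t)) ->
  is_derive (fun t => psum (fun j => (u - t) ^ j / INR (fact j) * g j t) (S n)) t
    ((u - t) ^ n / INR (fact n) * g (S n) t).
Proof.
intros H. induction n as [|n IH].
- simpl. apply is_derive_ext with (g 0%nat).
  { intros y. change (g 0%nat y = 0 + 1 / 1 * g 0%nat y). field. }
  replace (1 / 1 * g 1%nat t) with (g 1%nat t) by field. apply H.
- set (P := fun y => psum (fun j => (u - y) ^ j / INR (fact j) * g j y) (S n)) in *.
  assert (Hd : is_derive (fun y => (u - y) ^ (S n) / INR (fact (S n)) * g (S n) y) t
    (plus ((- ((u - t) ^ n / INR (fact n))) * g (S n) t)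
          ((u - t) ^ S n / INR (fact (S n)) * g (S (S n)) t))).
  { apply (is_derive_mult (fun y => (u - y) ^ (S n) / INR (fact (S n))) (g (S n))).
    - assert (Hc := is_derive_comp (fun y => y ^ (S n) / INR (fact (S n))) (fun y => u - y) t
        ((u - t) ^ n / INR (fact n)) (-1) (is_derive_pow_fact n (u - t))).
      replace (- ((u - t) ^ n / INR (fact n))) with (scal (-1) ((u - t) ^ n / INR (fact n))).
      + apply Hc. auto_derive; [easy|ring].
      + unfold scal; simpl; unfold mult; simpl; ring.
    - apply H.
    - intros; apply Rmult_comm. }
  assert (Hs := is_derive_plus (K := R_AbsRing) (V := R_NormedModule) P _ t _ _ IH Hd).
  replace ((u - t) ^ S n / INR (fact (S n)) * g (S (S n)) t) with
    (plus ((u - t) ^ n / INR (fact n) * g (S n) t)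
      (plus ((- ((u - t) ^ n / INR (fact n))) * g (S n) t)
          ((u - t) ^ S n / INR (fact (S n)) * g (S (S n)) t))).
  + exact Hs.
  + unfold plus; simpl AbelianMonoid.plus. cbv [plus]; simpl. ring.
Qed.

(** The mean value theorem is applied to the Taylor polynomial as a function of its centre, between
    u and u + h. This Cauchy form of the remainder has n! in place of (n+1)!, a loss that the
    geometric factor absorbs later. *)
Lemma taylor_bound (g : nat -> R -> R) (n : nat) (u h D : R) : 0 < h ->
  (forall j t, u <= t <= u + h -> is_derive (g j) t (g (S j) t)) ->
  (forall t, u <= t <= u + h -> Rabs (g (S n) t) <= D) ->
  Rabs (psum (fun j => (- h) ^ j / INR (fact j) * g j (u + h)) (S n) - g O u)
    <= h ^ (S n) / INR (fact n) * D.
Proof.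
intros Hh Hd HD.
set (P := fun t => psum (fun j => (u - t) ^ j / INR (fact j) * g j t) (S n)).
assert (HP : forall t, u <= t <= u + h ->
  is_derive P t ((u - t) ^ n / INR (fact n) * g (S n) t)).
{ intros t Ht. apply taylor_sum_derive. intros j. now apply Hd. }
replace (psum (fun j => (- h) ^ j / INR (fact j) * g j (u + h)) (S n)) with (P (u + h)).
2:{ apply psum_ext. intros j _. replace (u - (u + h)) with (- h) by ring. easy. }
assert (HPu : P u = g O u).
{ unfold P. clear. induction n as [|n IH].
  - simpl. field.
  - change (psum (fun j => (u - u) ^ j / INR (fact j) * g j u) (S n) +
      (u - u) ^ (S n) / INR (fact (S n)) * g (S n) u = g O u).
    rewrite IH. rewrite Rminus_diag, pow_ne_zero by easy. unfold Rdiv. ring. }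
rewrite <- HPu.
destruct (MVT_gen P u (u + h) (fun t => (u - t) ^ n / INR (fact n) * g (S n) t)) as [c [Hc He]].
- intros t Ht. rewrite Rmin_left, Rmax_right in Ht by lra. apply HP. lra.
- intros t Ht. rewrite Rmin_left, Rmax_right in Ht by lra.
  apply continuity_pt_filterlim.
  apply (ex_derive_continuous (K := R_AbsRing) (V := R_NormedModule) P).
  eexists. now apply HP.
- rewrite Rmin_left, Rmax_right in Hc by lra. rewrite He.
  replace (u + h - u) with h by ring.
  rewrite !Rabs_mult, (Rabs_pos_eq h) by lra.
  unfold Rdiv. rewrite Rabs_mult, (Rabs_pos_eq (/ _)).
  2:{ left. apply Rinv_0_lt_compat, INR_fact_pos. }
  rewrite <- RPow_abs.
  assert (H1 : Rabs (u - c) ^ n <= h ^ n).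
  { apply pow_incr. split; [apply Rabs_pos|]. apply Rabs_le. lra. }
  assert (H2 := HD c Hc). assert (H3 := Rabs_pos (g (S n) c)).
  assert (H4 : 0 < / INR (fact n)) by apply Rinv_0_lt_compat, INR_fact_pos.
  assert (H5 : 0 <= Rabs (u - c) ^ n) by apply pow_le, Rabs_pos.
  replace (h ^ S n * / INR (fact n) * D) with (h ^ n * / INR (fact n) * D * h) by (simpl; ring).
  apply Rmult_le_compat_r; [lra|]. apply Rmult_le_compat; try easy.
  + apply Rmult_le_pos; lra.
  + apply Rmult_le_compat_r; lra.
Qed.

(** * Shifting a Laplace transform by Taylor polynomials *)

(** [g p 0] continues the Laplace transform of [phi p] to [alpha <= u], and [g p k]
    is its [k]-th derivative.  The shift [q] in the factorial absorbs the growth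
    caused by [taylor_shift], so that [B] is preserved. *)
Definition lap_family {P : Type} (alpha B eta : R)
    (phi : P -> R -> R) (g : P -> nat -> R -> R) : Prop :=
  (forall p x, continuous (phi p) x) /\
  (exists C, forall p, edec (phi p) C eta) /\
  (forall p k u, alpha <= u -> is_derive (g p k) u (g p (S k) u)) /\
  (exists M q, forall p k u, alpha <= u ->
     Rabs (g p k u) <= M * INR (fact (k + q)) * B ^ k) /\
  (forall p k u, alpha <= u -> - eta < u -> g p k u = Lap k (phi p) u).

(** The probability that a Poisson variable of mean h x is smaller than [n]: between 0 and 1,
    tending to 1 as [n] grows, and exponentially small in [x] for fixed [n]. *)
Definition damp (n : nat) (h x : R) : R := exp_sum n (h * x) * exp (- (h * x)).

(** The weights do not depend on [k], because differentiation in [u] commutes with the shift; so the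
    shifted functions are again successive derivatives of one another. *)
Definition taylor_shift {P : Type} (n : nat) (h : R) (g : P -> nat -> R -> R)
    (p : P) (k : nat) (u : R) : R :=
  psum (fun j => (- h) ^ j / INR (fact j) * g p (j + k)%nat (u + h)) n.

Lemma continuous_exp_sum (n : nat) (y : R) : continuous (exp_sum n) y.
Proof.
unfold exp_sum. apply cont_psum. intros j. apply cont_derivable. intros x. auto_derive. easy.
Qed.

Lemma continuous_damp (n : nat) (h x : R) : continuous (damp n h) x.
Proof.
revert x. apply cont_mult.
- intros x. apply (continuous_comp (fun x => h * x) (exp_sum n)).
  + apply (ex_derive_continuous (K := R_AbsRing) (V := R_NormedModule)). auto_derive; easy.
  + apply continuous_exp_sum.
- apply cont_derivable. intros x. auto_derive; easy.
Qed.

Lemma damp_pos (n : nat) (h x : R) : 0 <= h -> 0 <= x -> 0 <= damp n h x.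
Proof.
intros Hh Hx. apply Rmult_le_pos; [|left; apply exp_pos]. apply exp_sum_pos. nra.
Qed.

Lemma damp_le_1 (n : nat) (h x : R) : 0 <= h -> 0 <= x -> damp n h x <= 1.
Proof.
intros Hh Hx. unfold damp. rewrite exp_Ropp.
assert (He := exp_pos (h * x)).
apply Rmult_le_reg_r with (exp (h * x)); [exact He|].
rewrite Rmult_assoc, Rinv_l, Rmult_1_r, Rmult_1_l by lra.
apply exp_sum_le_exp. nra.
Qed.

Lemma damp_decay (n : nat) (h x : R) : 0 <= h -> 0 <= x ->
  damp n h x <= 2 ^ n * exp (- (h / 2 * x)).
Proof.
intros Hh Hx. unfold damp.
replace (- (h / 2 * x)) with (h * x / 2 + - (h * x)) by field.
rewrite exp_plus, <- Rmult_assoc.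
apply Rmult_le_compat_r; [left; apply exp_pos|]. apply exp_sum_half. nra.
Qed.

Lemma is_derive_damp (n : nat) (h x : R) :
  is_derive (damp (S n) h) x (- (h * ((h * x) ^ n / INR (fact n) * exp (- (h * x))))).
Proof.
assert (Hc := is_derive_comp (exp_sum (S n)) (fun x => h * x) x
  (exp_sum n (h * x)) h (is_derive_exp_sum n (h * x))).
assert (Hl : is_derive (fun x => h * x) x h) by (auto_derive; [easy|ring]).
specialize (Hc Hl).
assert (He : is_derive (fun x => exp (- (h * x))) x (- h * exp (- (h * x))))
  by (auto_derive; [easy|ring]).
assert (H := is_derive_mult _ _ x _ _ Hc He Rmult_comm).
replace (- (h * ((h * x) ^ n / INR (fact n) * exp (- (h * x))))) with
 (plus (mult (scal h (exp_sum n (h * x))) (exp (- (h * x))))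
      (mult (exp_sum (S n) (h * x)) (- h * exp (- (h * x))))).
- exact H.
- change (h * exp_sum n (h * x) * exp (- (h * x)) +
    (exp_sum n (h * x) + (h * x) ^ n / INR (fact n)) * (- h * exp (- (h * x))) =
    - (h * ((h * x) ^ n / INR (fact n) * exp (- (h * x))))).
  ring.
Qed.

Lemma pow_lt_eps (K eps : R) : 0 < eps ->
  exists N, forall n, (N <= n)%nat -> K * (/ 2) ^ n <= eps.
Proof.
intros He. destruct (pow_lt_1_zero (/ 2)) with (eps / (Rabs K + 1)) as [N HN].
- rewrite Rabs_pos_eq; lra.
- apply Rdiv_lt_0_compat; [exact He|]. pose proof (Rabs_pos K); lra.
- exists N. intros n Hn. specialize (HN n Hn).
  assert (HK := Rabs_pos K).
  assert (Hp : 0 <= (/ 2) ^ n) by (apply pow_le; lra).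
  rewrite Rabs_pos_eq in HN by exact Hp.
  apply Rle_trans with ((Rabs K + 1) * (/ 2) ^ n).
  + apply Rmult_le_compat_r; [exact Hp|]. pose proof (Rle_abs K). lra.
  + apply (Rmult_lt_compat_l (Rabs K + 1)) in HN; [|lra].
    replace ((Rabs K + 1) * (eps / (Rabs K + 1))) with eps in HN by (field; lra). lra.
Qed.

(** Only derivatives of order below k + n enter, so enlarging [q] by [n] and [M] by a constant
    factor absorbs the sum, and [B] is kept. An element of [P] is required to read off from the
    bounds that [C] and [M] are nonnegative. *)
Lemma lap_family_shift {P : Type} (alpha B eta h : R) (phi : P -> R -> R)
    (g : P -> nat -> R -> R) (n : nat) :
  0 < h -> 0 <= B -> inhabited P -> lap_family alpha B eta phi g ->
  lap_family alpha B (eta + h / 2) (fun p x => phi p x * damp n h x) (taylor_shift n h g).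
Proof.
intros Hh HB [p0] (Hc & (C & HC) & Hd & (M & q & HM) & HL).
assert (HC0 : 0 <= C) by apply (edec_nonneg _ _ _ (HC p0)).
assert (HMp : forall k u, alpha <= u -> 0 <= M * INR (fact (k + q)) * B ^ k).
{ intros k u Hu. apply Rle_trans with (2 := HM p0 k u Hu). apply Rabs_pos. }
assert (HM0 : 0 <= M).
{ specialize (HMp 0%nat alpha (Rle_refl _)). rewrite pow_O, Rmult_1_r in HMp.
  pose proof (INR_fact_pos (0 + q)). nra. }
split; [|split; [|split; [|split]]].
- intros p. apply cont_mult; [apply Hc|]. intros x. apply continuous_damp.
- exists (C * 2 ^ n). intros p x Hx. rewrite Rabs_mult.
  rewrite (Rabs_pos_eq (damp _ _ _)) by (apply damp_pos; lra).
  replace (C * 2 ^ n * exp (- ((eta + h / 2) * x)))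
    with ((C * exp (- (eta * x))) * (2 ^ n * exp (- (h / 2 * x)))).
  + apply Rmult_le_compat; [apply Rabs_pos|apply damp_pos; lra|now apply HC|apply damp_decay; lra].
  + replace (- ((eta + h / 2) * x)) with (- (eta * x) + - (h / 2 * x)) by ring.
    rewrite exp_plus. ring.
- intros p k u Hu. unfold taylor_shift.
  replace (psum (fun j => (- h) ^ j / INR (fact j) * g p (j + S k)%nat (u + h)) n)
    with (psum (fun j => (- h) ^ j / INR (fact j) * g p (S (j + k)) (u + h)) n).
  2:{ apply psum_ext. intros j _. now rewrite Nat.add_succ_r. }
  apply (psum_derive (fun j u => (- h) ^ j / INR (fact j) * g p (j + k)%nat (u + h))
    (fun j u => (- h) ^ j / INR (fact j) * g p (S (j + k)) (u + h))).
  intros j. apply (is_derive_scal (fun u => g p (j + k)%nat (u + h))).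
  assert (Hg := Hd p (j + k)%nat (u + h) ltac:(lra)).
  assert (Hcomp := is_derive_comp (g p (j + k)%nat) (fun u => u + h) u _ 1 Hg).
  replace (g p (S (j + k)) (u + h)) with (scal 1 (g p (S (j + k)) (u + h))).
  + apply Hcomp. auto_derive; [easy|ring].
  + apply (scal_one (K := R_AbsRing) (V := R_NormedModule)).
- exists (M * exp_sum n (h * B)), (q + n)%nat. intros p k u Hu. unfold taylor_shift.
  apply Rle_trans with (1 := psum_Rabs _ _).
  replace (M * exp_sum n (h * B) * INR (fact (k + (q + n))) * B ^ k) with
    (M * INR (fact (k + (q + n))) * B ^ k * exp_sum n (h * B)) by ring.
  unfold exp_sum. rewrite <- psum_scal. apply psum_le. intros j Hj.
  unfold Rdiv. rewrite !Rabs_mult, <- RPow_abs, Rabs_Ropp, (Rabs_pos_eq h) by lra.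
  assert (Hj0 : 0 < / INR (fact j)) by apply Rinv_0_lt_compat, INR_fact_pos.
  rewrite (Rabs_pos_eq (/ _)) by lra.
  rewrite Rpow_mult_distr.
  replace (M * INR (fact (k + (q + n))) * B ^ k * (h ^ j * B ^ j * / INR (fact j))) with
    (h ^ j * / INR (fact j) * (M * INR (fact (k + (q + n))) * B ^ (j + k)))
    by (rewrite pow_add; ring).
  apply Rmult_le_compat_l.
  + apply Rmult_le_pos; [apply pow_le; lra|lra].
  + apply Rle_trans with (1 := HM p (j + k)%nat (u + h) ltac:(lra)).
    apply Rmult_le_compat_r; [now apply pow_le|].
    apply Rmult_le_compat_l; [exact HM0|]. apply le_INR, fact_le. lia.
(* Since (h x)^j = (- h)^j (- x)^j, each Taylor term is the integral of one term of [exp_sum], and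
   exp (- h x) comes from evaluating at u + h. As u > - (eta + h/2), the point u + h lies right of -
   eta, where these integrals converge. *)
- intros p k u Hu Hue. unfold taylor_shift, Lap.
  transitivity (psum (fun j => II (fun x => (- h) ^ j / INR (fact j) *
    lap_int (j + k) (phi p) (u + h) x)) n).
  + apply psum_ext. intros j _. rewrite HL by lra. unfold Lap. symmetry.
    assert (He := edec_lap_int (j + k) (phi p) C eta ((eta + (u + h)) / 2) (u + h) (HC p) ltac:(lra)).
    apply (II_scal _ _ _ _ (cont_lap_int _ _ _ (Hc p)) He). lra.
  + rewrite <- (II_psum (fun j x => (- h) ^ j / INR (fact j) *
      lap_int (j + k) (phi p) (u + h) x) n ((eta + (u + h)) / 2)).
    * apply II_ext. intros x _. unfold lap_int, damp, exp_sum.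
      replace (exp (- ((u + h) * x))) with (exp (- (u * x)) * exp (- (h * x)))
        by (rewrite <- exp_plus; f_equal; ring).
      replace ((- x) ^ k * (phi p x * (psum (fun j => (h * x) ^ j / INR (fact j)) n * exp (- (h * x)))) *
        exp (- (u * x))) with
        ((- x) ^ k * phi p x * (exp (- (u * x)) * exp (- (h * x))) *
         psum (fun j => (h * x) ^ j / INR (fact j)) n) by ring.
      rewrite <- psum_scal. apply psum_ext. intros j _.
      replace (h * x) with (- h * - x) by ring. rewrite Rpow_mult_distr, pow_add.
      unfold Rdiv. ring.
    * lra.
    * intros j x. apply (continuous_scal_r (K := R_AbsRing) (V := R_NormedModule)).
      now apply cont_lap_int.
    * intros j. eexists. intros x Hx. rewrite Rabs_mult.
      eapply Rle_trans; [apply Rmult_le_compat_l; [apply Rabs_pos|]|].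
      -- apply (edec_lap_int (j + k) (phi p) C eta ((eta + (u + h)) / 2) (u + h) (HC p)); lra.
      -- rewrite <- Rmult_assoc. apply Rle_refl.
Qed.

(** Since (n+1+q)! / n! <= (q+1)! 2^(n+q+1), the remainder is at most a constant times 2^n (h
    B)^(n+1), and h B <= 1/4 leaves 2^(-n). *)
Lemma taylor_geom (g : nat -> R -> R) (M B u h : R) (q n : nat) :
  0 < h -> 0 <= B -> h * B <= / 4 ->
  (forall j t, u <= t <= u + h -> is_derive (g j) t (g (S j) t)) ->
  (forall j t, u <= t <= u + h -> Rabs (g j t) <= M * INR (fact (j + q)) * B ^ j) ->
  Rabs (psum (fun j => (- h) ^ j / INR (fact j) * g j (u + h)) (S n) - g O u)
    <= Rabs M * INR (fact (q + 1)) * 2 ^ q * (/ 2) ^ S n.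
Proof.
intros Hh HB HhB Hd HM.
eapply Rle_trans; [apply (taylor_bound g n u h (Rabs M * INR (fact (S n + q)) * B ^ S n) Hh Hd)|].
- intros t Ht. apply Rle_trans with (1 := HM (S n) t Ht).
  apply Rmult_le_compat_r; [now apply pow_le|].
  apply Rmult_le_compat_r; [left; apply INR_fact_pos|apply Rle_abs].
- assert (Hf := fact_add_le n (q + 1)).
  replace (S n + q)%nat with (n + (q + 1))%nat by lia.
  assert (Hfn := INR_fact_pos n).
  assert (HhBn : (h * B) ^ S n <= (/ 4) ^ S n) by (apply pow_incr; nra).
  assert (HhBp : 0 <= (h * B) ^ S n) by (apply pow_le; nra).
  replace (h ^ S n / INR (fact n) * (Rabs M * INR (fact (n + (q + 1))) * B ^ S n)) with
    (Rabs M * (INR (fact (n + (q + 1))) / INR (fact n)) * (h * B) ^ S n)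
    by (rewrite Rpow_mult_distr; field; lra).
  replace (Rabs M * INR (fact (q + 1)) * 2 ^ q * (/ 2) ^ S n) with
    (Rabs M * (INR (fact (q + 1)) * 2 ^ (n + (q + 1))) * (/ 4) ^ S n).
  + apply Rmult_le_compat; [|exact HhBp| |exact HhBn].
    * apply Rmult_le_pos; [apply Rabs_pos|]. apply Rdiv_le_0_compat; [|exact Hfn].
      left; apply INR_fact_pos.
    * apply Rmult_le_compat_l; [apply Rabs_pos|].
      apply Rmult_le_reg_r with (INR (fact n)); [exact Hfn|].
      unfold Rdiv. rewrite Rmult_assoc, Rinv_l, Rmult_1_r by lra. lra.
  + replace (n + (q + 1))%nat with (S n + q)%nat by lia. rewrite pow_add.
    replace (/ 4) with (/ 2 * / 2) by field. rewrite Rpow_mult_distr, (pow_inv 2).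
    field. apply pow_nonzero. lra.
Qed.

Lemma taylor_shift_close {P : Type} (alpha B eta h : R) (phi : P -> R -> R)
    (g : P -> nat -> R -> R) :
  0 < h -> 0 <= B -> h * B <= / 4 -> lap_family alpha B eta phi g ->
  forall eps, 0 < eps -> exists N, forall n, (N <= n)%nat -> forall p u, alpha <= u ->
    Rabs (taylor_shift n h g p 0 u - g p 0%nat u) <= eps.
Proof.
intros Hh HB HhB (Hc & (C & HC) & Hd & (M & q & HM) & HL) eps Heps.
destruct (pow_lt_eps (Rabs M * INR (fact (q + 1)) * 2 ^ q) eps Heps) as [N HN].
exists (S N). intros [|n] Hn p u Hu; [lia|].
unfold taylor_shift.
replace (psum (fun j => (- h) ^ j / INR (fact j) * g p (j + 0)%nat (u + h)) (S n))
  with (psum (fun j => (- h) ^ j / INR (fact j) * g p j (u + h)) (S n)).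
2:{ apply psum_ext. intros j _. now rewrite Nat.add_0_r. }
apply Rle_trans with (2 := HN (S n) ltac:(lia)).
apply (taylor_geom (g p) M B u h q n Hh HB HhB); intros; [apply Hd|apply HM]; lra.
Qed.

(** * Complex-valued functions and truncation *)

(** A Boolean selects the component, so that one real-variable argument serves real and imaginary
    parts. *)
Definition part (b : bool) (z : C) : R := if b then fst z else snd z.

Lemma part_le_Cmod (b : bool) (z : C) : Rabs (part b z) <= Cmod z.
Proof.
destruct z as [x y]. assert (H := Rmax_Cmod (x, y)). simpl in H.
destruct b; simpl; [apply Rle_trans with (2 := H), Rmax_l|apply Rle_trans with (2 := H), Rmax_r].
Qed.

Lemma Cmod_le_parts (z : C) : Cmod z <= Rabs (fst z) + Rabs (snd z).
Proof.
destruct z as [x y]. replace (x, y) with (Cplus (RtoC x) (Cmult Ci (RtoC y))).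
- apply Rle_trans with (1 := Cmod_triangle _ _).
  rewrite Cmod_mult, !Cmod_R. simpl. unfold Cmod. simpl.
  replace (0 * (0 * 1) + 1 * (1 * 1)) with 1 by ring. rewrite sqrt_1.
  ring_simplify. replace (x + (0 * y - 1 * 0)) with x by ring.
  replace (0 + (0 * 0 + 1 * y)) with y by ring. lra.
- unfold Cplus, Cmult, RtoC, Ci; simpl; f_equal; ring.
Qed.

(** Two-sided derivatives on the whole line, so that the ordinary calculus rules apply;
    [C1_half_line_extension] brings functions on the half-line into this form. *)
Definition is_C1 (T dT : R -> C) : Prop :=
  forall b x, is_derive (fun y => part b (T y)) x (part b (dT x)) /\
    continuous (fun y => part b (dT y)) x.

Lemma is_C1_continuous (T dT : R -> C) (b : bool) (x : R) :
  is_C1 T dT -> continuous (fun y => part b (T y)) x.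
Proof.
intros H. apply (ex_derive_continuous (K := R_AbsRing) (V := R_NormedModule)).
eexists. apply H.
Qed.

(** The parameter type for [lap_family]: an imaginary part of s and a choice of component, over
    which all constants are uniform. *)
Definition freq (r : R) : Type := ({v : R | Rabs v <= r} * bool)%type.

(** Real or imaginary part of [T x * exp (- i v x)]. *)
Definition wave_at (T : R -> C) (v : R) (b : bool) (x : R) : R :=
  part b (fst (T x) * cos (v * x) + snd (T x) * sin (v * x),
          snd (T x) * cos (v * x) - fst (T x) * sin (v * x)).

Definition wave {r : R} (T : R -> C) (p : freq r) : R -> R :=
  wave_at T (proj1_sig (fst p)) (snd p).

Lemma wave_at_scal (m : R -> R) (T : R -> C) (v : R) (b : bool) (x : R) :
  wave_at (fun y => Cmult (RtoC (m y)) (T y)) v b x = wave_at T v b x * m x.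
Proof. unfold wave_at. destruct b; simpl; ring. Qed.

Lemma Rabs_le_sqrt (x y : R) : x ^ 2 <= y -> Rabs x <= sqrt y.
Proof.
intros H. rewrite <- sqrt_Rsqr_abs. apply sqrt_le_1_alt. unfold Rsqr. simpl in H. lra.
Qed.

(** Multiplication by exp (- i v x) is a rotation; what the bound drops is the square of the other
    component. *)
Lemma wave_at_le (T : R -> C) (v : R) (b : bool) (x : R) :
  Rabs (wave_at T v b x) <= Cmod (T x).
Proof.
unfold wave_at, Cmod.
assert (H := sin2_cos2 (v * x)). unfold Rsqr in H.
set (s := sin (v * x)) in *. set (c := cos (v * x)) in *.
destruct (T x) as [y z]. simpl fst; simpl snd.
destruct b; simpl part; apply Rabs_le_sqrt.
- replace (y ^ 2 + z ^ 2) with ((y ^ 2 + z ^ 2) * (s * s + c * c)) by (rewrite H; ring).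
  assert (0 <= (y * s - z * c) ^ 2) by apply pow2_ge_0. lra.
- replace (y ^ 2 + z ^ 2) with ((y ^ 2 + z ^ 2) * (s * s + c * c)) by (rewrite H; ring).
  assert (0 <= (y * c + z * s) ^ 2) by apply pow2_ge_0. lra.
Qed.

Lemma wave_at_continuous (T dT : R -> C) (v : R) (b : bool) (x : R) :
  is_C1 T dT -> continuous (wave_at T v b) x.
Proof.
intros H. unfold wave_at.
assert (Hc : forall x, continuous (fun x => cos (v * x)) x)
  by (apply cont_derivable; intros; auto_derive; easy).
assert (Hs : forall x, continuous (fun x => sin (v * x)) x)
  by (apply cont_derivable; intros; auto_derive; easy).
assert (H1 := fun x => is_C1_continuous T dT true x H).
assert (H2 := fun x => is_C1_continuous T dT false x H). simpl in H1, H2.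
destruct b; simpl.
- apply (continuous_plus (V := R_NormedModule)); now apply cont_mult.
- apply (continuous_minus (V := R_NormedModule)); now apply cont_mult.
Qed.

(** Beyond [N] the function [sigma] vanishes, so its transform is the integral over [0, N] for every
    s. The target [G] is given separately from [d], because left of 0 it is a continuation and need
    not be an integral. *)
Definition approximable (alpha r : R) (d : R -> C) (G : freq r -> R -> R) : Prop :=
  forall eps, 0 < eps -> exists (sigma dsigma : R -> C) (N : R),
    0 <= N /\ is_C1 sigma dsigma /\ (forall x, N <= x -> sigma x = RtoC 0) /\
    (forall x, 0 <= x -> Cmod (Cminus (dsigma x) (d x)) <= eps) /\
    (forall p u, alpha <= u ->
       Rabs (RInt (lap_int 0 (wave sigma p) u) 0 N - G p u) <= eps).

Lemma is_C1_scal (m dm : R -> R) (T dT : R -> C) :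
  (forall x, is_derive m x (dm x)) -> (forall x, continuous dm x) -> is_C1 T dT ->
  is_C1 (fun x => Cmult (RtoC (m x)) (T x))
     (fun x => Cplus (Cmult (RtoC (dm x)) (T x)) (Cmult (RtoC (m x)) (dT x))).
Proof.
intros Hm Hdm HT b x.
assert (Hmc : forall x, continuous m x).
{ intros y. apply (ex_derive_continuous (K := R_AbsRing) (V := R_NormedModule)).
  eexists; apply Hm. }
assert (E1 : forall y z, part b (Cmult (RtoC y) z) = y * part b z).
{ intros y [z1 z2]. destruct b; simpl; ring. }
assert (E2 : forall y z, part b (Cplus y z) = part b y + part b z) by (now destruct b).
split.
- apply is_derive_ext with (fun y => m y * part b (T y)).
  { intros t. now rewrite E1. }
  rewrite E2, !E1.
  apply (is_derive_mult m (fun y => part b (T y))); [apply Hm|apply HT|intros; apply Rmult_comm].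
- apply continuous_ext with (fun y => dm y * part b (T y) + m y * part b (dT y)).
  { intros t. now rewrite E2, !E1. }
  apply (continuous_plus (V := R_NormedModule)).
  + apply (cont_mult dm (fun y => part b (T y))); [exact Hdm|].
    intros; now apply is_C1_continuous with dT.
  + apply (cont_mult m (fun y => part b (dT y))); [exact Hmc|]. intros; apply HT.
Qed.

(** * A cutoff function and the truncation of exponentially decaying functions *)

Definition sq_pos (y : R) : R := Rmax 0 y ^ 2.

Lemma is_derive_sq_pos (y : R) : is_derive sq_pos y (2 * Rmax 0 y).
Proof.
apply (is_derive_quad _ _ _ 1 1); [lra|]. intros h _. unfold sq_pos.
apply Rabs_le. unfold Rmax.
destruct (Rle_dec 0 (y + h)); destruct (Rle_dec 0 y); nra.
Qed.

Lemma continuous_Rmax_0 (y : R) : continuous (Rmax 0) y.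
Proof.
apply continuous_ext with (fun y => (y + Rabs y) / 2).
- intros t. change ((t + Rabs t) / 2 = Rmax 0 t). unfold Rmax. destruct (Rle_dec 0 t).
  + rewrite Rabs_pos_eq by lra. field.
  + rewrite Rabs_left by lra. field.
- unfold Rdiv. apply (continuous_mult (K := R_AbsRing)); [|apply continuous_const].
  apply (continuous_plus (V := R_NormedModule)); [apply continuous_id|apply continuous_Rabs].
Qed.

(** Composing two squared positive parts gives a C^1 function equal to 1 up to [N] and to 0 from N +
    1 on; the space asks for one continuous derivative only. *)
Definition cutoff (N x : R) : R := sq_pos (1 - sq_pos (x - N)).

Definition dcutoff (N x : R) : R :=
  - (2 * Rmax 0 (x - N)) * (2 * Rmax 0 (1 - sq_pos (x - N))).

Lemma is_derive_cutoff (N x : R) : is_derive (cutoff N) x (dcutoff N x).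
Proof.
apply (is_derive_comp sq_pos (fun x => 1 - sq_pos (x - N))).
- apply is_derive_sq_pos.
- assert (H : is_derive (fun x => sq_pos (x - N)) x (2 * Rmax 0 (x - N))).
  { replace (2 * Rmax 0 (x - N)) with (scal 1 (2 * Rmax 0 (x - N))).
    - apply (is_derive_comp sq_pos (fun x => x - N)); [apply is_derive_sq_pos|].
      auto_derive; [easy|ring].
    - apply (scal_one (K := R_AbsRing) (V := R_NormedModule)). }
  replace (- (2 * Rmax 0 (x - N))) with (minus 0 (2 * Rmax 0 (x - N))).
  + apply (is_derive_minus (K := R_AbsRing) (V := R_NormedModule) (fun _ => 1));
      [|exact H]. apply (is_derive_const (K := R_AbsRing) (V := R_NormedModule) 1).
  + change (0 + - (2 * Rmax 0 (x - N)) = - (2 * Rmax 0 (x - N))). ring.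
Qed.

Lemma continuous_dcutoff (N x : R) : continuous (dcutoff N) x.
Proof.
unfold dcutoff.
assert (Hm : forall y, continuous (fun x => Rmax 0 (x - N)) y).
{ intros y. apply (continuous_comp (fun x => x - N) (Rmax 0)).
  - apply (ex_derive_continuous (K := R_AbsRing) (V := R_NormedModule)). auto_derive; easy.
  - apply continuous_Rmax_0. }
revert x. apply cont_mult.
- intros x. apply (continuous_opp (V := R_NormedModule)).
  revert x. apply cont_mult; [intros; apply continuous_const|exact Hm].
- apply cont_mult; [intros; apply continuous_const|].
  intros x. apply (continuous_comp (fun x => 1 - sq_pos (x - N)) (Rmax 0));
    [|apply continuous_Rmax_0].
  apply (continuous_minus (V := R_NormedModule)); [apply continuous_const|].
  unfold sq_pos. apply continuous_ext with (fun x => Rmax 0 (x - N) * Rmax 0 (x - N)).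
  + intros t. change (Rmax 0 (t - N) * Rmax 0 (t - N) = Rmax 0 (t - N) ^ 2). ring.
  + now apply cont_mult.
Qed.

Lemma sq_pos_0 (y : R) : y <= 0 -> sq_pos y = 0.
Proof. intros H. unfold sq_pos. rewrite Rmax_left by exact H. ring. Qed.

Lemma sq_pos_pos (y : R) : 0 <= sq_pos y.
Proof. apply pow2_ge_0. Qed.

Lemma cutoff_1 (N x : R) : x <= N -> cutoff N x = 1.
Proof.
intros H. unfold cutoff. rewrite (sq_pos_0 (x - N)) by lra.
unfold sq_pos. rewrite Rmax_right by lra. ring.
Qed.

Lemma dcutoff_0 (N x : R) : x <= N -> dcutoff N x = 0.
Proof. intros H. unfold dcutoff. rewrite (Rmax_left 0 (x - N)) by lra. ring. Qed.

Lemma cutoff_0 (N x : R) : N + 1 <= x -> cutoff N x = 0.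
Proof.
intros H. unfold cutoff. apply sq_pos_0. unfold sq_pos. rewrite Rmax_right by lra. nra.
Qed.

Lemma cutoff_bounds (N x : R) : 0 <= cutoff N x <= 1.
Proof.
split; [apply sq_pos_pos|]. unfold cutoff. assert (H := sq_pos_pos (x - N)).
unfold sq_pos at 1. set (y := sq_pos (x - N)) in *.
assert (0 <= Rmax 0 (1 - y) <= 1) by (split; [apply Rmax_l|apply Rmax_lub; lra]). nra.
Qed.

(** The positive part of 1 - y^2 vanishes once y = (x - N)_+ reaches 1, so each of the two factors
    matters only while it is at most 2. *)
Lemma dcutoff_bound (N x : R) : Rabs (dcutoff N x) <= 4.
Proof.
unfold dcutoff, sq_pos. assert (H := Rmax_l 0 (x - N)).
set (y := Rmax 0 (x - N)) in *. apply Rabs_le. unfold Rmax.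
destruct (Rle_dec 0 (1 - y ^ 2)); nra.
Qed.

(** Because c + alpha > 0, the transform integrals converge uniformly up to Re s = alpha, and their
    tails beyond [N] are small on the whole half-plane at once. *)
Lemma truncation (alpha r A c : R) (T dT : R -> C) : 0 < c -> 0 < c + alpha ->
  is_C1 T dT -> (forall x, 0 <= x -> Cmod (T x) <= A * exp (- (c * x))) ->
  (forall x, 0 <= x -> Cmod (dT x) <= A * exp (- (c * x))) ->
  approximable alpha r dT (fun p u => Lap 0 (wave T p) u).
Proof.
intros Hc Hca HC1 HT HdT eps Heps.
assert (HC : 0 <= A).
{ specialize (HT 0 (Rle_refl 0)). rewrite Rmult_0_r, Ropp_0, exp_0 in HT.
  pose proof (Cmod_ge_0 (T 0)). lra. }
(* The factor 5 is 4 from [dcutoff_bound] and 1 from the cutoff itself. *)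
destruct (exp_tail_small (5 * A) c eps Hc Heps) as [N1 [HN1 HN1e]].
(* Two tails: that of [T] beyond [N], and the contribution of the transition zone [N, N + 1]. *)
destruct (exp_tail_small (2 * (A / (c + alpha))) (c + alpha) eps Hca Heps) as [N2 [HN2 HN2e]].
set (N := Rmax N1 N2).
assert (HNN1 : N1 <= N) by apply Rmax_l. assert (HNN2 : N2 <= N) by apply Rmax_r.
exists (fun x => Cmult (RtoC (cutoff N x)) (T x)),
  (fun x => Cplus (Cmult (RtoC (dcutoff N x)) (T x)) (Cmult (RtoC (cutoff N x)) (dT x))),
  (N + 1).
assert (HsC1 := is_C1_scal (cutoff N) (dcutoff N) T dT (is_derive_cutoff N) (continuous_dcutoff N) HC1).
split; [lra|]. split; [exact HsC1|]. split; [|split].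
- intros x Hx. rewrite cutoff_0 by exact Hx. ring.
- intros x Hx. destruct (Rle_dec x N) as [HxN|HxN].
  + rewrite cutoff_1, dcutoff_0 by exact HxN.
    match goal with |- Cmod ?z <= _ => replace z with (RtoC 0) by ring end.
    rewrite Cmod_0. lra.
  + replace (Cminus (Cplus (Cmult (RtoC (dcutoff N x)) (T x)) (Cmult (RtoC (cutoff N x)) (dT x))) (dT x))
      with (Cplus (Cmult (RtoC (dcutoff N x)) (T x)) (Cmult (RtoC (cutoff N x - 1)) (dT x)))
      by (rewrite RtoC_minus; ring).
    apply Rle_trans with (1 := Cmod_triangle _ _). rewrite !Cmod_mult, !Cmod_R.
    specialize (HN1e x ltac:(lra)).
    assert (H1 := HT x Hx). assert (H2 := HdT x Hx).
    assert (H3 := dcutoff_bound N x). assert (H4 := cutoff_bounds N x).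
    assert (H5 : Rabs (cutoff N x - 1) <= 1) by (apply Rabs_le; lra).
    assert (H6 := Cmod_ge_0 (T x)). assert (H7 := Cmod_ge_0 (dT x)).
    assert (H8 := Rabs_pos (dcutoff N x)). assert (H9 := Rabs_pos (cutoff N x - 1)).
    nra.
- intros p u Hu.
  assert (Hw : forall x, continuous (wave T p) x) by (intros; now apply wave_at_continuous with dT).
  assert (Hw2 : forall x, continuous (wave (fun x => Cmult (RtoC (cutoff N x)) (T x)) p) x)
    by (intros; eapply wave_at_continuous; exact HsC1).
  assert (Hd : edec (lap_int 0 (wave T p) u) A (c + alpha)).
  { apply edec_mono with (c + u); [lra|]. intros x Hx. unfold lap_int.
    rewrite pow_O, Rmult_1_l.
    refine (edec_exp (wave T p) A c u _ x Hx).
    intros y Hy. apply Rle_trans with (1 := wave_at_le T _ _ y). now apply HT. }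
  assert (Hd2 : edec (lap_int 0 (wave (fun x => Cmult (RtoC (cutoff N x)) (T x)) p) u) A (c + alpha)).
  { intros x Hx. apply Rle_trans with (2 := Hd x Hx). unfold lap_int.
    unfold wave. rewrite wave_at_scal. rewrite !Rabs_mult.
    apply Rmult_le_compat_r; [apply Rabs_pos|].
    apply Rmult_le_compat_l; [apply Rabs_pos|].
    assert (H4 := cutoff_bounds N x). rewrite (Rabs_pos_eq (cutoff N x)) by lra.
    rewrite <- (Rmult_1_r (Rabs (wave_at T _ _ x))) at 2.
    apply Rmult_le_compat_l; [apply Rabs_pos|lra]. }
  specialize (HN2e N HNN2).
  rewrite (RInt_Chasles_cont _ 0 N (N + 1)) by (now apply cont_lap_int).
  rewrite (RInt_ext (lap_int 0 (wave (fun x => Cmult (RtoC (cutoff N x)) (T x)) p) u)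
    (lap_int 0 (wave T p) u) 0 N).
  2:{ intros x Hx. rewrite Rmax_right in Hx by lra. unfold lap_int.
      unfold wave. rewrite wave_at_scal, cutoff_1 by lra. now rewrite Rmult_1_r. }
  assert (H1 := II_tail (lap_int 0 (wave T p) u) A (c + alpha) N
    (cont_lap_int _ _ _ Hw) Hd Hca ltac:(lra)).
  assert (H2 := RInt_tail_le _ A (c + alpha) N (N + 1) (cont_lap_int 0 _ u Hw2) Hd2 Hca ltac:(lra)).
  fold (Lap 0 (wave T p) u) in H1.
  rewrite Rabs_minus_sym in H1.
  match goal with |- Rabs (?a + ?b - ?c) <= _ =>
    replace (a + b - c) with ((a - c) + b) by (apply Rminus_diag_uniq; lra) end.
  apply Rle_trans with (1 := Rabs_triang _ _). lra.
Qed.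

(** * Iteration of the Taylor shift *)

Definition ddamp (n : nat) (h x : R) : R :=
  - (h * ((h * x) ^ n / INR (fact n) * exp (- (h * x)))).

(** The term (h x)^(n+1) / (n+1)! equals 2^(-n-1) times the same term at 2 h x, which is at most exp
    (2 h x). Smallness in [n] is thus bought with a growth in [x] that a decay rate of at least 2 h
    absorbs. *)
Lemma one_minus_damp (n : nat) (h x : R) : 0 < h -> 0 <= x ->
  0 <= 1 - damp (S n) h x <= (/ 2) ^ n * exp (2 * h * x).
Proof.
intros Hh Hx. assert (H1 := damp_le_1 (S n) h x ltac:(lra) Hx).
split; [lra|].
assert (Hy : 0 <= h * x) by nra.
assert (H2 := exp_sum_remainder (S n) (h * x) Hy).
assert (H3 := pow_fact_le_exp (S n) (2 * h * x) ltac:(nra)).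
assert (He := exp_pos (h * x)).
assert (Hf := INR_fact_pos (S n)).
unfold damp. rewrite exp_Ropp.
apply Rmult_le_reg_r with (exp (h * x)); [exact He|].
rewrite Rmult_minus_distr_r, Rmult_assoc, Rinv_l, Rmult_1_l, Rmult_1_r by lra.
apply Rle_trans with (1 := H2). apply Rmult_le_compat_r; [lra|].
replace ((h * x) ^ S n / INR (fact (S n))) with
  ((/ 2) ^ S n * ((2 * h * x) ^ S n / INR (fact (S n)))).
- apply Rmult_le_compat; [apply pow_le; lra| |simpl|exact H3].
  + apply Rdiv_le_0_compat; [apply pow_le; nra|exact Hf].
  + assert (0 <= (/ 2) ^ n) by (apply pow_le; lra). lra.
- replace (2 * h * x) with (2 * (h * x)) by ring. rewrite Rpow_mult_distr, pow_inv.
  field. split; [lra|]. apply pow_nonzero; lra.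
Qed.

Lemma ddamp_small (n : nat) (h x : R) : 0 < h -> 0 <= x ->
  Rabs (ddamp n h x) <= h * (/ 2) ^ n * exp (2 * h * x).
Proof.
intros Hh Hx. unfold ddamp. rewrite Rabs_Ropp, Rmult_assoc.
assert (Hy : 0 <= h * x) by nra. assert (Hf := INR_fact_pos n).
assert (H3 := pow_fact_le_exp n (2 * h * x) ltac:(nra)).
assert (H4 : 0 <= (h * x) ^ n / INR (fact n)).
{ apply Rdiv_le_0_compat; [now apply pow_le|exact Hf]. }
assert (H5 : exp (- (h * x)) <= 1) by (rewrite <- exp_0; apply exp_le_compat; lra).
assert (H6 := exp_pos (- (h * x))).
rewrite Rabs_pos_eq by (apply Rmult_le_pos; [lra|]; apply Rmult_le_pos; lra).
apply Rmult_le_compat_l; [lra|].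
apply Rle_trans with ((h * x) ^ n / INR (fact n)); [nra|].
replace ((h * x) ^ n / INR (fact n)) with
  ((/ 2) ^ n * ((2 * h * x) ^ n / INR (fact n))).
- apply Rmult_le_compat_l; [apply pow_le; lra|exact H3].
- replace (2 * h * x) with (2 * (h * x)) by ring. rewrite Rpow_mult_distr, pow_inv.
  field. split; [lra|]. apply pow_nonzero; lra.
Qed.

Lemma ddamp_decay (n : nat) (h x : R) : 0 < h -> 0 <= x ->
  Rabs (ddamp n h x) <= h * 2 ^ n * exp (- (h / 2 * x)).
Proof.
intros Hh Hx. unfold ddamp. rewrite Rabs_Ropp, Rmult_assoc.
assert (Hy : 0 <= h * x) by nra. assert (Hf := INR_fact_pos n).
assert (H3 := pow_fact_le_exp n (h * x / 2) ltac:(lra)).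
assert (H4 : 0 <= (h * x) ^ n / INR (fact n)).
{ apply Rdiv_le_0_compat; [now apply pow_le|exact Hf]. }
assert (H6 := exp_pos (- (h * x))).
rewrite Rabs_pos_eq by (apply Rmult_le_pos; [lra|]; apply Rmult_le_pos; lra).
apply Rmult_le_compat_l; [lra|].
replace (- (h / 2 * x)) with (h * x / 2 + - (h * x)) by field.
rewrite exp_plus, <- Rmult_assoc. apply Rmult_le_compat_r; [lra|].
replace ((h * x) ^ n / INR (fact n)) with
  (2 ^ n * ((h * x / 2) ^ n / INR (fact n))).
- apply Rmult_le_compat_l; [apply pow_le; lra|exact H3].
- unfold Rdiv at 2. rewrite (Rpow_mult_distr (h * x)), pow_inv.
  field. split; [lra|]. apply pow_nonzero; lra.
Qed.

Lemma continuous_ddamp (n : nat) (h x : R) : continuous (ddamp n h) x.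
Proof.
revert x. apply cont_derivable. intros x. unfold ddamp. auto_derive. easy.
Qed.

(** Induction on the number [m] of shifts still to be made, each worth h/2 of decay, with [B] and
    [h] fixed outside it. The constant [A] may grow by a power of 2 at each shift, since the order
    of the next shift and the cutoff point are chosen after it. *)
Lemma lap_family_approximable (alpha r B h : R) (m : nat) :
  0 <= r -> 0 <= B -> 0 < h -> h * B <= / 4 ->
  forall (eta A : R) (T dT : R -> C) (g : freq r -> nat -> R -> R),
  is_C1 T dT -> 2 * h <= eta ->
  (forall x, 0 <= x -> Cmod (T x) <= A * exp (- (eta * x))) ->
  (forall x, 0 <= x -> Cmod (dT x) <= A * exp (- (eta * x))) ->
  lap_family alpha B eta (wave T) g -> - alpha < eta + INR m * (h / 2) ->
  approximable alpha r dT (fun p u => g p O u).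
Proof.
intros Hr HB Hh HhB. induction m as [|m IH];
  intros eta A T dT g HC1 Heta HT HdT Hg Hm.
(* No shift is left: the decay beats exp (alpha x), so [g] is the integral for all u >= alpha and
   truncation applies. *)
- intros eps Heps. rewrite Rmult_0_l, Rplus_0_r in Hm.
  destruct (truncation alpha r A eta T dT ltac:(lra) ltac:(lra) HC1 HT HdT eps Heps)
    as (s & ds & N & H1 & H2 & H3 & H4 & H5).
  exists s, ds, N. split; [exact H1|split; [exact H2|split; [exact H3|split; [exact H4|]]]].
  intros p u Hu. destruct Hg as (_ & _ & _ & _ & HL). rewrite HL by lra. now apply H5.
- intros eps Heps.
  assert (HA : 0 <= A).
  { specialize (HT 0 (Rle_refl 0)). rewrite Rmult_0_r, Ropp_0, exp_0 in HT.
    pose proof (Cmod_ge_0 (T 0)). lra. }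
  destruct (taylor_shift_close alpha B eta h (wave T) g Hh HB HhB Hg (eps / 2) ltac:(lra))
    as [N1 HN1].
  (* In A (1 + h), the part A h comes from [ddamp] times [T], the part A from 1 - [damp] times
     [dT]. *)
  destruct (pow_lt_eps (A * (1 + h)) (eps / 2) ltac:(lra)) as [N2 HN2].
  set (k := max N1 N2).
  set (T2 := fun x => Cmult (RtoC (damp (S k) h x)) (T x)).
  set (dT2 := fun x => Cplus (Cmult (RtoC (ddamp k h x)) (T x))
    (Cmult (RtoC (damp (S k) h x)) (dT x))).
  assert (HC2 : is_C1 T2 dT2).
  { apply is_C1_scal; [|apply continuous_ddamp|exact HC1]. intros x. apply is_derive_damp. }
  assert (Hinh : inhabited (freq r)).
  { constructor. split; [exists 0; now rewrite Rabs_R0|exact true]. }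
  assert (Hg2 := lap_family_shift alpha B eta h (wave T) g (S k) Hh HB Hinh Hg).
  replace (fun p x => wave T p x * damp (S k) h x) with (fun p : freq r => wave T2 p) in Hg2.
  2:{ extensionality p. extensionality x. apply wave_at_scal. }
  assert (Hk2 : 0 <= 2 ^ k) by (apply pow_le; lra).
  assert (Hdec : forall x, exp (- ((eta + h / 2) * x)) = exp (- (eta * x)) * exp (- (h / 2 * x))).
  { intros x. rewrite <- exp_plus. f_equal. ring. }
  assert (Happ : approximable alpha r dT2 (fun p u => taylor_shift (S k) h g p 0 u)).
  { apply (IH (eta + h / 2) (A * 2 ^ S k * (1 + h)) T2 dT2); try easy.
    - lra.
    - intros x Hx. unfold T2. rewrite Cmod_mult, Cmod_R, Hdec.
      rewrite Rabs_pos_eq by (apply damp_pos; lra).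
      assert (H1 := damp_decay (S k) h x ltac:(lra) Hx). assert (H2 := HT x Hx).
      assert (H3 := damp_pos (S k) h x ltac:(lra) Hx).
      apply Rle_trans with (2 ^ S k * exp (- (h / 2 * x)) * (A * exp (- (eta * x)))).
      + apply Rmult_le_compat; try easy. apply Cmod_ge_0.
      + assert (0 <= A * 2 ^ S k * exp (- (eta * x)) * exp (- (h / 2 * x))).
        { repeat apply Rmult_le_pos; try lra; try (left; apply exp_pos). apply pow_le; lra. }
        nra.
    - intros x Hx. unfold dT2. apply Rle_trans with (1 := Cmod_triangle _ _).
      rewrite !Cmod_mult, !Cmod_R, Hdec.
      rewrite (Rabs_pos_eq (damp _ _ _)) by (apply damp_pos; lra).
      assert (H1 := damp_decay (S k) h x ltac:(lra) Hx). assert (H2 := HT x Hx).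
      assert (H3 := damp_pos (S k) h x ltac:(lra) Hx).
      assert (H4 := ddamp_decay k h x Hh Hx). assert (H5 := HdT x Hx).
      set (E1 := exp (- (h / 2 * x))) in *. set (E2 := exp (- (eta * x))) in *.
      assert (HE1 : 0 < E1) by apply exp_pos. assert (HE2 : 0 < E2) by apply exp_pos.
      apply Rle_trans with (h * 2 ^ k * E1 * (A * E2) + 2 ^ S k * E1 * (A * E2)).
      + apply Rplus_le_compat; apply Rmult_le_compat; try easy; try apply Cmod_ge_0.
        apply Rabs_pos.
      + assert (0 <= A * E1 * E2 * 2 ^ k * h) by (repeat apply Rmult_le_pos; lra).
        simpl. lra.
    - rewrite S_INR in Hm. lra. }
  destruct (Happ (eps / 2) ltac:(lra)) as (s & ds & N & H1 & H2 & H3 & H4 & H5).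
  exists s, ds, N. split; [exact H1|split; [exact H2|split; [exact H3|split]]].
  + intros x Hx.
    replace (Cminus (ds x) (dT x)) with (Cplus (Cminus (ds x) (dT2 x)) (Cminus (dT2 x) (dT x)))
      by ring.
    apply Rle_trans with (1 := Cmod_triangle _ _).
    replace eps with (eps / 2 + eps / 2) by field.
    apply Rplus_le_compat; [now apply H4|].
    replace (Cminus (dT2 x) (dT x)) with (Cplus (Cmult (RtoC (ddamp k h x)) (T x))
      (Cmult (RtoC (damp (S k) h x - 1)) (dT x)))
      by (unfold dT2; rewrite RtoC_minus; ring).
    apply Rle_trans with (1 := Cmod_triangle _ _). rewrite !Cmod_mult, !Cmod_R.
    apply Rle_trans with (2 := HN2 k (Nat.le_max_r _ _)).
    assert (Q1 := one_minus_damp k h x Hh Hx). assert (Q2 := ddamp_small k h x Hh Hx).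
    rewrite Rabs_minus_sym, (Rabs_pos_eq (1 - _)) by lra.
    assert (Q3 := HT x Hx). assert (Q4 := HdT x Hx).
    (* Here 2 h <= eta is used: the decay absorbs the growth exp (2 h x) of both damping errors. *)
    assert (Q5 : exp (2 * h * x) * exp (- (eta * x)) <= 1).
    { rewrite <- exp_plus, <- exp_0. apply exp_le_compat. nra. }
    assert (HE1 := exp_pos (2 * h * x)). assert (HE2 := exp_pos (- (eta * x))).
    set (E1 := exp (2 * h * x)) in *. set (E2 := exp (- (eta * x))) in *.
    assert (Hk : 0 <= (/ 2) ^ k) by (apply pow_le; lra).
    apply Rle_trans with (h * (/ 2) ^ k * E1 * (A * E2) + (/ 2) ^ k * E1 * (A * E2)).
    * apply Rplus_le_compat; apply Rmult_le_compat; try easy; try apply Cmod_ge_0;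
        try apply Rabs_pos; lra.
    * replace (h * (/ 2) ^ k * E1 * (A * E2) + (/ 2) ^ k * E1 * (A * E2)) with
        (A * (1 + h) * (/ 2) ^ k * (E1 * E2)) by ring.
      rewrite <- (Rmult_1_r (A * (1 + h) * (/ 2) ^ k)) at 2.
      apply Rmult_le_compat_l; [|exact Q5].
      repeat apply Rmult_le_pos; lra.
  + intros p u Hu.
    replace (RInt (lap_int 0 (wave s p) u) 0 N - g p 0%nat u) with
      ((RInt (lap_int 0 (wave s p) u) 0 N - taylor_shift (S k) h g p 0 u) +
       (taylor_shift (S k) h g p 0 u - g p 0%nat u))
      by (apply Rminus_diag_uniq; lra).
    apply Rle_trans with (1 := Rabs_triang _ _).
    replace eps with (eps / 2 + eps / 2) by field.
    apply Rplus_le_compat; [now apply H5|].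
    apply HN1; [|exact Hu]. unfold k. lia.
Qed.

(** * Derivatives of analytic functions along the real direction *)

Lemma pow_n_Cpow (z : C) (n : nat) : pow_n (K := C_AbsRing) z n = Cpow z n.
Proof.
induction n as [|n IH]; [easy|]. rewrite Cpow_S, <- IH. easy.
Qed.

Lemma Cmod_Cpow (z : C) (n : nat) : Cmod (Cpow z n) = Cmod z ^ n.
Proof.
induction n as [|n IH]; [apply Cmod_1|]. now rewrite Cpow_S, Cmod_mult, IH.
Qed.

Lemma part_plus (b : bool) (z w : C) : part b (Cplus z w) = part b z + part b w.
Proof. now destruct b. Qed.

Lemma part_minus (b : bool) (z w : C) : part b (Cminus z w) = part b z - part b w.
Proof. now destruct b. Qed.

Lemma part_RtoC_mult (b : bool) (x : R) (z : C) : part b (Cmult (RtoC x) z) = x * part b z.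
Proof. destruct b, z; simpl; ring. Qed.

Lemma part_filterlim (b : bool) (l : C) :
  filterlim (part b) (locally l) (locally (part b l)).
Proof.
intros Q [e He]. exists e. intros y Hy. apply He.
destruct b; apply Hy.
Qed.

Lemma is_series_part (b : bool) (c : nat -> C) (l : C) :
  is_series (K := C_AbsRing) (V := C_NormedModule) c l ->
  is_series (fun n => part b (c n)) (part b l).
Proof.
intros H.
assert (E : forall n, part b (sum_n (G := C_NormedModule) c n) = sum_n (fun n => part b (c n)) n).
{ induction n as [|n IH].
  - now rewrite !sum_O.
  - rewrite !sum_Sn, <- IH. apply (part_plus b). }
assert (Hl := filterlim_comp _ _ _ (sum_n (G := C_NormedModule) c) (part b) _ _ _ H (part_filterlim b l)).
refine (filterlim_ext _ _ E Hl).
Qed.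

Lemma series_geom (c : nat -> R) (K : R) :
  (forall n, Rabs (c n) <= K * (/ 2) ^ n) -> ex_series c /\ Rabs (Series c) <= 2 * K.
Proof.
intros H.
assert (Hq : Rabs (/ 2) < 1) by (rewrite Rabs_pos_eq; lra).
assert (Hg := is_series_geom (/ 2) Hq).
assert (Hk := is_series_scal_l K _ _ Hg).
change (is_series (fun n => K * (/ 2) ^ n) (K * / (1 - / 2))) in Hk.
assert (Hex : ex_series (fun n => Rabs (c n))).
{ apply (ex_series_le (K := R_AbsRing) (V := R_CompleteNormedModule) _
    (fun n => K * (/ 2) ^ n)).
  - intros n. unfold norm; simpl. unfold abs; simpl. rewrite Rabs_Rabsolu. apply H.
  - eexists; exact Hk. }
split; [now apply ex_series_Rabs|].
apply Rle_trans with (1 := Series_Rabs _ Hex).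
replace (2 * K) with (Series (fun n => K * (/ 2) ^ n)).
- apply Series_le; [|eexists; exact Hk]. intros n. split; [apply Rabs_pos|apply H].
- rewrite (is_series_unique _ _ Hk). field.
Qed.

Definition cseries (b : bool) (a : nat -> C) (z : C) : R :=
  Series (fun n => part b (Cmult (a n) (Cpow z n))).

Definition dcoef (a : nat -> C) (n : nat) : C := Cmult (RtoC (INR (S n))) (a (S n)).

Lemma cseries_bound (b : bool) (a : nat -> C) (A E : R) (z : C) :
  0 < E -> (forall n, Cmod (a n) <= A * E ^ n) -> Cmod z <= / (2 * E) ->
  ex_series (fun n => part b (Cmult (a n) (Cpow z n))) /\ Rabs (cseries b a z) <= 2 * A.
Proof.
intros HE Ha Hz. apply series_geom. intros n.
apply Rle_trans with (1 := part_le_Cmod _ _). rewrite Cmod_mult, Cmod_Cpow.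
apply Rle_trans with (A * E ^ n * (/ (2 * E)) ^ n).
- apply Rmult_le_compat; [apply Cmod_ge_0|apply pow_le, Cmod_ge_0|apply Ha|].
  apply pow_incr. split; [apply Cmod_ge_0|exact Hz].
- rewrite Rmult_assoc, <- Rpow_mult_distr.
  replace (E * / (2 * E)) with (/ 2) by (field; lra). apply Rle_refl.
Qed.

(** The errors of the first-order expansion obey e_(n+1) = w e_n + h^2 n z^(n-1), so they accumulate
    to at most n^2 h^2 rho^(n-2). Multiplying by rho^2 avoids negative exponents for n < 2. *)
Lemma Cpow_second_order (z w : C) (h rho : R) (n : nat) :
  0 < rho -> Cmod z <= rho -> Cmod w <= rho -> w = Cplus z (RtoC h) ->
  Cmod (Cminus (Cminus (Cpow w n) (Cpow z n))
     (Cmult (RtoC h) (Cmult (RtoC (INR n)) (Cpow z (pred n))))) * rho ^ 2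
  <= INR n ^ 2 * h ^ 2 * rho ^ n.
Proof.
intros Hr Hz Hw E.
induction n as [|n IH].
- simpl Cpow. replace (Cminus _ _) with (RtoC 0) by (simpl INR; ring).
  rewrite Cmod_0. simpl. lra.
- set (e := fun n => Cminus (Cminus (Cpow w n) (Cpow z n))
     (Cmult (RtoC h) (Cmult (RtoC (INR n)) (Cpow z (pred n))))) in *.
  change (Cmod (e n) * rho ^ 2 <= INR n ^ 2 * h ^ 2 * rho ^ n) in IH.
  change (Cmod (e (S n)) * rho ^ 2 <= INR (S n) ^ 2 * h ^ 2 * rho ^ S n).
  assert (Ee : e (S n) = Cplus (Cmult w (e n))
    (Cmult (RtoC (h ^ 2 * INR n)) (Cpow z (pred n)))).
  { unfold e. rewrite S_INR, RtoC_plus, RtoC_mult, !Cpow_S. simpl pred.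
    replace (RtoC (h ^ 2)) with (Cmult (RtoC h) (RtoC h)) by (rewrite <- RtoC_mult; f_equal; ring).
    destruct n as [|n].
    - simpl. rewrite E. ring.
    - simpl pred. rewrite !Cpow_S. rewrite E. ring. }
  rewrite Ee.
  apply Rle_trans with ((rho * Cmod (e n) + h ^ 2 * INR n * rho ^ pred n) * rho ^ 2).
  + apply Rmult_le_compat_r; [apply pow2_ge_0|].
    apply Rle_trans with (1 := Cmod_triangle _ _). apply Rplus_le_compat.
    * rewrite Cmod_mult. apply Rmult_le_compat_r; [apply Cmod_ge_0|exact Hw].
    * assert (0 <= h ^ 2 * INR n) by (apply Rmult_le_pos; [apply pow2_ge_0|apply pos_INR]).
      rewrite Cmod_mult, Cmod_R, Cmod_Cpow, Rabs_pos_eq by easy.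
      apply Rmult_le_compat_l; [easy|]. apply pow_incr. split; [apply Cmod_ge_0|exact Hz].
  + assert (Hn : INR n * rho ^ pred n * rho ^ 2 = INR n * rho ^ S n).
    { destruct n as [|n]; [simpl; ring|]. simpl pred. simpl. ring. }
    assert (Hh : 0 <= h ^ 2) by apply pow2_ge_0.
    assert (Hrn : 0 < rho ^ S n) by (apply pow_lt; exact Hr).
    assert (Hi := pos_INR n).
    apply (Rmult_le_compat_l rho) in IH; [|lra].
    replace (rho * (INR n ^ 2 * h ^ 2 * rho ^ n)) with (INR n ^ 2 * h ^ 2 * rho ^ S n) in IH
      by (simpl; ring).
    rewrite S_INR.
    replace ((rho * Cmod (e n) + h ^ 2 * INR n * rho ^ pred n) * rho ^ 2) with
      (rho * (Cmod (e n) * rho ^ 2) + h ^ 2 * (INR n * rho ^ pred n * rho ^ 2)) by ring.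
    rewrite Hn.
    assert (0 <= h ^ 2 * rho ^ S n * (INR n + 1))
      by (apply Rmult_le_pos; [apply Rmult_le_pos; lra|lra]).
    lra.
Qed.

Lemma INR_le_pow2 (n : nat) : INR n <= 2 ^ n.
Proof.
induction n as [|n IH]; [simpl; lra|]. rewrite S_INR. simpl.
assert (1 <= 2 ^ n) by (apply pow_R1_Rle; lra). lra.
Qed.

Lemma cseries_derive (b : bool) (a : nat -> C) (A A' E x y : R) :
  0 < E -> (forall n, Cmod (a n) <= A * E ^ n) ->
  (forall n, Cmod (dcoef a n) <= A' * E ^ n) -> Cmod (x, y) < / (8 * E) ->
  is_derive (fun t => cseries b a (t, y)) x (cseries b (dcoef a) (x, y)).
Proof.
(* With E rho = 1/8 and n <= 2^n, the second-order terms n^2 (E rho)^n are at most 2^(-n). *)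
intros HE Ha Hda Hz. set (rho := / (8 * E)) in *.
assert (Hrho : 0 < rho) by (apply Rinv_0_lt_compat; lra).
assert (Hrho2 : rho <= / (2 * E)) by (apply Rinv_le_contravar; lra).
apply (is_derive_quad _ _ _ (rho - Cmod (x, y)) (2 * (A / rho ^ 2))); [lra|].
intros h Hh. set (z := (x, y)) in *. set (w := (x + h, y)).
change (Rabs (cseries b a w - cseries b a z - h * cseries b (dcoef a) z)
  <= 2 * (A / rho ^ 2) * h ^ 2).
assert (Ew : w = Cplus z (RtoC h)).
{ unfold w, z, Cplus, RtoC; simpl. f_equal; ring. }
assert (Hw : Cmod w <= rho).
{ rewrite Ew. apply Rle_trans with (1 := Cmod_triangle _ _). rewrite Cmod_R. lra. }
destruct (cseries_bound b a A E z HE Ha ltac:(lra)) as [Hz1 _].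
destruct (cseries_bound b a A E w HE Ha ltac:(lra)) as [Hw1 _].
destruct (cseries_bound b (dcoef a) A' E z HE Hda ltac:(lra)) as [Hd1 _].
(* The derived series before reindexing, so that it can be subtracted term by term; its term at n =
   0 is zero. *)
set (d := fun n => part b (Cmult (a n) (Cmult (RtoC (INR n)) (Cpow z (pred n))))).
assert (Hdex : ex_series d).
{ apply ex_series_incr_1.
  apply ex_series_ext with (2 := Hd1). intros n. unfold d, dcoef. simpl pred. f_equal. ring. }
assert (Hds : cseries b (dcoef a) z = Series d).
{ rewrite (Series_incr_1 d Hdex).
  replace (d O) with 0.
  - rewrite Rplus_0_l. apply Series_ext. intros n. unfold d, dcoef. simpl pred. f_equal. ring.
  - unfold d. simpl INR. replace (Cmult (a O) _) with (RtoC 0) by ring. now destruct b. }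
rewrite Hds. unfold cseries.
rewrite <- (Series_minus _ _ Hw1 Hz1), <- (Series_scal_l h).
assert (Hhd : ex_series (fun n => h * d n)).
{ apply (ex_series_scal_l (K := R_AbsRing) h d Hdex). }
rewrite <- Series_minus; [| |exact Hhd].
2:{ apply (ex_series_minus (K := R_AbsRing) (V := R_NormedModule) _ _ Hw1 Hz1). }
replace (2 * (A / rho ^ 2) * h ^ 2) with (2 * (A / rho ^ 2 * h ^ 2)) by ring.
apply series_geom. intros n. unfold d.
rewrite <- part_minus, <- part_RtoC_mult, <- part_minus.
apply Rle_trans with (1 := part_le_Cmod _ _).
replace (Cminus (Cminus (Cmult (a n) (Cpow w n)) (Cmult (a n) (Cpow z n)))
   (Cmult (RtoC h) (Cmult (a n) (Cmult (RtoC (INR n)) (Cpow z (pred n))))))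
 with (Cmult (a n) (Cminus (Cminus (Cpow w n) (Cpow z n))
     (Cmult (RtoC h) (Cmult (RtoC (INR n)) (Cpow z (pred n)))))) by ring.
rewrite Cmod_mult.
assert (H2 := Cpow_second_order z w h rho n Hrho ltac:(lra) Hw Ew).
set (e := Cmod (Cminus _ _)) in *.
assert (Hr2 : 0 < rho ^ 2) by (apply pow_lt; exact Hrho).
assert (He0 : 0 <= e) by apply Cmod_ge_0.
apply Rmult_le_reg_r with (rho ^ 2); [exact Hr2|].
replace (A / rho ^ 2 * h ^ 2 * (/ 2) ^ n * rho ^ 2) with (A * h ^ 2 * (/ 2) ^ n) by (field; lra).
rewrite Rmult_assoc.
apply Rle_trans with (A * E ^ n * (INR n ^ 2 * h ^ 2 * rho ^ n)).
{ apply Rmult_le_compat; [apply Cmod_ge_0|apply Rmult_le_pos; lra|apply Ha|exact H2]. }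
assert (HA : 0 <= A).
{ specialize (Ha O). rewrite pow_O, Rmult_1_r in Ha. pose proof (Cmod_ge_0 (a O)). lra. }
replace (A * E ^ n * (INR n ^ 2 * h ^ 2 * rho ^ n)) with
  (A * h ^ 2 * (INR n ^ 2 * (E * rho) ^ n)) by (rewrite Rpow_mult_distr; ring).
apply Rmult_le_compat_l.
{ apply Rmult_le_pos; [exact HA|apply pow2_ge_0]. }
replace (E * rho) with (/ 8) by (unfold rho; field; lra).
replace ((/ 2) ^ n) with ((2 ^ n) ^ 2 * (/ 8) ^ n).
- apply Rmult_le_compat_r; [apply pow_le; lra|].
  apply pow_incr. split; [apply pos_INR|apply INR_le_pow2].
- rewrite <- pow_mult, Nat.mul_comm, pow_mult, <- Rpow_mult_distr. f_equal. field.
Qed.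

Fixpoint dcoef_n (j : nat) (a : nat -> C) : nat -> C :=
  match j with O => a | S k => dcoef (dcoef_n k a) end.

Lemma dcoef_n_eq (j : nat) (a : nat -> C) (n : nat) :
  dcoef_n j a n = Cmult (RtoC (INR (fact (n + j)) / INR (fact n))) (a (n + j)%nat).
Proof.
revert n. induction j as [|j IH]; intros n.
- simpl. rewrite Nat.add_0_r. unfold Rdiv. rewrite Rinv_r by apply INR_fact_neq_0. ring.
- simpl dcoef_n. unfold dcoef. rewrite IH, Cmult_assoc, <- RtoC_mult.
  replace (S n + j)%nat with (n + S j)%nat by lia. f_equal. f_equal.
  rewrite (INR_fact_S n). field. split; [apply INR_fact_neq_0|].
  apply not_0_INR; lia.
Qed.

(** Derivatives of all orders share the rate 2 D, because (n+j)! / n! <= j! 2^(n+j) splits into a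
    part in [n] and a part in [j]. This yields Cauchy estimates from the power series alone. *)
Lemma dcoef_n_bound (j : nat) (a : nat -> C) (A D : R) : 0 < D ->
  (forall n, Cmod (a n) <= A * D ^ n) ->
  forall n, Cmod (dcoef_n j a n) <= A * INR (fact j) * (2 * D) ^ j * (2 * D) ^ n.
Proof.
intros HD Ha n. rewrite dcoef_n_eq, Cmod_mult, Cmod_R.
assert (Hn := INR_fact_pos n). assert (Hnj := INR_fact_pos (n + j)).
rewrite Rabs_pos_eq by (apply Rdiv_le_0_compat; lra).
assert (Hf : INR (fact (n + j)) / INR (fact n) <= INR (fact j) * 2 ^ (n + j)).
{ apply Rmult_le_reg_r with (INR (fact n)); [exact Hn|].
  unfold Rdiv. rewrite Rmult_assoc, Rinv_l, Rmult_1_r by lra.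
  assert (H := fact_add_le n j). lra. }
replace (A * INR (fact j) * (2 * D) ^ j * (2 * D) ^ n) with
  (INR (fact j) * 2 ^ (n + j) * (A * D ^ (n + j))) by (rewrite !Rpow_mult_distr, !pow_add; ring).
apply Rmult_le_compat; [apply Rdiv_le_0_compat; lra|apply Cmod_ge_0|exact Hf|apply Ha].
Qed.

Lemma analytic_at_coef (F : C -> C) (u0 v0 : R) : analytic_at F (u0, v0) ->
  exists (a : nat -> C) (A D R0 : R), 0 < D /\ 0 < R0 /\
    (forall n, Cmod (a n) <= A * D ^ n) /\
    forall b u v, Rabs (u - u0) < R0 -> Rabs (v - v0) < R0 ->
      part b (F (u, v)) = cseries b a (u - u0, v - v0).
Proof.
intros [a [[e He] Ha]]. simpl in Ha.
assert (Hs : forall b u v, Rabs (u - u0) < e -> Rabs (v - v0) < e ->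
  is_series (fun n => part b (Cmult (a n) (Cpow (u - u0, v - v0) n))) (part b (F (u, v)))).
{ intros b u v Hu Hv.
  assert (Hz := Ha (u, v) (conj Hu Hv)). apply (is_series_part b) in Hz.
  apply is_series_ext with (2 := Hz). intros n. f_equal. rewrite pow_n_Cpow.
  rewrite Cmult_comm. easy. }
(* At a real offset t the powers are real, so each component of a_n t^n is a term of a convergent
   series and hence bounded. *)
set (t := e / 2).
assert (Ht : 0 < t) by (unfold t; lra).
assert (Hb : forall b, exists A, forall n, Rabs (part b (a n)) * t ^ n <= A).
{ intros b.
  assert (H := Hs b (u0 + t) v0).
  replace (u0 + t - u0) with t in H by ring. replace (v0 - v0) with 0 in H by ring.
  rewrite Rabs_R0, (Rabs_pos_eq t) in H by lra.
  specialize (H ltac:(unfold t; lra) He).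
  assert (Hl := ex_series_lim_0 _ (ex_intro _ _ H)).
  apply is_lim_seq_Reals in Hl.
  destruct (maj_by_pos _ (exist _ 0 Hl)) as [A [HA HAn]].
  exists A. intros n. specialize (HAn n).
  replace (part b (Cmult (a n) (Cpow (t, 0) n))) with (t ^ n * part b (a n)) in HAn.
  - rewrite Rabs_mult, (Rabs_pos_eq (t ^ n)) in HAn by (apply pow_le; lra). lra.
  - rewrite <- part_RtoC_mult, Cmult_comm. f_equal. f_equal.
    clear. induction n as [|n IH]; [easy|]. rewrite Cpow_S, <- IH.
    change (t, 0) with (RtoC t). rewrite <- RtoC_mult. easy. }
destruct (Hb true) as [A1 HA1]. destruct (Hb false) as [A2 HA2].
exists a, (A1 + A2), (/ t), e. split; [now apply Rinv_0_lt_compat|]. split; [exact He|]. split.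
- intros n. assert (Htn : 0 < t ^ n) by (apply pow_lt; exact Ht).
  apply Rmult_le_reg_r with (t ^ n); [exact Htn|].
  rewrite pow_inv, Rmult_assoc, Rinv_l, Rmult_1_r by lra.
  specialize (HA1 n). specialize (HA2 n). simpl in HA1, HA2.
  assert (H := Cmod_le_parts (a n)).
  apply (Rmult_le_compat_r (t ^ n)) in H; lra.
- intros b u v Hu Hv. symmetry. apply is_series_unique. now apply Hs.
Qed.

(** For analytic [F] these are the complex derivatives. Built on the total [Derive], they do not
    refer to a centre of expansion, so local bounds can be glued by compactness. *)
Fixpoint real_derive_n (j : nat) (F : C -> C) : C -> C :=
  match j with
  | O => F
  | S k => fun z =>
      (Derive (fun x => fst (real_derive_n k F (x, snd z))) (fst z),
       Derive (fun x => snd (real_derive_n k F (x, snd z))) (fst z))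
  end.

Lemma part_real_derive_S (b : bool) (j : nat) (F : C -> C) (u v : R) :
  part b (real_derive_n (S j) F (u, v)) = Derive (fun x => part b (real_derive_n j F (x, v))) u.
Proof. now destruct b. Qed.

Lemma analytic_at_derivatives (F : C -> C) (u0 v0 : R) : analytic_at F (u0, v0) ->
  exists M B R0 : R, 0 < R0 /\ 0 <= B /\ forall u v, Rabs (u - u0) < R0 -> Rabs (v - v0) < R0 ->
    forall b j,
      is_derive (fun x => part b (real_derive_n j F (x, v))) u
        (part b (real_derive_n (S j) F (u, v))) /\
      Rabs (part b (real_derive_n j F (u, v))) <= M * INR (fact j) * B ^ j.
Proof.
intros H. destruct (analytic_at_coef F u0 v0 H) as (a & A & D & R0 & HD & HR0 & Ha & HF).
(* Half of the radius required by [cseries_derive], because the modulus is estimated by the sum of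
   the two components. *)
set (R1 := Rmin R0 (/ (2 * (8 * (2 * D))))).
assert (HR1 : 0 < R1).
{ apply Rmin_pos; [exact HR0|]. apply Rinv_0_lt_compat; lra. }
assert (HR10 : R1 <= R0) by apply Rmin_l.
assert (Hsmall : forall u v, Rabs (u - u0) < R1 -> Rabs (v - v0) < R1 ->
  Cmod (u - u0, v - v0) < / (8 * (2 * D))).
{ intros u v Hu Hv. apply Rle_lt_trans with (1 := Cmod_le_parts _). simpl.
  assert (R1 <= / (2 * (8 * (2 * D)))) by apply Rmin_r.
  replace (/ (8 * (2 * D))) with (/ (2 * (8 * (2 * D))) + / (2 * (8 * (2 * D)))) by (field; lra).
  lra. }
assert (Hb := fun j => dcoef_n_bound j a A D HD Ha).
assert (HE : 0 < 2 * D) by lra.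
assert (Hder : forall j b u v, Rabs (u - u0) < R1 -> Rabs (v - v0) < R1 ->
  is_derive (fun x => cseries b (dcoef_n j a) (x - u0, v - v0)) u
    (cseries b (dcoef_n (S j) a) (u - u0, v - v0))).
{ intros j b u v Hu Hv.
  assert (Hc := cseries_derive b (dcoef_n j a) _ _ (2 * D) (u - u0) (v - v0) HE (Hb j) (Hb (S j))
    (Hsmall u v Hu Hv)).
  replace (cseries b (dcoef_n (S j) a) (u - u0, v - v0)) with
    (scal 1 (cseries b (dcoef_n (S j) a) (u - u0, v - v0)))
    by apply (scal_one (K := R_AbsRing) (V := R_NormedModule)).
  apply (is_derive_comp (fun t => cseries b (dcoef_n j a) (t, v - v0)) (fun x => x - u0) u _ 1 Hc).
  auto_derive; [easy|ring]. }
assert (Hloc : forall u, Rabs (u - u0) < R1 -> locally u (fun x => Rabs (x - u0) < R1)).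
{ intros u Hu. exists (mkposreal (R1 - Rabs (u - u0)) ltac:(lra)). intros x Hx.
  change (Rabs (x - u) < R1 - Rabs (u - u0)) in Hx.
  replace (x - u0) with ((x - u) + (u - u0)) by ring.
  apply Rle_lt_trans with (1 := Rabs_triang _ _). lra. }
assert (Heq : forall j b u v, Rabs (u - u0) < R1 -> Rabs (v - v0) < R1 ->
  part b (real_derive_n j F (u, v)) = cseries b (dcoef_n j a) (u - u0, v - v0)).
{ induction j as [|j IH]; intros b u v Hu Hv.
  - apply HF; lra.
  - rewrite part_real_derive_S.
    rewrite (Derive_ext_loc _ (fun x => cseries b (dcoef_n j a) (x - u0, v - v0))).
    + apply is_derive_unique. now apply Hder.
    + apply filter_imp with (2 := Hloc u Hu). intros x Hx. now apply IH. }
exists (2 * A), (2 * D), R1. split; [exact HR1|]. split; [lra|].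
intros u v Hu Hv b j. split.
- apply is_derive_ext_loc with (fun x => cseries b (dcoef_n j a) (x - u0, v - v0)).
  + apply filter_imp with (2 := Hloc u Hu). intros x Hx. symmetry. now apply Heq.
  + rewrite Heq by easy. now apply Hder.
- rewrite Heq by easy.
  replace (2 * A * INR (fact j) * (2 * D) ^ j) with (2 * (A * INR (fact j) * (2 * D) ^ j)) by ring.
  apply (cseries_bound b _ _ (2 * D) _ HE (Hb j)).
  left. apply Rlt_le_trans with (1 := Hsmall u v Hu Hv). apply Rinv_le_contravar; lra.
Qed.

(** * Compactness and the identity theorem *)

(** The form of Heine-Borel behind all uniform bounds below: local data are packed into a single
    radius, and the lower bound [e0] of the radii is what becomes uniform. *)
Lemma compact_2d (a b c d : R) (P : R -> R -> R -> Prop) :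
  (forall x y, a <= x <= b -> c <= y <= d -> exists e, 0 < e /\ P x y e) ->
  exists e0, 0 < e0 /\ forall x y, a <= x <= b -> c <= y <= d ->
    exists u v e, a <= u <= b /\ c <= v <= d /\ P u v e /\ e0 <= e /\
      Rabs (x - u) < e /\ Rabs (y - v) < e.
Proof.
intros H.
(* Outside the rectangle an arbitrary radius makes the gauge total, as [compactness_value_2d]
   requires. *)
assert (H' : forall x y, exists e : posreal, a <= x <= b -> c <= y <= d -> P x y e).
{ intros x y. destruct (classic (a <= x <= b /\ c <= y <= d)) as [[Hx Hy]|Hn].
  - destruct (H x y Hx Hy) as [e [He HP]]. now exists (mkposreal e He).
  - exists (mkposreal 1 Rlt_0_1). tauto. }
set (delta := fun x y => proj1_sig (constructive_indefinite_description _ (H' x y))).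
destruct (compactness_value_2d a b c d delta) as [e0 He0].
exists e0. split; [apply cond_pos|]. intros x y Hx Hy.
apply NNPP. intros Hn. apply (He0 x y Hx Hy). intros (u & v & Hu & Hv & H1 & H2 & H3).
apply Hn. exists u, v, (delta u v). repeat split; try easy.
exact (proj2_sig (constructive_indefinite_description _ (H' u v)) Hu Hv).
Qed.

Definition cont_within_rect (a b c d : R) (f : C -> R) : Prop :=
  forall x y, a <= x <= b -> c <= y <= d -> forall eps, 0 < eps ->
  exists e, 0 < e /\ forall u v, a <= u <= b -> c <= v <= d ->
    Rabs (u - x) < e -> Rabs (v - y) < e -> Rabs (f (u, v) - f (x, y)) < eps.

Lemma rect_uniform_continuity (a b c d : R) (f : C -> R) : cont_within_rect a b c d f ->
  forall eps, 0 < eps -> exists e, 0 < e /\ forall x y u v,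
    a <= x <= b -> c <= y <= d -> a <= u <= b -> c <= v <= d ->
    Rabs (u - x) < e -> Rabs (v - y) < e -> Rabs (f (u, v) - f (x, y)) < eps.
Proof.
intros Hf eps Heps.
(* The local condition holds on twice the radius, so that a point and its neighbour are both
   compared with one centre. *)
destruct (compact_2d a b c d (fun x y e => forall u v, a <= u <= b -> c <= v <= d ->
    Rabs (u - x) < 2 * e -> Rabs (v - y) < 2 * e -> Rabs (f (u, v) - f (x, y)) < eps / 2))
  as [e0 [He0 H]].
- intros x y Hx Hy. destruct (Hf x y Hx Hy (eps / 2) ltac:(lra)) as [e [He HP]].
  exists (e / 2). split; [lra|]. intros u v Hu Hv H1 H2. apply HP; lra.
- exists e0. split; [exact He0|]. intros x y u v Hx Hy Hu Hv H1 H2.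
  destruct (H x y Hx Hy) as (x0 & y0 & e & _ & _ & HP & Hee & H3 & H4).
  replace (f (u, v) - f (x, y)) with ((f (u, v) - f (x0, y0)) + - (f (x, y) - f (x0, y0))) by ring.
  apply Rle_lt_trans with (1 := Rabs_triang _ _). rewrite Rabs_Ropp.
  assert (Q1 := HP x y Hx Hy ltac:(lra) ltac:(lra)).
  assert (Q2 : Rabs (f (u, v) - f (x0, y0)) < eps / 2).
  { apply (HP u v Hu Hv).
    - replace (u - x0) with ((u - x) + (x - x0)) by ring.
      apply Rle_lt_trans with (1 := Rabs_triang _ _). lra.
    - replace (v - y0) with ((v - y) + (y - y0)) by ring.
      apply Rle_lt_trans with (1 := Rabs_triang _ _). lra. }
  lra.
Qed.

(** The bound is encoded as / e, so that the single number delivered by [compact_2d] serves as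
    radius and as bound. *)
Lemma rect_bounded (a b c d : R) (f : C -> R) : cont_within_rect a b c d f ->
  exists D, 0 <= D /\ forall x y, a <= x <= b -> c <= y <= d -> Rabs (f (x, y)) <= D.
Proof.
intros Hf.
destruct (compact_2d a b c d (fun x y e => forall u v, a <= u <= b -> c <= v <= d ->
    Rabs (u - x) < e -> Rabs (v - y) < e -> Rabs (f (u, v)) <= / e))
  as [e0 [He0 H]].
- intros x y Hx Hy. destruct (Hf x y Hx Hy 1 ltac:(lra)) as [e [He HP]].
  assert (Hp := Rabs_pos (f (x, y))).
  set (e1 := / (Rabs (f (x, y)) + 1)).
  assert (He1 : 0 < e1) by (apply Rinv_0_lt_compat; lra).
  exists (Rmin e e1). split; [now apply Rmin_pos|]. intros u v Hu Hv H1 H2.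
  assert (Q := HP u v Hu Hv (Rlt_le_trans _ _ _ H1 (Rmin_l _ _)) (Rlt_le_trans _ _ _ H2 (Rmin_l _ _))).
  apply Rle_trans with (/ e1).
  + unfold e1. rewrite Rinv_inv.
    replace (f (u, v)) with ((f (u, v) - f (x, y)) + f (x, y)) by ring.
    apply Rle_trans with (1 := Rabs_triang _ _). lra.
  + apply Rinv_le_contravar; [now apply Rmin_pos|apply Rmin_r].
- exists (/ e0). split; [left; now apply Rinv_0_lt_compat|]. intros x y Hx Hy.
  destruct (H x y Hx Hy) as (u & v & e & _ & _ & HP & Hee & H3 & H4).
  apply Rle_trans with (1 := HP x y Hx Hy H3 H4). now apply Rinv_le_contravar.
Qed.

(** As in [rect_bounded], one e carries the radius and, through / e, both constants of the local
    estimates; shrinking e only weakens them. *)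
Lemma analytic_rect_bound (a b c d : R) (F : C -> C) :
  (forall u v, a <= u <= b -> c <= v <= d -> analytic_at F (u, v)) ->
  exists M B, 0 <= M /\ 0 <= B /\ forall u v, a <= u <= b -> c <= v <= d ->
    forall bb j, Rabs (part bb (real_derive_n j F (u, v))) <= M * INR (fact j) * B ^ j.
Proof.
intros HF.
destruct (compact_2d a b c d (fun x y e => forall u v, Rabs (u - x) < e -> Rabs (v - y) < e ->
   forall bb j, Rabs (part bb (real_derive_n j F (u, v))) <= / e * INR (fact j) * (/ e) ^ j))
  as [e0 [He0 H]].
- intros x y Hx Hy.
  destruct (analytic_at_derivatives F x y (HF x y Hx Hy)) as (M & B & R0 & HR0 & HB & HP).
  set (e := Rmin R0 (/ (Rabs M + B + 1))).
  assert (HM := Rabs_pos M).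
  assert (Hpos : 0 < / (Rabs M + B + 1)) by (apply Rinv_0_lt_compat; lra).
  assert (He : 0 < e) by now apply Rmin_pos.
  assert (Hie : Rabs M + B + 1 <= / e).
  { rewrite <- (Rinv_inv (Rabs M + B + 1)). apply Rinv_le_contravar; [exact He|apply Rmin_r]. }
  exists e. split; [exact He|]. intros u v Hu Hv bb j.
  destruct (HP u v (Rlt_le_trans _ _ _ Hu (Rmin_l _ _)) (Rlt_le_trans _ _ _ Hv (Rmin_l _ _)) bb j)
    as [_ Hb].
  apply Rle_trans with (1 := Hb).
  assert (Hf := INR_fact_pos j). assert (HMa := Rle_abs M).
  apply Rle_trans with (/ e * INR (fact j) * B ^ j).
  + apply Rmult_le_compat_r; [now apply pow_le|]. apply Rmult_le_compat_r; lra.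
  + apply Rmult_le_compat_l; [apply Rmult_le_pos; lra|]. apply pow_incr. lra.
- assert (Hi : 0 < / e0) by now apply Rinv_0_lt_compat.
  exists (/ e0), (/ e0). split; [lra|split; [lra|]]. intros u v Hu Hv bb j.
  destruct (H u v Hu Hv) as (u0 & v0 & e & _ & _ & HP & Hee & H3 & H4).
  apply Rle_trans with (1 := HP u v H3 H4 bb j).
  assert (Hie : / e <= / e0) by now apply Rinv_le_contravar.
  assert (Hie0 : 0 < / e) by (apply Rinv_0_lt_compat; lra).
  assert (Hf := INR_fact_pos j).
  apply Rmult_le_compat.
  + apply Rmult_le_pos; lra.
  + apply pow_le; lra.
  + apply Rmult_le_compat_r; lra.
  + apply pow_incr; lra.
Qed.

(** * The identity theorem on a rectangle *)

Lemma derivatives_zero (f : nat -> R -> R) (a b : R) :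
  (forall j t, a < t < b -> is_derive (f j) t (f (S j) t)) ->
  (forall t, a < t < b -> f O t = 0) -> forall j t, a < t < b -> f j t = 0.
Proof.
intros Hd H0 j. induction j as [|j IH]; [exact H0|]. intros t Ht.
assert (Hloc : locally t (fun x => a < x < b)).
{ exists (mkposreal (Rmin (t - a) (b - t)) ltac:(apply Rmin_pos; lra)). intros x Hx.
  change (Rabs (x - t) < Rmin (t - a) (b - t)) in Hx. apply Rabs_def2 in Hx.
  pose proof (Rmin_l (t - a) (b - t)). pose proof (Rmin_r (t - a) (b - t)). lra. }
rewrite <- (is_derive_unique _ _ _ (Hd j t Ht)).
rewrite (Derive_ext_loc _ (fun _ => 0)); [apply Derive_const|].
now apply filter_imp with (2 := Hloc).
Qed.

(** The zero set is extended to the left in steps of h: at t + h all derivatives vanish, so the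
    Taylor polynomials there are zero, and their remainder tends to 0 because h B <= 1/4. *)
Lemma real_analytic_zero (f : nat -> R -> R) (a b c M B : R) : a < c < b -> 0 <= B ->
  (forall j t, a < t < b -> is_derive (f j) t (f (S j) t)) ->
  (forall j t, a < t < b -> Rabs (f j t) <= M * INR (fact j) * B ^ j) ->
  (forall t, c < t < b -> f O t = 0) -> forall t, a < t < b -> f O t = 0.
Proof.
intros Hac HB Hd HM H0.
(* The first bound keeps t + h below [b] when t <= c, the second gives h B <= 1/4. *)
set (h := Rmin ((b - c) / 2) (/ (4 * (B + 1)))).
assert (Hh : 0 < h).
{ apply Rmin_pos; [lra|]. apply Rinv_0_lt_compat; lra. }
assert (Hhb : h <= (b - c) / 2) by apply Rmin_l.
assert (HhB : h * B <= / 4).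
{ apply Rle_trans with (/ (4 * (B + 1)) * (B + 1)).
  - apply Rmult_le_compat; try lra. apply Rmin_r.
  - right. field. lra. }
assert (Hind : forall m t, Rmax a (c - INR m * h) < t < b -> f O t = 0).
{ induction m as [|m IH]; intros t [Ht Htb].
  - rewrite Rmult_0_l, Rminus_0_r, Rmax_right in Ht by lra. apply H0; lra.
  - assert (Hta := Rle_lt_trans _ _ _ (Rmax_l _ _) Ht).
    assert (Htc := Rle_lt_trans _ _ _ (Rmax_r _ _) Ht).
    destruct (Rlt_dec c t) as [Hct|Hct]; [now apply H0|].
    rewrite S_INR in Htc.
    assert (Hz : forall j, f j (t + h) = 0).
    { intros j. apply (derivatives_zero f (Rmax a (c - INR m * h)) b).
      - intros i s [Hs Hsb]. apply Hd. split; [|exact Hsb].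
        apply Rle_lt_trans with (2 := Hs), Rmax_l.
      - exact IH.
      - split; [apply Rmax_lub_lt; lra|lra]. }
    apply Rabs_eq_0. apply Rle_antisym; [|apply Rabs_pos].
    apply Rnot_lt_le. intros Hpos.
    destruct (pow_lt_eps (Rabs M * INR (fact (0 + 1)) * 2 ^ 0) (Rabs (f O t) / 2) ltac:(lra))
      as [n Hn].
    specialize (Hn (S n) ltac:(lia)).
    assert (Ht2 := taylor_geom f M B t h 0 n Hh HB HhB
      ltac:(intros; apply Hd; lra)
      ltac:(intros; rewrite Nat.add_0_r; apply HM; lra)).
    rewrite (psum_ext _ (fun _ => 0 * 0)) in Ht2 by (intros; rewrite Hz; ring).
    rewrite psum_scal, Rmult_0_l, Rminus_0_l, Rabs_Ropp in Ht2. lra. }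
intros t [Ht Htb].
destruct (INR_unbounded ((c - t) / h)) as [m Hm].
apply (Hind m). split; [|exact Htb]. apply Rmax_lub_lt; [exact Ht|].
apply (Rmult_lt_compat_r h) in Hm; [|exact Hh].
replace ((c - t) / h * h) with (c - t) in Hm by (field; lra). lra.
Qed.

Lemma analytic_at_real_derive (F : C -> C) (u v : R) (b : bool) (j : nat) : analytic_at F (u, v) ->
  is_derive (fun x => part b (real_derive_n j F (x, v))) u
    (part b (real_derive_n (S j) F (u, v))).
Proof.
intros H. destruct (analytic_at_derivatives F u v H) as (M & B & R0 & HR0 & _ & HP).
apply HP; rewrite Rminus_diag, Rabs_R0; exact HR0.
Qed.

(** Each horizontal line is treated separately: it joins the point to Re s > 0 by a compact segment
    inside the rectangle, and [real_analytic_zero] applies to F - G on it. *)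
Lemma rect_ext_unique (alpha r : R) (F G : C -> C) : alpha < 0 ->
  (forall s, rect alpha r s -> analytic_at F s) ->
  (forall s, rect alpha r s -> analytic_at G s) ->
  (forall s, rect alpha r s -> 0 < Re s -> F s = G s) ->
  forall s, rect alpha r s -> F s = G s.
Proof.
intros Ha HF HG HFG [u v] [[Hu1 Hu2] Hv]. simpl in Hu1, Hu2, Hv.
assert (Hv' := Rabs_def2 _ _ Hv).
(* The segment [a, b] has [u] in its interior, stays off the sides of the open rectangle and reaches
   positive real parts. *)
set (a := (alpha + u) / 2).
set (b := Rmax ((u + 1) / 2) (/ 2)).
assert (Hb1 : b < 1) by (apply Rmax_lub_lt; lra).
assert (Hb2 : u < b) by (apply Rlt_le_trans with (2 := Rmax_l _ _); lra).
assert (Hb3 : 0 < b) by (apply Rlt_le_trans with (2 := Rmax_r _ _); lra).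
assert (Hrect : forall t w, a <= t <= b -> v <= w <= v -> rect alpha r (t, w)).
{ intros t w Ht Hw. replace w with v by lra. unfold rect; simpl.
  unfold a in Ht. split; [lra|exact Hv]. }
destruct (analytic_rect_bound a b v v F) as (M1 & B1 & HM1 & HB1 & HP1).
{ intros; now apply HF, Hrect. }
destruct (analytic_rect_bound a b v v G) as (M2 & B2 & HM2 & HB2 & HP2).
{ intros; now apply HG, Hrect. }
assert (Hpart : forall bb, part bb (F (u, v)) - part bb (G (u, v)) = 0).
{ intros bb.
  (* The third point must lie strictly between a and b even if a >= 0, hence the maximum of 0 with
     the midpoint. *)
  apply (real_analytic_zero (fun j t => part bb (real_derive_n j F (t, v)) - part bb (real_derive_n j G (t, v)))
    a b (Rmax 0 ((a + b) / 2)) (M1 + M2) (Rmax B1 B2)).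
  - split; [|apply Rmax_lub_lt]; unfold a in *; try lra.
    apply Rlt_le_trans with (2 := Rmax_r _ _). lra.
  - apply Rle_trans with (2 := Rmax_l _ _). exact HB1.
  - intros j t Ht. apply (is_derive_minus (K := R_AbsRing) (V := R_NormedModule));
      apply analytic_at_real_derive; [apply HF|apply HG]; apply Hrect; lra.
  - intros j t Ht.
    assert (Hf := INR_fact_pos j).
    assert (Q1 := HP1 t v ltac:(lra) ltac:(lra) bb j).
    assert (Q2 := HP2 t v ltac:(lra) ltac:(lra) bb j).
    assert (P1 : B1 ^ j <= Rmax B1 B2 ^ j) by (apply pow_incr; split; [exact HB1|apply Rmax_l]).
    assert (P2 : B2 ^ j <= Rmax B1 B2 ^ j) by (apply pow_incr; split; [exact HB2|apply Rmax_r]).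
    unfold Rminus. apply Rle_trans with (1 := Rabs_triang _ _). rewrite Rabs_Ropp.
    apply (Rmult_le_compat_l (M1 * INR (fact j))) in P1; [|apply Rmult_le_pos; lra].
    apply (Rmult_le_compat_l (M2 * INR (fact j))) in P2; [|apply Rmult_le_pos; lra].
    lra.
  - intros t [Ht Htb]. simpl.
    assert (0 < t) by (apply Rle_lt_trans with (2 := Ht), Rmax_l).
    assert ((a + b) / 2 < t) by (apply Rle_lt_trans with (2 := Ht), Rmax_r).
    rewrite HFG; [ring| |exact H].
    apply Hrect; unfold a in *; lra.
  - unfold a; lra. }
assert (H1 := Hpart true). assert (H2 := Hpart false). simpl in H1, H2.
rewrite (surjective_pairing (F (u, v))), (surjective_pairing (G (u, v))). f_equal; lra.
Qed.

(** * Dilation and damping *)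

Lemma bounded_on_segment (f : R -> R) (a b : R) : (forall x, continuous f x) ->
  exists D, 0 <= D /\ forall x, a <= x <= b -> Rabs (f x) <= D.
Proof.
intros Hf.
destruct (bounded_continuity (K := R_AbsRing) (V := R_NormedModule) f a b) as [M HM].
{ intros x _. apply Hf. }
exists (Rabs M). split; [apply Rabs_pos|]. intros x Hx.
apply Rle_trans with (2 := Rle_abs M). left. now apply HM.
Qed.

Lemma vanishing_bounded (f : R -> R) :
  (forall x, continuous f x) -> is_lim f p_infty 0 ->
  exists D, 0 <= D /\ forall x, 0 <= x -> Rabs (f x) <= D.
Proof.
intros Hf Hl. apply is_lim_spec in Hl. destruct (Hl (mkposreal 1 Rlt_0_1)) as [X HX].
destruct (bounded_on_segment f 0 X Hf) as [D [HD0 HD]].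
exists (D + 1). split; [lra|]. intros x Hx. destruct (Rle_dec x X) as [H|H].
- specialize (HD x ltac:(lra)). lra.
- specialize (HX x ltac:(lra)). simpl in HX. rewrite Rminus_0_r in HX. lra.
Qed.

Lemma vanishing_sublinear (f df : R -> R) :
  (forall x, is_derive f x (df x)) -> (forall x, continuous df x) -> is_lim df p_infty 0 ->
  forall eps, 0 < eps -> exists A, 0 <= A /\ forall x, 0 <= x -> Rabs (f x) <= A + eps * x.
Proof.
intros Hd Hc Hl eps Heps. apply is_lim_spec in Hl.
destruct (Hl (mkposreal eps Heps)) as [X0 HX0]. simpl in HX0.
set (X := Rmax 0 X0 + 1).
assert (HX : X0 < X) by (unfold X; pose proof (Rmax_r 0 X0); lra).
assert (HX1 : 0 < X) by (unfold X; pose proof (Rmax_l 0 X0); lra).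
assert (Hcf : forall x, continuous f x).
{ intros x. apply (ex_derive_continuous (K := R_AbsRing) (V := R_NormedModule)).
  eexists; apply Hd. }
destruct (bounded_on_segment f 0 X Hcf) as [D [HD0 HD]].
exists D. split; [exact HD0|]. intros x Hx. destruct (Rle_dec x X) as [H|H].
- specialize (HD x ltac:(lra)). nra.
- destruct (MVT_gen f X x df) as [c [Hcc He]].
  + intros; apply Hd.
  + intros; apply continuity_pt_filterlim, Hcf.
  + rewrite Rmin_left in Hcc by lra. specialize (HX0 c ltac:(lra)).
    rewrite Rminus_0_r in HX0.
    replace (f x) with (f X + (f x - f X)) by ring. rewrite He.
    apply Rle_trans with (1 := Rabs_triang _ _).
    assert (HDX := HD X ltac:(lra)).
    rewrite Rabs_mult, (Rabs_pos_eq (x - X)) by lra. nra.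
Qed.

Lemma exp_between (y : R) : 0 <= y -> 1 - y <= exp (- y) <= 1.
Proof.
intros Hy. split.
- pose proof (exp_ineq1_le (- y)). lra.
- rewrite <- exp_0. apply exp_le_compat. lra.
Qed.

(** On [0, X] uniform continuity is used; beyond X both values of [f] are small, since the dilation
    moves points to the right. *)
Lemma dilation_close (f : R -> R) :
  (forall x, continuous f x) -> is_lim f p_infty 0 ->
  forall eps, 0 < eps -> exists delta, 0 < delta /\ forall eta, 0 < eta < delta ->
    forall x, 0 <= x ->
    Rabs ((1 + 2 * eta) * f ((1 + 2 * eta) * x) * exp (- (eta * x)) - f x) <= eps.
Proof.
intros Hf Hl eps Heps. destruct (vanishing_bounded f Hf Hl) as [D [HD0 HD]].
apply is_lim_spec in Hl. destruct (Hl (mkposreal (eps / 4) ltac:(lra))) as [X0 HX0]. simpl in HX0.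
set (X := Rmax 0 X0 + 1).
assert (HX : X0 < X) by (unfold X; pose proof (Rmax_r 0 X0); lra).
assert (HX1 : 0 < X) by (unfold X; pose proof (Rmax_l 0 X0); lra).
(* A rectangle with degenerate second side gives uniform continuity in one variable, up to 2 X
   because 1 + 2 eta <= 2. *)
destruct (rect_uniform_continuity 0 (2 * X) 0 0 (fun z => f (fst z))) with (eps := eps / 2)
  as [d [Hd Hu]].
{ intros x y _ _ e He. assert (H := proj1 (filterlim_locally f (f x)) (Hf x) (mkposreal e He)).
  destruct H as [e' He']. exists e'. split; [apply cond_pos|].
  intros u v _ _ H _. apply (He' u H). }
{ lra. }
set (K := (D + 1) * (2 + X)).
assert (HK : 0 < K) by (apply Rmult_lt_0_compat; lra).
exists (Rmin (/ 2) (Rmin (d / (2 * X)) (eps / (2 * K)))). split.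
{ repeat apply Rmin_pos; try lra; apply Rdiv_lt_0_compat; lra. }
intros eta [He0 He] x Hx.
assert (He1 := Rlt_le_trans _ _ _ He (Rmin_l _ _)).
assert (He2 := Rlt_le_trans _ _ _ (Rlt_le_trans _ _ _ He (Rmin_r _ _)) (Rmin_l _ _)).
assert (He3 := Rlt_le_trans _ _ _ (Rlt_le_trans _ _ _ He (Rmin_r _ _)) (Rmin_r _ _)).
assert (Hex : 0 <= eta * x) by nra.
assert (HE := exp_between (eta * x) Hex).
assert (HE0 := exp_pos (- (eta * x))).
set (E := exp (- (eta * x))) in *. set (y := (1 + 2 * eta) * x).
assert (Hy : x <= y) by (unfold y; nra).
destruct (Rle_dec X x) as [HxX|HxX].
- assert (Q1 := HX0 x ltac:(lra)). assert (Q2 := HX0 y ltac:(lra)).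
  rewrite Rminus_0_r in Q1, Q2. unfold Rminus. apply Rle_trans with (1 := Rabs_triang _ _).
  rewrite Rabs_Ropp, !Rabs_mult, (Rabs_pos_eq E), (Rabs_pos_eq (1 + 2 * eta)) by lra.
  assert (Hp := Rabs_pos (f y)).
  assert ((1 + 2 * eta) * Rabs (f y) * E <= 2 * Rabs (f y) * 1).
  { apply Rmult_le_compat; try lra; [apply Rmult_le_pos; lra|].
    apply Rmult_le_compat_r; lra. }
  lra.
- replace ((1 + 2 * eta) * f y * E - f x) with (((1 + 2 * eta) * E - 1) * f y + (f y - f x)) by ring.
  apply Rle_trans with (1 := Rabs_triang _ _).
  assert (Q1 : Rabs (f y - f x) < eps / 2).
  { apply (Hu x 0 y 0); try lra.
    - unfold y. nra.
    - unfold y. replace ((1 + 2 * eta) * x - x) with (2 * (eta * x)) by ring.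
      rewrite Rabs_pos_eq by lra.
      apply (Rmult_lt_compat_r (2 * X)) in He2; [|lra].
      replace (d / (2 * X) * (2 * X)) with d in He2 by (field; lra). nra.
    - rewrite Rminus_diag, Rabs_R0. exact Hd. }
  rewrite Rabs_mult.
  (* From 1 - eta x <= E <= 1 and x < X. *)
  assert (Q2 : Rabs ((1 + 2 * eta) * E - 1) <= eta * (2 + X)).
  { apply Rabs_le. nra. }
  assert (Q3 := HD y ltac:(lra)).
  assert (Q4 : eta * K < eps / 2).
  { apply (Rmult_lt_compat_r K) in He3; [|exact HK].
    replace (eps / (2 * K) * K) with (eps / 2) in He3 by (field; lra). exact He3. }
  assert (Q5 : Rabs ((1 + 2 * eta) * E - 1) * Rabs (f y) <= eta * (2 + X) * D).
  { apply Rmult_le_compat; try apply Rabs_pos; easy. }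
  unfold K in Q4. nra.
Qed.

Lemma x_exp_le (eta x : R) : 0 < eta -> 0 <= x -> x * exp (- (eta * x)) <= / eta.
Proof.
intros He Hx. assert (H := pow_exp_bound 1 eta x He Hx).
simpl in H. rewrite !Rmult_1_r in H. unfold Rdiv in H. lra.
Qed.

(** The factor eta x exp (- eta x) is bounded but not uniformly small, so the linear growth of [f]
    must have arbitrarily small slope. This is where tau' -> 0 matters: a merely bounded derivative
    would leave an error of order one. *)
Lemma damping_close (f df : R -> R) :
  (forall x, is_derive f x (df x)) -> (forall x, continuous df x) -> is_lim df p_infty 0 ->
  forall eps, 0 < eps -> exists delta, 0 < delta /\ forall eta, 0 < eta < delta ->
    forall x, 0 <= x ->
    Rabs (eta * f ((1 + 2 * eta) * x) * exp (- (eta * x))) <= eps.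
Proof.
intros Hd Hc Hl eps Heps.
destruct (vanishing_sublinear f df Hd Hc Hl (eps / 4) ltac:(lra)) as [A [HA0 HA]].
exists (Rmin (/ 2) (eps / (2 * (A + 1)))). split.
{ apply Rmin_pos; [lra|]. apply Rdiv_lt_0_compat; lra. }
intros eta [He0 He] x Hx.
assert (He1 := Rlt_le_trans _ _ _ He (Rmin_l _ _)).
assert (He2 := Rlt_le_trans _ _ _ He (Rmin_r _ _)).
assert (HE0 := exp_pos (- (eta * x))).
assert (HE1 := x_exp_le eta x He0 Hx).
assert (HE2 : exp (- (eta * x)) <= 1) by (apply exp_between; nra).
set (E := exp (- (eta * x))) in *.
assert (H := HA ((1 + 2 * eta) * x) ltac:(nra)).
rewrite !Rabs_mult, (Rabs_pos_eq eta), (Rabs_pos_eq E) by lra.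
apply Rle_trans with (eta * (A + eps / 4 * ((1 + 2 * eta) * x)) * E).
{ apply Rmult_le_compat_r; [lra|]. apply Rmult_le_compat_l; lra. }
assert (H1 : eta * (x * E) <= 1).
{ apply (Rmult_le_compat_l eta) in HE1; [|lra]. rewrite Rinv_r in HE1; lra. }
assert (H2 : eta * (A + 1) < eps / 2).
{ apply (Rmult_lt_compat_r (A + 1)) in He2; [|lra].
  replace (eps / (2 * (A + 1)) * (A + 1)) with (eps / 2) in He2 by (field; lra). exact He2. }
replace (eta * (A + eps / 4 * ((1 + 2 * eta) * x)) * E) with
  (eta * A * E + eps / 4 * ((1 + 2 * eta) * (eta * (x * E)))) by ring.
assert (H3 : eta * A * E <= eta * A * 1) by (apply Rmult_le_compat_l; nra).
assert (H4 : 0 <= eta * (x * E)) by (repeat apply Rmult_le_pos; lra).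
assert (H5 : (1 + 2 * eta) * (eta * (x * E)) <= 2 * 1) by (apply Rmult_le_compat; lra).
nra.
Qed.

Definition dilated (eta : R) (T : R -> C) (x : R) : C :=
  Cmult (RtoC (exp (- (eta * x)))) (T ((1 + 2 * eta) * x)).

Definition ddilated (eta : R) (T dT : R -> C) (x : R) : C :=
  Cplus (Cmult (RtoC (- eta * exp (- (eta * x)))) (T ((1 + 2 * eta) * x)))
    (Cmult (RtoC (exp (- (eta * x)))) (Cmult (RtoC (1 + 2 * eta)) (dT ((1 + 2 * eta) * x)))).

Lemma is_C1_dilated (eta : R) (T dT : R -> C) :
  is_C1 T dT -> is_C1 (dilated eta T) (ddilated eta T dT).
Proof.
intros HT. apply is_C1_scal.
- intros x. auto_derive; [easy|ring].
- apply cont_derivable. intros x. auto_derive. easy.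
- intros b x. assert (Hl : is_derive (fun x => (1 + 2 * eta) * x) x (1 + 2 * eta))
    by (auto_derive; [easy|ring]).
  split.
  + rewrite part_RtoC_mult.
    apply (is_derive_comp (fun y => part b (T y)) (fun x => (1 + 2 * eta) * x)).
    * apply HT.
    * exact Hl.
  + apply continuous_ext with (fun y => (1 + 2 * eta) * part b (dT ((1 + 2 * eta) * y))).
    { intros t. now rewrite part_RtoC_mult. }
    apply (continuous_scal_r (K := R_AbsRing) (V := R_NormedModule)).
    apply (continuous_comp (fun x => (1 + 2 * eta) * x) (fun y => part b (dT y))).
    * apply (ex_derive_continuous (K := R_AbsRing) (V := R_NormedModule)). eexists; exact Hl.
    * apply HT.
Qed.

Definition vanishing (d : R -> C) : Prop :=
  forall b, is_lim (fun x => part b (d x)) p_infty 0.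

Lemma dilated_close (T dT : R -> C) : is_C1 T dT -> vanishing dT ->
  forall eps, 0 < eps -> exists delta, 0 < delta /\ forall eta, 0 < eta < delta ->
    forall x, 0 <= x -> Cmod (Cminus (ddilated eta T dT x) (dT x)) <= eps.
Proof.
intros HT Hv eps Heps.
assert (H : forall b, exists delta, 0 < delta /\ forall eta, 0 < eta < delta ->
    forall x, 0 <= x -> Rabs (part b (Cminus (ddilated eta T dT x) (dT x))) <= eps / 2).
{ intros b.
  destruct (dilation_close (fun x => part b (dT x)) (fun x => proj2 (HT b x)) (Hv b)
    (eps / 4) ltac:(lra)) as [d1 [Hd1 H1]].
  destruct (damping_close (fun x => part b (T x)) (fun x => part b (dT x))
    (fun x => proj1 (HT b x)) (fun x => proj2 (HT b x)) (Hv b)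
    (eps / 4) ltac:(lra)) as [d2 [Hd2 H2]].
  exists (Rmin d1 d2). split; [now apply Rmin_pos|]. intros eta [He0 He] x Hx.
  specialize (H1 eta (conj He0 (Rlt_le_trans _ _ _ He (Rmin_l _ _))) x Hx).
  specialize (H2 eta (conj He0 (Rlt_le_trans _ _ _ He (Rmin_r _ _))) x Hx).
  simpl in H1, H2.
  unfold ddilated. rewrite part_minus, part_plus, !part_RtoC_mult.
  match goal with |- Rabs ?z <= _ => replace z with
   (((1 + 2 * eta) * part b (dT ((1 + 2 * eta) * x)) * exp (- (eta * x)) - part b (dT x)) +
    - (eta * part b (T ((1 + 2 * eta) * x)) * exp (- (eta * x)))) by ring end.
  apply Rle_trans with (1 := Rabs_triang _ _). rewrite Rabs_Ropp. lra. }
destruct (H true) as [d1 [Hd1 H1]]. destruct (H false) as [d2 [Hd2 H2]].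
exists (Rmin d1 d2). split; [now apply Rmin_pos|]. intros eta [He0 He] x Hx.
specialize (H1 eta (conj He0 (Rlt_le_trans _ _ _ He (Rmin_l _ _))) x Hx).
specialize (H2 eta (conj He0 (Rlt_le_trans _ _ _ He (Rmin_r _ _))) x Hx).
apply Rle_trans with (1 := Cmod_le_parts _).
change (Rabs (part true (Cminus (ddilated eta T dT x) (dT x))) +
  Rabs (part false (Cminus (ddilated eta T dT x) (dT x))) <= eps). lra.
Qed.

Lemma vanishing_derive_growth (T dT : R -> C) : is_C1 T dT -> vanishing dT ->
  exists A, 0 <= A /\ forall x, 0 <= x -> Cmod (T x) <= A + x.
Proof.
intros HT Hv.
destruct (vanishing_sublinear _ _ (fun x => proj1 (HT true x)) (fun x => proj2 (HT true x))
  (Hv true) (/ 2) ltac:(lra)) as [A1 [HA1 H1]].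
destruct (vanishing_sublinear _ _ (fun x => proj1 (HT false x)) (fun x => proj2 (HT false x))
  (Hv false) (/ 2) ltac:(lra)) as [A2 [HA2 H2]].
exists (A1 + A2). split; [lra|]. intros x Hx. apply Rle_trans with (1 := Cmod_le_parts _).
specialize (H1 x Hx). specialize (H2 x Hx). simpl in H1, H2. lra.
Qed.

(** Half of the rate eta is spent on the linear growth of [T], which leaves eta / 2. *)
Lemma dilated_decay (T dT : R -> C) (eta : R) : is_C1 T dT -> vanishing dT -> 0 < eta ->
  exists A, forall x, 0 <= x ->
    Cmod (dilated eta T x) <= A * exp (- (eta / 2 * x)) /\
    Cmod (ddilated eta T dT x) <= A * exp (- (eta / 2 * x)).
Proof.
intros HT Hv He.
assert (HD : exists D, 0 <= D /\ forall x, 0 <= x -> Cmod (dT x) <= D).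
{ destruct (vanishing_bounded _ (fun x => proj2 (HT true x)) (Hv true)) as [D1 [HD1 H1]].
  destruct (vanishing_bounded _ (fun x => proj2 (HT false x)) (Hv false)) as [D2 [HD2 H2]].
  exists (D1 + D2). split; [lra|]. intros x Hx. apply Rle_trans with (1 := Cmod_le_parts _).
  specialize (H1 x Hx). specialize (H2 x Hx). simpl in H1, H2. lra. }
destruct (vanishing_derive_growth T dT HT Hv) as [A [HA0 HA]]. destruct HD as [D [HD0 HD]].
set (L := 1 + 2 * eta).
assert (HL : 0 < L) by (unfold L; lra).
set (K := A + L * / (eta / 2)).
assert (HK : 0 <= K).
{ apply Rplus_le_le_0_compat; [exact HA0|]. apply Rmult_le_pos; [lra|].
  left; apply Rinv_0_lt_compat; lra. }
assert (Hdec : forall x, 0 <= x -> exp (- (eta * x)) * Cmod (T (L * x)) <= K * exp (- (eta / 2 * x))).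
{ intros x Hx. assert (H := HA (L * x) ltac:(nra)).
  assert (Hxe := x_exp_le (eta / 2) x ltac:(lra) Hx).
  replace (- (eta * x)) with (- (eta / 2 * x) + - (eta / 2 * x)) by field. rewrite exp_plus.
  assert (HE := exp_pos (- (eta / 2 * x))).
  assert (HE2 : exp (- (eta / 2 * x)) <= 1) by (apply exp_between; nra).
  set (E := exp (- (eta / 2 * x))) in *.
  rewrite Rmult_assoc, (Rmult_comm K). apply Rmult_le_compat_l; [lra|].
  apply Rle_trans with (E * (A + L * x)); [apply Rmult_le_compat_l; lra|].
  unfold K. apply (Rmult_le_compat_l L) in Hxe; [|lra]. nra. }
exists (K + eta * K + L * D). intros x Hx. specialize (Hdec x Hx).
assert (HE := exp_pos (- (eta / 2 * x))).
assert (Heta := exp_pos (- (eta * x))).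
assert (HLD : 0 <= L * D) by (apply Rmult_le_pos; lra).
assert (HeK : 0 <= eta * K) by (apply Rmult_le_pos; lra).
assert (Hle : exp (- (eta * x)) <= exp (- (eta / 2 * x))) by (apply exp_le_compat; nra).
set (E := exp (- (eta / 2 * x))) in *. set (E2 := exp (- (eta * x))) in *.
split.
- unfold dilated. rewrite Cmod_mult, Cmod_R, Rabs_pos_eq by (left; apply exp_pos).
  fold L. fold E2. apply Rle_trans with (1 := Hdec). apply Rmult_le_compat_r; lra.
- unfold ddilated. apply Rle_trans with (1 := Cmod_triangle _ _).
  rewrite !Cmod_mult, !Cmod_R. fold L. fold E2.
  rewrite Rabs_mult, Rabs_Ropp, (Rabs_pos_eq eta), (Rabs_pos_eq E2), (Rabs_pos_eq L) by lra.
  assert (H := HD (L * x) ltac:(nra)).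
  assert (Hp := Cmod_ge_0 (dT (L * x))).
  assert (Q1 : eta * (E2 * Cmod (T (L * x))) <= eta * (K * E)) by (apply Rmult_le_compat_l; lra).
  assert (Q2 : E2 * (L * Cmod (dT (L * x))) <= E * (L * D)).
  { apply Rmult_le_compat; [lra|apply Rmult_le_pos; lra|exact Hle|apply Rmult_le_compat_l; lra]. }
  nra.
Qed.

Lemma II_dilate (f : R -> R) (A c L : R) : 0 < L -> 0 < c ->
  (forall x, continuous f x) -> edec (fun x => f (L * x)) A c ->
  II f = L * II (fun x => f (L * x)).
Proof.
intros HL Hc Hf Hd. apply II_unique.
assert (Hf2 : forall x, continuous (fun x => f (L * x)) x).
{ intros x. apply (continuous_comp (fun x => L * x) f); [|apply Hf].
  apply (ex_derive_continuous (K := R_AbsRing) (V := R_NormedModule)). auto_derive; easy. }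
assert (H := II_lim _ A c Hf2 Hd Hc).
apply is_lim_ext with (fun b => L * RInt (fun x => f (L * x)) 0 (b / L)).
- intros b.
  assert (E := RInt_comp_lin (V := R_CompleteNormedModule) f L 0 0 (b / L)).
  rewrite Rmult_0_r, !Rplus_0_r in E.
  replace (L * (b / L)) with b in E by (field; lra).
  rewrite <- E by (now apply ex_RInt_cont).
  rewrite (RInt_scal (V := R_CompleteNormedModule)).
  + unfold scal; simpl; unfold mult; simpl. f_equal. apply RInt_ext.
    intros x _. now rewrite Rplus_0_r.
  + apply ex_RInt_ext with (fun x => f (L * x)); [intros x _; now rewrite Rplus_0_r|].
    now apply ex_RInt_cont.
- apply (is_lim_scal_l (fun b => RInt (fun x => f (L * x)) 0 (b / L)) L p_infty
    (II (fun x => f (L * x)))).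
  apply is_lim_spec. apply is_lim_spec in H. intros e. destruct (H e) as [M HM].
  exists (L * M). intros x Hx. apply HM.
  apply Rmult_lt_reg_l with L; [exact HL|]. replace (L * (x / L)) with x by (field; lra). exact Hx.
Qed.

(** The k-th derivative in u of F((s + eta) / L) / L, the continued transform of [dilated]: one
    factor 1 / L comes from the change of variable, the others from the chain rule. *)
Definition scaled_derive (F : C -> C) (eta v : R) (b : bool) (k : nat) (u : R) : R :=
  (/ (1 + 2 * eta)) ^ S k *
  part b (real_derive_n k F ((u + eta) / (1 + 2 * eta), v / (1 + 2 * eta))).

(** The contraction takes Re s = 1 + eta exactly to Re s = 1, so on the right a margin beyond the
    rectangle is available. *)
Lemma scaled_rect (alpha r eta u v : R) : alpha < 0 -> 0 < r -> 0 < eta ->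
  alpha <= u < 1 + eta -> Rabs v <= r ->
  alpha < (u + eta) / (1 + 2 * eta) < 1 /\ Rabs (v / (1 + 2 * eta)) < r.
Proof.
intros Ha Hr He Hu Hv. set (L := 1 + 2 * eta). assert (HL : 1 < L) by (unfold L; lra).
split; [split|].
- apply Rmult_lt_reg_r with L; [lra|]. unfold Rdiv. rewrite Rmult_assoc, Rinv_l by lra. nra.
- apply Rmult_lt_reg_r with L; [lra|]. unfold Rdiv. rewrite Rmult_assoc, Rinv_l by lra.
  unfold L. lra.
- apply Rmult_lt_reg_r with L; [lra|]. unfold Rdiv.
  rewrite Rabs_mult, (Rabs_pos_eq (/ L)) by (left; apply Rinv_0_lt_compat; lra).
  rewrite Rmult_assoc, Rinv_l by lra. nra.
Qed.

Lemma scaled_derive_is_derive (alpha r : R) (F : C -> C) (eta v : R) (b : bool) (k : nat) (u : R) :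
  alpha < 0 -> 0 < r -> 0 < eta -> (forall s, rect alpha r s -> analytic_at F s) ->
  alpha <= u < 1 + eta -> Rabs v <= r ->
  is_derive (scaled_derive F eta v b k) u (scaled_derive F eta v b (S k) u).
Proof.
intros Ha Hr He HF Hu Hv.
assert (Hin := scaled_rect alpha r eta u v Ha Hr He Hu Hv).
assert (Hd := analytic_at_real_derive F ((u + eta) / (1 + 2 * eta)) (v / (1 + 2 * eta)) b k
  (HF (_, _) Hin)).
unfold scaled_derive. set (L := 1 + 2 * eta) in *.
change ((/ L) ^ S (S k)) with (/ L * (/ L) ^ S k).
rewrite (Rmult_comm (/ L)), Rmult_assoc.
apply (is_derive_scal (fun u => part b (real_derive_n k F ((u + eta) / L, v / L)))).
apply (is_derive_comp (fun x => part b (real_derive_n k F (x, v / L))) (fun u => (u + eta) / L)).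
- exact Hd.
- auto_derive; [easy|]. unfold Rdiv. ring.
Qed.

(** For k = 0 this is a change of variable, valid since u > - eta / 2 makes (u + eta) / L positive.
    Both sides being sequences of successive derivatives, [derivatives_zero] applied to the
    difference gives all k. *)
Lemma scaled_derive_Lap (alpha r : R) (T dT : R -> C) (F : C -> C) (eta A v : R) (b : bool) :
  alpha < 0 -> 0 < r -> 0 < eta -> is_C1 T dT ->
  (forall s, rect alpha r s -> analytic_at F s) ->
  (forall u w, 0 < u <= 1 -> Rabs w <= r ->
     part b (F (u, w)) = II (lap_int 0 (wave_at T w b) u)) ->
  (forall x, 0 <= x -> Cmod (dilated eta T x) <= A * exp (- (eta / 2 * x))) ->
  Rabs v <= r ->
  forall k u, Rmax alpha (- (eta / 2)) < u < 1 + eta ->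
    scaled_derive F eta v b k u = Lap k (wave_at (dilated eta T) v b) u.
Proof.
intros Ha Hr He HT HF HL HA Hv.
assert (HT1 := is_C1_dilated eta T dT HT).
assert (Hw : forall x, continuous (wave_at (dilated eta T) v b) x)
  by (intros; eapply wave_at_continuous; exact HT1).
assert (Hdec : edec (wave_at (dilated eta T) v b) A (eta / 2)).
{ intros x Hx. apply Rle_trans with (1 := wave_at_le _ _ _ _). now apply HA. }
enough (H : forall k u, Rmax alpha (- (eta / 2)) < u < 1 + eta ->
    scaled_derive F eta v b k u - Lap k (wave_at (dilated eta T) v b) u = 0).
{ intros k u Hu. specialize (H k u Hu). lra. }
apply (derivatives_zero
  (fun k u => scaled_derive F eta v b k u - Lap k (wave_at (dilated eta T) v b) u)).
- intros k u [Hu1 Hu2].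
  assert (Hu3 := Rle_lt_trans _ _ _ (Rmax_l _ _) Hu1).
  assert (Hu4 := Rle_lt_trans _ _ _ (Rmax_r _ _) Hu1).
  apply (is_derive_minus (K := R_AbsRing) (V := R_NormedModule)).
  + apply (scaled_derive_is_derive alpha r); try easy. lra.
  + apply (Lap_derive k _ A (eta / 2)); try easy. lra.
- intros u [Hu1 Hu2].
  assert (Hu3 := Rle_lt_trans _ _ _ (Rmax_l _ _) Hu1).
  assert (Hu4 := Rle_lt_trans _ _ _ (Rmax_r _ _) Hu1).
  destruct (scaled_rect alpha r eta u v Ha Hr He ltac:(lra) Hv) as [[_ H1] Hvr].
  unfold scaled_derive. simpl real_derive_n.
  set (L := 1 + 2 * eta) in *. assert (HL0 : 1 < L) by (unfold L; lra).
  assert (H2 : 0 < (u + eta) / L) by (apply Rdiv_lt_0_compat; lra).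
  rewrite HL by lra. unfold Lap.
  set (f := lap_int 0 (wave_at T (v / L) b) ((u + eta) / L)).
  assert (Ef : (fun x => f (L * x)) = lap_int 0 (wave_at (dilated eta T) v b) u).
  { extensionality x. unfold f, lap_int, dilated. fold L.
    rewrite wave_at_scal. unfold wave_at.
    replace (v / L * (L * x)) with (v * x) by (field; lra).
    replace ((u + eta) / L * (L * x)) with (u * x + eta * x) by (field; lra).
    rewrite Ropp_plus_distr, exp_plus. rewrite !pow_O. ring. }
  rewrite (II_dilate f (A * (INR (fact 0) / (eta / 2 + u - (eta / 2 + u) / 2) ^ 0))
    ((eta / 2 + u) / 2) L).
  + rewrite Ef. rewrite pow_1. field. lra.
  + lra.
  + lra.
  + apply cont_lap_int. intros; now apply wave_at_continuous with dT.
  + rewrite Ef. apply edec_lap_int; [exact Hdec|lra].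
Qed.

Lemma dilated_approximable (alpha r : R) (T dT : R -> C) (F : C -> C) (eta : R) :
  alpha < 0 -> 0 < r -> 0 < eta < - alpha -> is_C1 T dT -> vanishing dT ->
  (forall s, rect alpha r s -> analytic_at F s) ->
  (forall b u w, 0 < u <= 1 -> Rabs w <= r ->
     part b (F (u, w)) = II (lap_int 0 (wave_at T w b) u)) ->
  forall eps, 0 < eps -> exists (sigma dsigma : R -> C) (N : R),
    0 <= N /\ is_C1 sigma dsigma /\ (forall x, N <= x -> sigma x = RtoC 0) /\
    (forall x, 0 <= x -> Cmod (Cminus (dsigma x) (ddilated eta T dT x)) <= eps) /\
    (forall u v b, alpha <= u <= 1 -> Rabs v <= r ->
       Rabs (RInt (lap_int 0 (wave_at sigma v b) u) 0 N - scaled_derive F eta v b 0 u) <= eps).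
Proof.
intros Ha Hr [He Hea] HT Hv HF HL eps Heps.
destruct (dilated_decay T dT eta HT Hv He) as [A HA].
assert (HT1 := is_C1_dilated eta T dT HT).
set (L := 1 + 2 * eta). assert (HL1 : 1 < L) by (unfold L; lra).
assert (HA0 : 0 <= A).
{ destruct (HA 0 (Rle_refl 0)) as [H _]. rewrite Rmult_0_r, Ropp_0, exp_0 in H.
  pose proof (Cmod_ge_0 (dilated eta T 0)). lra. }
assert (HLap : forall v b k u, Rabs v <= r -> Rmax alpha (- (eta / 2)) < u < 1 + eta ->
    scaled_derive F eta v b k u = Lap k (wave_at (dilated eta T) v b) u).
{ intros v b k u Hv1 Hu. apply (scaled_derive_Lap alpha r T dT F eta A v b); try easy.
  - intros; now apply HL.
  - intros; now apply HA. }
assert (Hw : forall v b x, continuous (wave_at (dilated eta T) v b) x)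
  by (intros; eapply wave_at_continuous; exact HT1).
assert (Hdec : forall v b, edec (wave_at (dilated eta T) v b) A (eta / 2)).
{ intros v b x Hx. apply Rle_trans with (1 := wave_at_le _ _ _ _). now apply HA. }
(* Each shift evaluates at u + h, so the family must be controlled for all u >= alpha. The
   continuation serves up to 0 and the integral beyond, since [F] gives no information to the right
   of the rectangle. *)
set (g := fun (p : freq r) k u => if Rle_dec u 0
  then scaled_derive F eta (proj1_sig (fst p)) (snd p) k u
  else Lap k (wave (dilated eta T) p) u).
(* The image of alpha <= u <= 0, |v| <= r under the contraction: compact and inside the domain of
   analyticity. *)
destruct (analytic_rect_bound ((alpha + eta) / L) (eta / L) (- (r / L)) (r / L) F)
  as (M & B & HM & HB & HMB).
{ intros u v Hu Hv1. apply HF. destruct (scaled_rect alpha r eta alpha r Ha Hr He) as [H1 H2]; try lra.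
  { rewrite Rabs_pos_eq; lra. }
  destruct (scaled_rect alpha r eta 0 r Ha Hr He) as [H3 _]; try lra.
  { rewrite Rabs_pos_eq; lra. }
  fold L in H1, H2, H3. rewrite Rplus_0_l in H3.
  unfold rect; simpl. split; [lra|].
  apply Rle_lt_trans with (r / L); [apply Rabs_le; lra|].
  apply Rle_lt_trans with (2 := H2). apply Rle_abs. }
(* [B] serves the continuation, 4 / eta the integral: for u > 0 the rate (eta / 2 + u) / 2 in
   [Lap_bound] exceeds eta / 4. *)
set (B2 := Rmax B (4 / eta)).
assert (HB2 : 0 <= B2) by (apply Rle_trans with (1 := HB), Rmax_l).
assert (H4e : 0 < 4 / eta) by (apply Rdiv_lt_0_compat; lra).
assert (Hfam : lap_family alpha B2 (eta / 2) (wave (dilated eta T)) g).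
{ split; [|split; [|split; [|split]]].
  - intros p x. apply Hw.
  - exists A. intros p. apply Hdec.
  - intros [[v Hv1] b] k u Hu. simpl.
    destruct (Rlt_dec u 0) as [Hu0|Hu0]; [|destruct (Rlt_dec 0 u) as [Hu1|Hu1]].
    + apply is_derive_ext_loc with (scaled_derive F eta v b k).
      * exists (mkposreal (- u) ltac:(lra)). intros x Hx. change (Rabs (x - u) < - u) in Hx.
        apply Rabs_def2 in Hx. unfold g. destruct (Rle_dec x 0); [easy|lra].
      * unfold g. destruct (Rle_dec u 0); [|lra].
        apply (scaled_derive_is_derive alpha r); try easy. lra.
    + apply is_derive_ext_loc with (Lap k (wave_at (dilated eta T) v b)).
      * exists (mkposreal u Hu1). intros x Hx. change (Rabs (x - u) < u) in Hx.
        apply Rabs_def2 in Hx. unfold g. destruct (Rle_dec x 0); [lra|easy].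
      * unfold g. destruct (Rle_dec u 0); [lra|].
        apply (Lap_derive k _ A (eta / 2)); try easy. lra.
    (* At the seam both branches agree on a neighbourhood, because the integral still converges and
       equals the continuation slightly left of 0. *)
    + assert (u = 0) by lra. subst u.
      assert (Hm : 0 < Rmin 1 (- Rmax alpha (- (eta / 2)))).
      { apply Rmin_pos; [lra|]. apply Ropp_0_gt_lt_contravar. apply Rmax_lub_lt; lra. }
      apply is_derive_ext_loc with (scaled_derive F eta v b k).
      * exists (mkposreal _ Hm). intros x Hx.
        change (Rabs (x - 0) < Rmin 1 (- Rmax alpha (- (eta / 2)))) in Hx.
        rewrite Rminus_0_r in Hx. apply Rabs_def2 in Hx.
        pose proof (Rmin_l 1 (- Rmax alpha (- (eta / 2)))).
        pose proof (Rmin_r 1 (- Rmax alpha (- (eta / 2)))).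
        unfold g. destruct (Rle_dec x 0); [easy|]. apply HLap; [exact Hv1|]. lra.
      * unfold g. destruct (Rle_dec 0 0); [|lra].
        apply (scaled_derive_is_derive alpha r); try easy. lra.
  - exists (M + A * (4 / eta)), O. intros [[v Hv1] b] k u Hu. rewrite Nat.add_0_r.
    assert (Hf := INR_fact_pos k).
    assert (HBk : 0 <= B2 ^ k) by now apply pow_le.
    assert (HA4 : 0 <= A * (4 / eta)) by (apply Rmult_le_pos; lra).
    unfold g. simpl fst; simpl snd; simpl proj1_sig. destruct (Rle_dec u 0) as [Hu0|Hu0].
    + unfold scaled_derive. fold L. rewrite Rabs_mult.
      assert (HiL : 0 < / L <= 1).
      { split; [apply Rinv_0_lt_compat; lra|]. rewrite <- Rinv_1. apply Rinv_le_contravar; lra. }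
      assert (HLk : Rabs ((/ L) ^ S k) <= 1).
      { rewrite Rabs_pos_eq by (apply pow_le; lra). rewrite <- (pow1 (S k)). apply pow_incr. lra. }
      assert (Q := HMB ((u + eta) / L) (v / L)).
      assert (Hvv : - r <= v <= r).
      { split; [|apply Rle_trans with (2 := Hv1), Rle_abs].
        pose proof (Rle_abs (- v)) as Hn. rewrite Rabs_Ropp in Hn. lra. }
      specialize (Q ltac:(split; apply Rmult_le_compat_r; lra)).
      specialize (Q ltac:(unfold Rdiv; rewrite Ropp_mult_distr_l; split; apply Rmult_le_compat_r; lra) b k).
      assert (HBB : B ^ k <= B2 ^ k) by (apply pow_incr; split; [exact HB|apply Rmax_l]).
      apply Rle_trans with (1 * (M * INR (fact k) * B ^ k)).
      { apply Rmult_le_compat; try easy; apply Rabs_pos. }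
      rewrite Rmult_1_l. apply Rle_trans with (M * INR (fact k) * B2 ^ k).
      { apply Rmult_le_compat_l; [apply Rmult_le_pos; lra|exact HBB]. }
      apply Rmult_le_compat_r; [exact HBk|]. apply Rmult_le_compat_r; lra.
    + apply Rle_trans with (1 := Lap_bound k _ A (eta / 2) u (Hw v b) (Hdec v b) ltac:(lra)).
      set (c := (eta / 2 + u) / 2). assert (Hc : eta / 4 < c) by (unfold c; lra).
      assert (Hc2 : / c <= 4 / eta).
      { replace (4 / eta) with (/ (eta / 4)) by (field; lra). apply Rinv_le_contravar; lra. }
      assert (Hc3 : 0 < / c) by (apply Rinv_0_lt_compat; lra).
      assert (Hc4 : (/ c) ^ k <= B2 ^ k).
      { apply pow_incr. split; [lra|]. apply Rle_trans with (1 := Hc2), Rmax_r. }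
      assert (Hc5 : 0 <= (/ c) ^ k) by (apply pow_le; lra).
      replace (A * (INR (fact k) / c ^ k) / c) with (A * / c * INR (fact k) * (/ c) ^ k).
      2:{ rewrite pow_inv. field. split; first [lra | apply pow_nonzero; lra]. }
      apply Rmult_le_compat; try easy.
      * apply Rmult_le_pos; [apply Rmult_le_pos; lra|lra].
      * apply Rmult_le_compat_r; [lra|].
        assert (A * / c <= A * (4 / eta)) by (apply Rmult_le_compat_l; lra). lra.
  - intros [[v Hv1] b] k u Hu Hu2. unfold g. simpl fst; simpl snd; simpl proj1_sig.
    destruct (Rle_dec u 0) as [Hu0|Hu0]; [|easy].
    (* The bound eta < - alpha puts - eta / 2 strictly right of alpha, so [u] lies inside the open
       interval of agreement. *)
    apply HLap; [exact Hv1|]. split; [|lra]. apply Rmax_lub_lt; lra. }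
(* The decay rate is eta / 2, so h <= eta / 4 is the requirement that 2 h not exceed it; the other
   bound gives h B2 <= 1/4. *)
set (h := Rmin (eta / 4) (/ (4 * (B2 + 1)))).
assert (Hh : 0 < h).
{ apply Rmin_pos; [lra|]. apply Rinv_0_lt_compat; lra. }
assert (Hh1 : h <= eta / 4) by apply Rmin_l.
assert (HhB : h * B2 <= / 4).
{ apply Rle_trans with (/ (4 * (B2 + 1)) * (B2 + 1)).
  - apply Rmult_le_compat; try lra. apply Rmin_r.
  - right. field. lra. }
destruct (INR_unbounded (- alpha / (h / 2))) as [m Hm].
apply (Rmult_lt_compat_r (h / 2)) in Hm; [|lra].
replace (- alpha / (h / 2) * (h / 2)) with (- alpha) in Hm by (field; lra).
destruct (lap_family_approximable alpha r B2 h m ltac:(lra) HB2 Hh HhB (eta / 2) A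
  (dilated eta T) (ddilated eta T dT) g HT1 ltac:(lra)
  (fun x Hx => proj1 (HA x Hx)) (fun x Hx => proj2 (HA x Hx)) Hfam ltac:(lra) eps Heps)
  as (s & ds & N & H1 & H2 & H3 & H4 & H5).
exists s, ds, N. split; [exact H1|split; [exact H2|split; [exact H3|split; [exact H4|]]]].
intros u v b Hu Hv1.
assert (H := H5 (exist _ v Hv1, b) u (proj1 Hu)). unfold g, wave in H. simpl in H.
destruct (Rle_dec u 0) as [Hu0|Hu0]; [exact H|].
rewrite <- HLap in H; [exact H|exact Hv1|]. split; [|lra]. apply Rmax_lub_lt; lra.
Qed.

(** Continuity up to the boundary makes [F] bounded and uniformly continuous on the closed
    rectangle, and the contraction moves its points by at most a multiple of eta. *)
Lemma scaled_close (alpha r : R) (F : C -> C) : alpha < 0 -> 0 < r ->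
  (forall b, cont_within_rect alpha 1 (- r) r (fun s => part b (F s))) ->
  forall eps, 0 < eps -> exists delta, 0 < delta /\ forall eta, 0 < eta < delta ->
    forall u v b, alpha <= u <= 1 -> Rabs v <= r ->
    Rabs (scaled_derive F eta v b 0 u - part b (F (u, v))) <= eps.
Proof.
intros Ha Hr HF eps Heps.
assert (H : forall b, exists delta, 0 < delta /\ forall eta, 0 < eta < delta ->
    forall u v, alpha <= u <= 1 -> Rabs v <= r ->
    Rabs (scaled_derive F eta v b 0 u - part b (F (u, v))) <= eps).
{ intros b.
  destruct (rect_bounded _ _ _ _ _ (HF b)) as [D [HD0 HD]].
  destruct (rect_uniform_continuity _ _ _ _ _ (HF b) (eps / 2) ltac:(lra)) as [e [He Hu]].
  (* An upper bound for |1 - 2 u| and 2 |v|, the displacements of the coordinates per unit of eta /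
     L. *)
  set (K := 2 * (1 - alpha) + 1 + 2 * r).
  assert (HK : 0 < K) by (unfold K; lra).
  exists (Rmin (e / K) (eps / (4 * (D + 1)))). split.
  { apply Rmin_pos; apply Rdiv_lt_0_compat; lra. }
  intros eta [He0 Hed] u v Hur Hv.
  assert (He1 := Rlt_le_trans _ _ _ Hed (Rmin_l _ _)).
  assert (He2 := Rlt_le_trans _ _ _ Hed (Rmin_r _ _)).
  destruct (scaled_rect alpha r eta u v Ha Hr He0 ltac:(lra) Hv) as [Hin1 Hin2].
  apply (Rmult_lt_compat_r K) in He1; [|exact HK].
  replace (e / K * K) with e in He1 by (field; lra).
  apply (Rmult_lt_compat_r (4 * (D + 1))) in He2; [|lra].
  replace (eps / (4 * (D + 1)) * (4 * (D + 1))) with eps in He2 by (field; lra).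
  unfold scaled_derive. simpl real_derive_n. rewrite pow_1.
  set (L := 1 + 2 * eta) in *. assert (HL : 1 < L) by (unfold L; lra).
  assert (HiL : 0 < / L) by (apply Rinv_0_lt_compat; lra).
  assert (HiL1 : / L = 1 - 2 * eta * / L) by (unfold L; field; unfold L in HL; lra).
  assert (HiL2 : / L < 1) by nra.
  assert (Hv' : - r <= v <= r).
  { split; [|apply Rle_trans with (2 := Hv), Rle_abs].
    pose proof (Rle_abs (- v)) as Hn. rewrite Rabs_Ropp in Hn. lra. }
  apply Rabs_def2 in Hin2.
  assert (HeL : eta * / L <= eta) by nra.
  assert (HeL0 : 0 < eta * / L) by nra.
  set (k := eta * / L) in *.
  assert (HiL3 : / L = 1 - 2 * k) by (unfold k; lra).
  assert (E1 : (u + eta) / L - u = k * (1 - 2 * u)).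
  { unfold Rdiv. rewrite Rmult_plus_distr_r. fold k. rewrite HiL3. ring. }
  assert (E2 : v / L - v = - (2 * k) * v) by (unfold Rdiv; rewrite HiL3; ring).
  assert (Q1 : Rabs (part b (F ((u + eta) / L, v / L)) - part b (F (u, v))) < eps / 2).
  { apply (Hu u v ((u + eta) / L) (v / L)); try lra.
    - rewrite E1. apply Rle_lt_trans with (2 := He1).
      rewrite Rabs_mult, (Rabs_pos_eq k) by lra.
      apply Rmult_le_compat; try lra; [apply Rabs_pos|]. apply Rabs_le. unfold K. lra.
    - rewrite E2. apply Rle_lt_trans with (2 := He1).
      rewrite Rabs_mult, Rabs_Ropp, (Rabs_pos_eq (2 * k)) by lra.
      apply Rle_trans with (2 * k * r); [apply Rmult_le_compat_l; lra|].
      unfold K. nra. }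
  assert (Q2 := HD ((u + eta) / L) (v / L) ltac:(lra) ltac:(lra)). simpl in Q2.
  set (X := part b (F ((u + eta) / L, v / L))) in *.
  replace (/ L * X - part b (F (u, v))) with ((X - part b (F (u, v))) + - (2 * k) * X)
    by (rewrite HiL3; ring).
  apply Rle_trans with (1 := Rabs_triang _ _).
  rewrite Rabs_mult, Rabs_Ropp, (Rabs_pos_eq (2 * k)) by lra.
  assert (2 * k * Rabs X <= 2 * eta * D).
  { apply Rmult_le_compat; try lra. apply Rabs_pos. }
  lra. }
destruct (H true) as [d1 [Hd1 H1]]. destruct (H false) as [d2 [Hd2 H2]].
exists (Rmin d1 d2). split; [now apply Rmin_pos|]. intros eta [He0 He] u v b Hu Hv.
destruct b; [apply H1|apply H2]; try easy; split; try easy;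
  apply Rlt_le_trans with (1 := He); [apply Rmin_l|apply Rmin_r].
Qed.

Lemma compact_support_approximation (alpha r : R) (T dT : R -> C) (F : C -> C) :
  alpha < 0 -> 0 < r -> is_C1 T dT -> vanishing dT ->
  (forall s, rect alpha r s -> analytic_at F s) ->
  (forall b, cont_within_rect alpha 1 (- r) r (fun s => part b (F s))) ->
  (forall b u w, 0 < u <= 1 -> Rabs w <= r ->
     part b (F (u, w)) = II (lap_int 0 (wave_at T w b) u)) ->
  forall eps, 0 < eps -> exists (sigma dsigma : R -> C) (N : R),
    0 <= N /\ is_C1 sigma dsigma /\ (forall x, N <= x -> sigma x = RtoC 0) /\
    (forall x, 0 <= x -> Cmod (Cminus (dsigma x) (dT x)) <= eps) /\
    (forall u v b, alpha <= u <= 1 -> Rabs v <= r ->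
       Rabs (RInt (lap_int 0 (wave_at sigma v b) u) 0 N - part b (F (u, v))) <= eps).
Proof.
intros Ha Hr HT Hv HF Hc HL eps Heps.
destruct (scaled_close alpha r F Ha Hr Hc (eps / 2) ltac:(lra)) as [d1 [Hd1 H1]].
destruct (dilated_close T dT HT Hv (eps / 2) ltac:(lra)) as [d2 [Hd2 H2]].
set (d := Rmin (- alpha) (Rmin d1 d2)).
assert (Hd : 0 < d) by (repeat apply Rmin_pos; lra).
set (eta := d / 2).
assert (He : 0 < eta < d) by (unfold eta; lra).
assert (He1 : eta < - alpha) by (apply Rlt_le_trans with (1 := proj2 He), Rmin_l).
assert (He2 : eta < Rmin d1 d2) by (apply Rlt_le_trans with (1 := proj2 He), Rmin_r).
destruct (dilated_approximable alpha r T dT F eta Ha Hr (conj (proj1 He) He1) HT Hv HF HL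
  (eps / 2) ltac:(lra)) as (s & ds & N & Q1 & Q2 & Q3 & Q4 & Q5).
exists s, ds, N. split; [exact Q1|split; [exact Q2|split; [exact Q3|split]]].
- intros x Hx.
  replace (Cminus (ds x) (dT x)) with (Cplus (Cminus (ds x) (ddilated eta T dT x))
    (Cminus (ddilated eta T dT x) (dT x))) by ring.
  apply Rle_trans with (1 := Cmod_triangle _ _).
  assert (P1 := Q4 x Hx).
  assert (P2 := H2 eta (conj (proj1 He) (Rlt_le_trans _ _ _ He2 (Rmin_r _ _))) x Hx). lra.
- intros u v b Hu Hv1.
  replace (RInt (lap_int 0 (wave_at s v b) u) 0 N - part b (F (u, v))) with
    ((RInt (lap_int 0 (wave_at s v b) u) 0 N - scaled_derive F eta v b 0 u) +
     (scaled_derive F eta v b 0 u - part b (F (u, v)))) by (apply Rminus_diag_uniq; lra).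
  apply Rle_trans with (1 := Rabs_triang _ _).
  assert (P1 := Q5 u v b Hu Hv1).
  assert (P2 := H1 eta (conj (proj1 He) (Rlt_le_trans _ _ _ He2 (Rmin_l _ _))) u v b Hu Hv1). lra.
Qed.

(** * One-sided derivatives *)

Lemma part_inj (z w : C) : (forall b, part b z = part b w) -> z = w.
Proof.
intros H. assert (H1 := H true). assert (H2 := H false).
destruct z, w. simpl in *. now subst.
Qed.

(** A filter-free form of the one-sided derivative for real functions, to which both components of
    [is_half_derive] reduce. *)
Definition half_derive_eps (f : R -> R) (x l : R) : Prop :=
  forall eps, 0 < eps -> exists delta, 0 < delta /\ forall y, 0 <= y ->
    Rabs (y - x) < delta -> Rabs (f y - f x - (y - x) * l) <= eps * Rabs (y - x).

Lemma is_half_derive_parts (tau : R -> C) (x : R) (l : C) : 0 <= x ->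
  is_half_derive tau x l <->
  forall b, half_derive_eps (fun y => part b (tau y)) x (part b l).
Proof.
intros Hx.
assert (Hpart : forall b y, part b (minus (G := C_R_NormedModule) (minus (G := C_R_NormedModule) (tau y) (tau x))
   (scal (V := C_R_NormedModule) (minus (G := R_NormedModule) y x) l)) =
   part b (tau y) - part b (tau x) - (y - x) * part b l).
{ intros b y. now destruct b. }
split.
- intros [_ H] b eps Heps.
  assert (Hlim : is_filter_lim (T := R_UniformSpace) (within half_line (locally x)) x).
  { intros P HP. apply filter_imp with (2 := HP). easy. }
  destruct (H x Hlim (mkposreal eps Heps)) as [d Hd]. exists d. split; [apply cond_pos|].
  intros y Hy Hyx. specialize (Hd y Hyx Hy).
  rewrite <- Hpart. apply Rle_trans with (1 := part_le_Cmod _ _). rewrite Cmod_norm. exact Hd.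
- intros H. split; [apply (is_linear_scal_l (V := C_R_NormedModule))|].
  intros x0 Hx0.
  (* [filterdiff] quantifies over all limits of the filter; here [x] is the only one, because it
     belongs to the half-line and so to every set of the filter. *)
  assert (E : x = x0).
  { apply (is_filter_lim_locally_unique (K := R_AbsRing) (V := R_NormedModule)).
    intros P HP.
    destruct (Req_dec x x0) as [->|Hn]; [exact HP|].
    exfalso.
    assert (Hp : 0 < Rabs (x - x0)) by (apply Rabs_pos_lt; lra).
    destruct (Hx0 (fun y => Rabs (y - x0) < Rabs (x - x0))) as [d Hd].
    - exists (mkposreal _ Hp). easy.
    - specialize (Hd x (ball_center x d) Hx). lra. }
  subst x0. intros eps.
  assert (He2 : 0 < eps / 2) by (destruct eps; simpl; lra).
  destruct (H true _ He2) as [d1 [Hd1 H1]]. destruct (H false _ He2) as [d2 [Hd2 H2]].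
  exists (mkposreal (Rmin d1 d2) (Rmin_pos _ _ Hd1 Hd2)). intros y Hy Hy0.
  change (Rabs (y - x) < Rmin d1 d2) in Hy.
  set (z := minus (G := C_R_NormedModule) (minus (G := C_R_NormedModule) (tau y) (tau x))
    (scal (V := C_R_NormedModule) (minus (G := R_NormedModule) y x) l)).
  change (@norm R_AbsRing (prod_NormedModule R_AbsRing R_NormedModule R_NormedModule) z
    <= eps * Rabs (y - x)).
  rewrite <- Cmod_norm. apply Rle_trans with (1 := Cmod_le_parts _).
  assert (Q1 := H1 y Hy0 (Rlt_le_trans _ _ _ Hy (Rmin_l _ _))). rewrite <- Hpart in Q1.
  assert (Q2 := H2 y Hy0 (Rlt_le_trans _ _ _ Hy (Rmin_r _ _))). rewrite <- Hpart in Q2.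
  change (Rabs (fst z) <= eps / 2 * Rabs (y - x)) in Q1.
  change (Rabs (snd z) <= eps / 2 * Rabs (y - x)) in Q2. lra.
Qed.

(** Only points x + h to the right are tested, which are available at x = 0 too. *)
Lemma half_derive_eps_unique (f : R -> R) (x l1 l2 : R) : 0 <= x ->
  half_derive_eps f x l1 -> half_derive_eps f x l2 -> l1 = l2.
Proof.
intros Hx H1 H2. apply Rminus_diag_uniq, Rabs_eq_0, Rle_antisym; [|apply Rabs_pos].
apply Rnot_lt_le. intros Hp. set (e := Rabs (l1 - l2) / 4).
assert (He : 0 < e) by (unfold e; lra).
destruct (H1 e He) as [d1 [Hd1 P1]]. destruct (H2 e He) as [d2 [Hd2 P2]].
set (h := Rmin d1 d2 / 2).
assert (Hm : 0 < Rmin d1 d2) by now apply Rmin_pos.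
assert (Hh : 0 < h) by (unfold h; lra).
assert (Q1 := Rmin_l d1 d2). assert (Q2 := Rmin_r d1 d2).
specialize (P1 (x + h) ltac:(lra)). specialize (P2 (x + h) ltac:(lra)).
replace (x + h - x) with h in P1, P2 by ring. rewrite (Rabs_pos_eq h) in P1, P2 by lra.
specialize (P1 ltac:(unfold h; lra)). specialize (P2 ltac:(unfold h; lra)).
assert (H : h * Rabs (l1 - l2) <= 2 * (e * h)).
{ replace (h * Rabs (l1 - l2)) with (Rabs (h * (l1 - l2)))
    by (rewrite Rabs_mult, (Rabs_pos_eq h); lra).
  replace (h * (l1 - l2)) with ((f (x + h) - f x - h * l2) + - (f (x + h) - f x - h * l1)) by ring.
  apply Rle_trans with (1 := Rabs_triang _ _). rewrite Rabs_Ropp. lra. }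
unfold e in H. nra.
Qed.

Lemma half_derive_unique (tau : R -> C) (x : R) (l : C) : 0 <= x ->
  is_half_derive tau x l -> half_derive tau x = l.
Proof.
intros Hx H. apply (iota_unique (V := C_R_CompleteNormedModule)); [|exact H].
intros y Hy. apply part_inj. intros b.
apply (half_derive_eps_unique (fun y => part b (tau y)) x); [exact Hx| |];
  now apply is_half_derive_parts.
Qed.

Lemma is_half_derive_minus (s t : R -> C) (x : R) (l m : C) : 0 <= x ->
  is_half_derive s x l -> is_half_derive t x m ->
  is_half_derive (fun y => Cminus (s y) (t y)) x (Cminus l m).
Proof.
intros Hx Hs Ht. apply is_half_derive_parts; [exact Hx|]. intros b eps Heps.
destruct (proj1 (is_half_derive_parts s x l Hx) Hs b (eps / 2) ltac:(lra)) as [d1 [Hd1 P1]].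
destruct (proj1 (is_half_derive_parts t x m Hx) Ht b (eps / 2) ltac:(lra)) as [d2 [Hd2 P2]].
exists (Rmin d1 d2). split; [now apply Rmin_pos|]. intros y Hy Hyx.
specialize (P1 y Hy (Rlt_le_trans _ _ _ Hyx (Rmin_l _ _))).
specialize (P2 y Hy (Rlt_le_trans _ _ _ Hyx (Rmin_r _ _))).
rewrite !part_minus.
match goal with |- Rabs ?z <= _ => replace z with
  ((part b (s y) - part b (s x) - (y - x) * part b l) +
   - (part b (t y) - part b (t x) - (y - x) * part b m)) by ring end.
apply Rle_trans with (1 := Rabs_triang _ _). rewrite Rabs_Ropp. lra.
Qed.

Lemma is_derive_eps (f : R -> R) (x l : R) : is_derive f x l <->
  forall eps, 0 < eps -> exists delta, 0 < delta /\ forall y,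
    Rabs (y - x) < delta -> Rabs (f y - f x - (y - x) * l) <= eps * Rabs (y - x).
Proof.
split.
- intros [_ H] eps Heps.
  assert (Hlim : is_filter_lim (T := R_UniformSpace) (locally x) x) by (intros P HP; exact HP).
  destruct (H x Hlim (mkposreal eps Heps)) as [d Hd]. exists d. split; [apply cond_pos|].
  intros y Hy. exact (Hd y Hy).
- intros H. split; [apply (is_linear_scal_l (V := R_NormedModule))|].
  intros x0 Hx0.
  assert (E : x = x0) by
    exact (is_filter_lim_locally_unique (K := R_AbsRing) (V := R_NormedModule) x x0 Hx0).
  subst x0. intros eps. destruct (H eps (cond_pos eps)) as [d [Hd Hy]].
  exists (mkposreal d Hd). intros y Hyx. exact (Hy y Hyx).
Qed.

Lemma is_C1_is_half_derive (T dT : R -> C) (x : R) : is_C1 T dT -> 0 <= x ->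
  is_half_derive T x (dT x).
Proof.
intros H Hx. apply is_half_derive_parts; [exact Hx|]. intros b eps Heps.
destruct (proj1 (is_derive_eps _ _ _) (proj1 (H b x)) eps Heps) as [d [Hd Hy]].
exists d. split; [exact Hd|]. intros y _. apply Hy.
Qed.

Lemma is_C1_half_line (T dT : R -> C) : is_C1 T dT -> C1_half_line T.
Proof.
intros H. split.
- intros x Hx. exists (dT x). now apply is_C1_is_half_derive.
- intros x Hx P [e He].
  assert (Hx' : 0 <= x) by exact Hx.
  assert (Ed : forall y, 0 <= y -> half_derive T y = dT y).
  { intros y Hy. apply half_derive_unique; [exact Hy|]. now apply is_C1_is_half_derive. }
  assert (Hc : forall b, locally x (fun y => Rabs (part b (dT y) - part b (dT x)) < e)).
  { intros b. exact (proj1 (filterlim_locally (F := locally x) _ _) (proj2 (H b x)) e). }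
  apply filter_imp with (2 := filter_and _ _ (Hc true) (Hc false)).
  intros y [H1 H2] Hy. apply He. rewrite (Ed x Hx'), (Ed y Hy). now split.
Qed.

(** Left of 0 the function is continued by its tangent at 0, which continues the derivative by a
    constant. *)
Lemma C1_half_line_extension (tau : R -> C) : C1_half_line tau ->
  exists T dT : R -> C, is_C1 T dT /\ forall x, 0 <= x -> T x = tau x /\ dT x = half_derive tau x.
Proof.
intros [Hd Hc].
assert (Hh : forall x, 0 <= x -> is_half_derive tau x (half_derive tau x)).
{ intros x Hx. destruct (Hd x Hx) as [l Hl]. now rewrite (half_derive_unique tau x l). }
set (dT := fun x => half_derive tau (Rmax 0 x)).
set (T := fun x => if Rle_dec 0 x then tau x
  else Cplus (tau 0) (Cmult (RtoC x) (half_derive tau 0))).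
exists T, dT. split.
- intros b x. split.
  + apply is_derive_eps. intros eps Heps.
    destruct (Rle_dec 0 x) as [Hx|Hx].
    * destruct (proj1 (is_half_derive_parts tau x _ Hx) (Hh x Hx) b eps Heps) as [d [Hd1 Hy]].
      destruct (Rlt_dec 0 x) as [Hx0|Hx0].
      -- exists (Rmin d x). split; [now apply Rmin_pos|]. intros y Hyx.
         assert (Q1 := Rlt_le_trans _ _ _ Hyx (Rmin_l _ _)).
         assert (Q2 := Rlt_le_trans _ _ _ Hyx (Rmin_r _ _)).
         apply Rabs_def2 in Q2. unfold T, dT. rewrite Rmax_right by lra.
         destruct (Rle_dec 0 y); [|lra]. destruct (Rle_dec 0 x); [|lra]. now apply Hy.
      -- assert (x = 0) by lra. subst x. exists d. split; [exact Hd1|]. intros y Hyx.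
         unfold T, dT. rewrite Rmax_left by lra.
         destruct (Rle_dec 0 0); [|lra]. destruct (Rle_dec 0 y) as [Hy0|Hy0]; [now apply Hy|].
         rewrite part_plus, part_RtoC_mult.
         match goal with |- Rabs ?z <= _ => replace z with 0 by ring end.
         rewrite Rabs_R0. apply Rmult_le_pos; [lra|apply Rabs_pos].
    * exists (- x). split; [lra|]. intros y Hyx. apply Rabs_def2 in Hyx.
      unfold T, dT. rewrite Rmax_left by lra.
      destruct (Rle_dec 0 y); [lra|]. destruct (Rle_dec 0 x); [lra|].
      rewrite !part_plus, !part_RtoC_mult.
      match goal with |- Rabs ?z <= _ => replace z with 0 by ring end.
      rewrite Rabs_R0. apply Rmult_le_pos; [lra|apply Rabs_pos].
  + unfold dT.
    apply (filterlim_comp _ _ _ (Rmax 0) (fun y => part b (half_derive tau y)) _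
      (within half_line (locally (Rmax 0 x)))).
    * intros P HP.
      assert (Q := continuous_Rmax_0 x _ HP). unfold filtermap in *.
      apply filter_imp with (2 := Q). intros y Hy. apply Hy, Rmax_l.
    * apply (filterlim_comp _ _ _ (half_derive tau) (part b) _ (locally (half_derive tau (Rmax 0 x)))).
      -- apply Hc. apply Rmax_l.
      -- apply part_filterlim.
- intros x Hx. unfold T, dT. rewrite Rmax_right by exact Hx.
  destruct (Rle_dec 0 x); [easy|lra].
Qed.

Lemma vanishing_iff (tau dT : R -> C) : (forall x, 0 <= x -> half_derive tau x = dT x) ->
  derive_vanishes_at_infty tau <-> vanishing dT.
Proof.
intros E. split.
- intros H b. apply is_lim_ext_loc with (fun x => part b (half_derive tau x)).
  { exists 0. intros x Hx. rewrite E; [easy|lra]. }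
  apply (filterlim_comp _ _ _ (half_derive tau) (part b) _ (locally (RtoC 0))); [exact H|].
  assert (Hp := part_filterlim b (RtoC 0)).
  replace (part b (RtoC 0)) with 0 in Hp by (now destruct b). exact Hp.
- intros H P [e He].
  assert (H1 := proj2 (is_lim_spec _ _ _) (H true) e). assert (H2 := proj2 (is_lim_spec _ _ _) (H false) e).
  destruct H1 as [M1 H1]. destruct H2 as [M2 H2].
  exists (Rmax 0 (Rmax M1 M2)). intros x Hx.
  assert (Q1 := Rle_lt_trans _ _ _ (Rmax_l _ _) Hx).
  assert (Q2 := Rle_lt_trans _ _ _ (Rmax_r _ _) Hx).
  apply He. rewrite E by lra. split.
  + apply H1. apply Rle_lt_trans with (2 := Q2), Rmax_l.
  + apply H2. apply Rle_lt_trans with (2 := Q2), Rmax_r.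
Qed.

(** * The Laplace transform of the definitions *)

Lemma laplace_integrand_part (T : R -> C) (u v x : R) (b : bool) :
  part b (Cmult (T x) (Cexp (Copp (Cmult (u, v) (RtoC x))))) = lap_int 0 (wave_at T v b) u x.
Proof.
unfold lap_int, wave_at, Cexp, Cmult, Copp, RtoC, Re, Im. rewrite pow_O.
destruct (T x) as [y z]. simpl fst; simpl snd.
replace (- (u * x - v * 0)) with (- (u * x)) by ring.
replace (- (u * 0 + v * x)) with (- (v * x)) by ring.
rewrite cos_neg, sin_neg. destruct b; simpl; ring.
Qed.

(** Convergence of the two real integrals is assumed in place of a decay rate, so the lemma covers
    Re s > 0 and compact support alike. *)
Lemma laplace_eq (tau T dT : R -> C) (u v : R) (l : bool -> R) :
  is_C1 T dT -> (forall x, 0 <= x -> tau x = T x) ->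
  (forall b, is_lim (fun B => RInt (lap_int 0 (wave_at T v b) u) 0 B) p_infty (l b)) ->
  laplace tau (u, v) = (l true, l false).
Proof.
intros HT E Hl. unfold laplace.
refine (@is_RInt_gen_unique C_R_CompleteNormedModule (at_point 0) (Rbar_locally p_infty) _ _
  (fun x => Cmult (tau x) (Cexp (Copp (Cmult (u, v) (RtoC x))))) ((l true, l false) : C) _).
intros P [e He].
destruct (proj2 (is_lim_spec _ _ _) (Hl true) e) as [M1 H1].
destruct (proj2 (is_lim_spec _ _ _) (Hl false) e) as [M2 H2].
apply (Filter_prod _ _ _ (fun x => x = 0) (fun y => Rmax 0 (Rmax M1 M2) < y)).
- easy.
- now exists (Rmax 0 (Rmax M1 M2)).
- intros x B -> HB.
  assert (Q1 := Rle_lt_trans _ _ _ (Rmax_l _ _) HB).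
  assert (Q2 := Rle_lt_trans _ _ _ (Rmax_r _ _) HB).
  exists (RInt (lap_int 0 (wave_at T v true) u) 0 B, RInt (lap_int 0 (wave_at T v false) u) 0 B).
  split.
  + simpl fst; simpl snd.
    assert (Hint : forall b, is_RInt (lap_int 0 (wave_at T v b) u) 0 B
      (RInt (lap_int 0 (wave_at T v b) u) 0 B)).
    { intros b. apply (RInt_correct (V := R_CompleteNormedModule)), ex_RInt_cont, cont_lap_int.
      intros; now apply wave_at_continuous with dT. }
    apply (is_RInt_fct_extend_pair (U := R_NormedModule) (V := R_NormedModule)).
    * apply is_RInt_ext with (2 := Hint true). intros x Hx. rewrite Rmin_left in Hx by lra.
      rewrite E by lra. symmetry. apply (laplace_integrand_part T u v x true).
    * apply is_RInt_ext with (2 := Hint false). intros x Hx. rewrite Rmin_left in Hx by lra.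
      rewrite E by lra. symmetry. apply (laplace_integrand_part T u v x false).
  + apply He. split.
    * apply H1. apply Rle_lt_trans with (2 := Q2), Rmax_l.
    * apply H2. apply Rle_lt_trans with (2 := Q2), Rmax_r.
Qed.

Lemma vanishing_derive_laplace_lim (T dT : R -> C) (u v : R) (b : bool) :
  is_C1 T dT -> vanishing dT -> 0 < u ->
  is_lim (fun B => RInt (lap_int 0 (wave_at T v b) u) 0 B) p_infty
    (II (lap_int 0 (wave_at T v b) u)).
Proof.
intros HT Hv Hu.
destruct (vanishing_derive_growth T dT HT Hv) as [A [HA0 HA]].
apply II_lim with (A + 2 / u) (u / 2).
- apply cont_lap_int. intros; now apply wave_at_continuous with dT.
- intros x Hx. unfold lap_int. rewrite pow_O, Rmult_1_l, Rabs_mult.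
  rewrite (Rabs_pos_eq (exp _)) by (left; apply exp_pos).
  replace (- (u * x)) with (- (u / 2 * x) + - (u / 2 * x)) by field.
  rewrite exp_plus, <- Rmult_assoc. apply Rmult_le_compat_r; [left; apply exp_pos|].
  assert (H1 := wave_at_le T v b x). assert (H2 := HA x Hx).
  assert (H3 := x_exp_le (u / 2) x ltac:(lra) Hx).
  assert (H4 := exp_pos (- (u / 2 * x))).
  assert (H5 : exp (- (u / 2 * x)) <= 1) by (apply exp_between; nra).
  replace (/ (u / 2)) with (2 / u) in H3 by (field; lra).
  apply Rle_trans with ((A + x) * exp (- (u / 2 * x))).
  + apply Rmult_le_compat_r; lra.
  + nra.
- lra.
Qed.

Lemma laplace_of_vanishing_derive (tau T dT : R -> C) (u v : R) (b : bool) :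
  is_C1 T dT -> vanishing dT -> (forall x, 0 <= x -> tau x = T x) -> 0 < u ->
  part b (laplace tau (u, v)) = II (lap_int 0 (wave_at T v b) u).
Proof.
intros HT Hv E Hu.
rewrite (laplace_eq tau T dT u v (fun b => II (lap_int 0 (wave_at T v b) u)) HT E); [now destruct b|].
intros b'. now apply vanishing_derive_laplace_lim with dT.
Qed.

Lemma is_C1_minus (S dS T dT : R -> C) : is_C1 S dS -> is_C1 T dT ->
  is_C1 (fun x => Cminus (S x) (T x)) (fun x => Cminus (dS x) (dT x)).
Proof.
intros HS HT b x. split.
- apply is_derive_ext with (fun y => part b (S y) - part b (T y)).
  { intros t. now rewrite part_minus. }
  rewrite part_minus.
  apply (is_derive_minus (K := R_AbsRing) (V := R_NormedModule)); [apply HS|apply HT].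
- apply continuous_ext with (fun y => part b (dS y) - part b (dT y)).
  { intros t. now rewrite part_minus. }
  apply (continuous_minus (V := R_NormedModule)); [apply HS|apply HT].
Qed.

Lemma laplace_minus (s t S dS T dT : R -> C) (u v : R) :
  is_C1 S dS -> vanishing dS -> (forall x, 0 <= x -> s x = S x) ->
  is_C1 T dT -> vanishing dT -> (forall x, 0 <= x -> t x = T x) -> 0 < u ->
  laplace (fun x => Cminus (s x) (t x)) (u, v) = Cminus (laplace s (u, v)) (laplace t (u, v)).
Proof.
intros HS HSv Es HT HTv Et Hu.
assert (HST := is_C1_minus S dS T dT HS HT).
assert (Est : forall x, 0 <= x -> Cminus (s x) (t x) = Cminus (S x) (T x)).
{ intros x Hx. now rewrite Es, Et. }
rewrite (laplace_eq _ _ _ u v (fun b => II (lap_int 0 (wave_at S v b) u) -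
  II (lap_int 0 (wave_at T v b) u)) HST Est).
- apply part_inj. intros b. rewrite part_minus.
  rewrite (laplace_of_vanishing_derive s S dS), (laplace_of_vanishing_derive t T dT) by easy.
  now destruct b.
- intros b. apply is_lim_ext with (fun B => RInt (lap_int 0 (wave_at S v b) u) 0 B -
    RInt (lap_int 0 (wave_at T v b) u) 0 B).
  + intros B.
    assert (Hm : RInt (fun x => lap_int 0 (wave_at S v b) u x - lap_int 0 (wave_at T v b) u x) 0 B
      = RInt (lap_int 0 (wave_at S v b) u) 0 B - RInt (lap_int 0 (wave_at T v b) u) 0 B).
    { apply (RInt_minus (V := R_CompleteNormedModule)); apply ex_RInt_cont, cont_lap_int;
        intros; [now apply wave_at_continuous with dS|now apply wave_at_continuous with dT]. }
    rewrite <- Hm. apply RInt_ext. intros x _. unfold lap_int, wave_at.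
    destruct b; simpl; ring.
  + apply is_lim_minus';
      [now apply vanishing_derive_laplace_lim with dS|now apply vanishing_derive_laplace_lim with dT].
Qed.

(** * Transforms of compactly supported functions are entire *)

Definition finite_laplace (T : R -> C) (N : R) (s : C) : C :=
  (RInt (lap_int 0 (wave_at T (Im s) true) (Re s)) 0 N,
   RInt (lap_int 0 (wave_at T (Im s) false) (Re s)) 0 N).

Lemma part_finite_laplace (T : R -> C) (N u v : R) (b : bool) :
  part b (finite_laplace T N (u, v)) = RInt (lap_int 0 (wave_at T v b) u) 0 N.
Proof. now destruct b. Qed.

Lemma laplace_compact_support (s ds : R -> C) (N u v : R) : is_C1 s ds ->
  (forall x, N <= x -> s x = RtoC 0) -> laplace s (u, v) = finite_laplace s N (u, v).
Proof.
intros Hs HN.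
rewrite (laplace_eq s s ds u v (fun b => RInt (lap_int 0 (wave_at s v b) u) 0 N)); try easy.
intros b. apply is_lim_ext_loc with (fun _ => RInt (lap_int 0 (wave_at s v b) u) 0 N);
  [|apply is_lim_const].
exists N. intros x Hx.
rewrite (RInt_Chasles_cont _ 0 N x).
- rewrite (RInt_ext _ (fun _ => 0) N x).
  + rewrite RInt_const. unfold scal; simpl; unfold mult; simpl.
    rewrite Rmult_0_r. symmetry. apply Rplus_0_r.
  + intros y Hy. rewrite Rmin_left in Hy by lra. rewrite <- laplace_integrand_part.
    rewrite HN by lra. rewrite Cmult_0_l. now destruct b.
- apply cont_lap_int. intros; now apply wave_at_continuous with ds.
Qed.

Lemma Cexp_plus (z w : C) : Cexp (Cplus z w) = Cmult (Cexp z) (Cexp w).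
Proof.
destruct z as [a b], w as [c d]. unfold Cexp, Cplus, Cmult, Re, Im; simpl.
rewrite exp_plus, cos_plus, sin_plus. f_equal; ring.
Qed.

Lemma Cmod_Cexp_le (z : C) : Cmod (Cexp z) <= exp (Cmod z).
Proof.
destruct z as [a b]. unfold Cexp, Cmod at 1, Re, Im. simpl fst; simpl snd.
replace ((exp a * cos b) ^ 2 + (exp a * sin b) ^ 2) with (exp a ^ 2).
- rewrite sqrt_pow2 by (left; apply exp_pos). apply exp_le_compat.
  apply Rle_trans with (2 := part_le_Cmod true (a, b)). apply Rle_abs.
- assert (H := sin2_cos2 b). unfold Rsqr in H.
  replace ((exp a * cos b) ^ 2 + (exp a * sin b) ^ 2) with
    (exp a ^ 2 * (sin b * sin b + cos b * cos b)) by ring. rewrite H. ring.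
Qed.

Fixpoint cexp_sum (n : nat) (y : C) : C :=
  match n with
  | O => RtoC 0
  | S k => Cplus (cexp_sum k y) (Cmult (RtoC (/ INR (fact k))) (Cpow y k))
  end.

Lemma part_cexp_sum (b : bool) (n : nat) (y : C) :
  part b (cexp_sum n y) = psum (fun j => / INR (fact j) * part b (Cpow y j)) n.
Proof.
induction n as [|n IH]; simpl.
- now destruct b.
- now rewrite part_plus, part_RtoC_mult, IH.
Qed.

Lemma cexp_ray_derive (b : bool) (c y : C) (t : R) :
  is_derive (fun t => part b (Cmult c (Cexp (Cmult (RtoC (- t)) y)))) t
    (part b (Cmult (Cmult (Copp y) c) (Cexp (Cmult (RtoC (- t)) y)))).
Proof.
destruct c as [c1 c2], y as [y1 y2].
assert (E : forall t, Cexp (Cmult (RtoC (- t)) (y1, y2)) =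
  (exp (- (t * y1)) * cos (t * y2), - (exp (- (t * y1)) * sin (t * y2)))).
{ intros s. unfold Cexp, Cmult, RtoC, Re, Im. simpl fst; simpl snd.
  replace (- s * y1 - 0 * y2) with (- (s * y1)) by ring.
  replace (- s * y2 + 0 * y1) with (- (s * y2)) by ring.
  rewrite cos_neg, sin_neg. f_equal. ring. }
rewrite E.
apply is_derive_ext with (fun t => part b (Cmult (c1, c2)
  (exp (- (t * y1)) * cos (t * y2), - (exp (- (t * y1)) * sin (t * y2))))).
{ intros s. now rewrite E. }
destruct b; simpl; (auto_derive; [easy|]); ring.
Qed.

Lemma Cexp_remainder (b : bool) (n : nat) (y : C) :
  Rabs (part b (Cminus (Cexp y) (cexp_sum (S n) y))) <=
  Cmod y ^ S n / INR (fact n) * exp (Cmod y).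
Proof.
(* [taylor_bound] expands about the right end of an interval. For exp (- t y) on [-1, 0] that end is
   the centre 0, the left end gives exp y, and the two powers of -1 cancel. *)
set (g := fun j t => part b (Cmult (Cpow (Copp y) j) (Cexp (Cmult (RtoC (- t)) y)))).
assert (H := taylor_bound g n (-1) 1 (Cmod y ^ S n * exp (Cmod y)) Rlt_0_1).
rewrite part_minus, Rabs_minus_sym.
replace (part b (cexp_sum (S n) y)) with
  (psum (fun j => (-1) ^ j / INR (fact j) * g j (-1 + 1)) (S n)).
2:{ rewrite part_cexp_sum. apply psum_ext. intros j _. unfold g.
    replace (-1 + 1) with 0 by ring. rewrite Ropp_0, Cmult_0_l.
    replace (Cexp (RtoC 0)) with (RtoC 1).
    2:{ unfold Cexp, RtoC; simpl. rewrite exp_0, cos_0, sin_0. f_equal; ring. }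
    rewrite Cmult_1_r. replace (Copp y) with (Cmult (RtoC (-1)) y)
      by (destruct y; unfold RtoC, Cmult, Copp; simpl; f_equal; ring).
    rewrite Cpow_mult_l.
    replace (Cpow (RtoC (-1)) j) with (RtoC ((-1) ^ j)).
    2:{ clear. induction j as [|j IH]; [easy|]. rewrite Cpow_S, <- IH, <- RtoC_mult. easy. }
    rewrite part_RtoC_mult. unfold Rdiv.
    replace ((-1) ^ j * / INR (fact j) * ((-1) ^ j * part b (Cpow y j))) with
      (((-1) * (-1)) ^ j * / INR (fact j) * part b (Cpow y j)) by (rewrite Rpow_mult_distr; ring).
    replace (-1 * -1) with 1 by ring. rewrite pow1. ring. }
replace (part b (Cexp y)) with (g O (-1)).
2:{ unfold g. replace (- -1) with 1 by ring. simpl Cpow. now rewrite !Cmult_1_l. }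
rewrite pow1 in H.
replace (Cmod y ^ S n / INR (fact n) * exp (Cmod y)) with
  (1 / INR (fact n) * (Cmod y ^ S n * exp (Cmod y))) by (field; apply INR_fact_neq_0).
apply H.
- intros j t _. unfold g. apply (cexp_ray_derive b (Cpow (Copp y) j) y t).
- intros t Ht. unfold g. apply Rle_trans with (1 := part_le_Cmod _ _).
  rewrite Cmod_mult, Cmod_Cpow, Cmod_opp. apply Rmult_le_compat_l; [apply pow_le, Cmod_ge_0|].
  apply Rle_trans with (1 := Cmod_Cexp_le _). apply exp_le_compat.
  rewrite Cmod_mult, Cmod_R. assert (Hp := Cmod_ge_0 y).
  assert (Rabs (- t) <= 1) by (apply Rabs_le; lra). nra.
Qed.

Definition cint (f : R -> C) (N : R) : C :=
  (RInt (fun x => part true (f x)) 0 N, RInt (fun x => part false (f x)) 0 N).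

Definition ccont (f : R -> C) : Prop := forall b x, continuous (fun y => part b (f y)) x.

Lemma part_cint (b : bool) (f : R -> C) (N : R) : part b (cint f N) = RInt (fun x => part b (f x)) 0 N.
Proof. now destruct b. Qed.

Lemma ccont_mult (f g : R -> C) : ccont f -> ccont g -> ccont (fun x => Cmult (f x) (g x)).
Proof.
intros Hf Hg b.
assert (H1 := Hf true). assert (H2 := Hf false). assert (H3 := Hg true). assert (H4 := Hg false).
simpl in H1, H2, H3, H4.
destruct b; simpl; intros x.
- apply (continuous_minus (V := R_NormedModule)); now apply cont_mult.
- apply (continuous_plus (V := R_NormedModule)); now apply cont_mult.
Qed.

Lemma ccont_const (c : C) : ccont (fun _ => c).
Proof. intros b x. apply continuous_const. Qed.

Lemma cint_mult (f : R -> C) (c : C) (N : R) : ccont f ->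
  Cmult c (cint f N) = cint (fun x => Cmult c (f x)) N.
Proof.
intros Hf.
assert (H1 := Hf true). assert (H2 := Hf false).
assert (Hs : forall k (g : R -> R), (forall x, continuous g x) ->
  k * RInt g 0 N = RInt (fun x => k * g x) 0 N).
{ intros k g Hg. symmetry.
  apply (RInt_scal (V := R_CompleteNormedModule)). now apply ex_RInt_cont. }
assert (Hsc : forall k (g : R -> R), (forall x, continuous g x) -> forall x, continuous (fun x => k * g x) x).
{ intros k g Hg x. now apply (continuous_scal_r (K := R_AbsRing) (V := R_NormedModule)). }
unfold cint, Cmult. simpl part in *. apply injective_projections; simpl fst; simpl snd.
- rewrite !Hs by easy. symmetry.
  apply (RInt_minus (V := R_CompleteNormedModule)); apply ex_RInt_cont; now apply Hsc.
- rewrite !Hs by easy. symmetry.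
  apply (RInt_plus (V := R_CompleteNormedModule)); apply ex_RInt_cont; now apply Hsc.
Qed.

Lemma is_series_of_parts (c : nat -> C) (l : C) :
  (forall b, is_lim_seq (fun n => part b (sum_n (G := C_NormedModule) c n)) (part b l)) ->
  is_series (K := C_AbsRing) (V := C_NormedModule) c l.
Proof.
intros H P [e He].
destruct (proj2 (is_lim_seq_spec _ _) (H true) e) as [N1 H1].
destruct (proj2 (is_lim_seq_spec _ _) (H false) e) as [N2 H2].
exists (max N1 N2). intros n Hn. apply He. split.
- apply H1. lia.
- apply H2. lia.
Qed.

(** One writes exp (- z x) = exp (- z0 x) exp (- (z - z0) x) and integrates the series of the second
    factor over [0, N]. The error is at most a constant times q^n / n! with q = |z - z0| N, which
    tends to 0 for every z. *)
Lemma finite_laplace_analytic (T dT : R -> C) (N : R) (z0 : C) : 0 <= N -> is_C1 T dT ->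
  analytic_at (finite_laplace T N) z0.
Proof.
intros HN HT.
set (E := fun z x => Cmult (T x) (Cexp (Copp (Cmult z (RtoC x))))).
assert (HE : forall z, ccont (E z)).
{ intros [u v] b x. apply continuous_ext with (lap_int 0 (wave_at T v b) u).
  - intros t. symmetry. apply laplace_integrand_part.
  - apply cont_lap_int. intros; now apply wave_at_continuous with dT. }
assert (HF : forall z, finite_laplace T N z = cint (E z) N).
{ intros [u v]. apply part_inj. intros b. rewrite part_finite_laplace, part_cint.
  apply RInt_ext. intros x _. symmetry. apply laplace_integrand_part. }
assert (Hpw : forall k, ccont (fun x => Cmult (RtoC (/ INR (fact k))) (RtoC ((- x) ^ k)))).
{ intros k. apply ccont_mult; [apply ccont_const|]. intros b x. destruct b; simpl.
  - apply (ex_derive_continuous (K := R_AbsRing) (V := R_NormedModule)). auto_derive. easy.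
  - apply continuous_const. }
set (a := fun k => cint (fun x => Cmult (E z0 x) (Cmult (RtoC (/ INR (fact k))) (RtoC ((- x) ^ k)))) N).
exists a. apply filter_forall. intros z. set (w := Cminus z z0).
assert (Hterm : forall k, scal (V := C_NormedModule) (pow_n (K := C_AbsRing) w k) (a k) =
  cint (fun x => Cmult (E z0 x) (Cmult (RtoC (/ INR (fact k))) (Cpow (Cmult (RtoC (- x)) w) k))) N).
{ intros k. rewrite pow_n_Cpow. change (Cmult (Cpow w k) (a k) =
   cint (fun x => Cmult (E z0 x) (Cmult (RtoC (/ INR (fact k))) (Cpow (Cmult (RtoC (- x)) w) k))) N).
  unfold a. rewrite cint_mult.
  - f_equal. extensionality x. rewrite Cpow_mult_l.
    replace (Cpow (RtoC (- x)) k) with (RtoC ((- x) ^ k)); [ring|].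
    clear. induction k as [|k IH]; [easy|]. rewrite Cpow_S, <- IH, <- RtoC_mult. easy.
  - apply ccont_mult; [apply HE|apply Hpw]. }
assert (Hcs : forall n, ccont (fun x => cexp_sum n (Cmult (RtoC (- x)) w))).
{ intros n. induction n as [|n IH]; [exact (ccont_const (RtoC 0))|].
  intros b x. simpl cexp_sum.
  apply continuous_ext with (fun x => part b (cexp_sum n (Cmult (RtoC (- x)) w)) +
    part b (Cmult (Cpow w n) (Cmult (RtoC (/ INR (fact n))) (RtoC ((- x) ^ n))))).
  - intros t. rewrite part_plus. f_equal. f_equal. rewrite Cpow_mult_l.
    replace (Cpow (RtoC (- t)) n) with (RtoC ((- t) ^ n)); [ring|].
    clear. induction n as [|k IH]; [easy|]. rewrite Cpow_S, <- IH, <- RtoC_mult. easy.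
  - apply (continuous_plus (V := R_NormedModule)); [apply IH|].
    apply (ccont_mult _ _ (ccont_const (Cpow w n)) (Hpw n)). }
assert (Hsum : forall n, sum_n (G := C_NormedModule) (fun k => scal (pow_n (K := C_AbsRing) w k) (a k)) n =
  cint (fun x => Cmult (E z0 x) (cexp_sum (S n) (Cmult (RtoC (- x)) w))) N).
{ induction n as [|n IH].
  - rewrite sum_O, Hterm. f_equal. extensionality x. simpl. ring.
  - rewrite sum_Sn, IH, Hterm. apply part_inj. intros b.
    assert (Hc1 := ccont_mult _ _ (HE z0) (Hcs (S n)) b).
    assert (Hc2 := ccont_mult _ _ (HE z0) (Hcs (S (S n))) b).
    set (f1 := fun x => part b (Cmult (E z0 x) (cexp_sum (S n) (Cmult (RtoC (- x)) w)))).
    set (f2 := fun x => part b (Cmult (E z0 x) (cexp_sum (S (S n)) (Cmult (RtoC (- x)) w)))) in *.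
    set (f3 := fun x => part b (Cmult (E z0 x) (Cmult (RtoC (/ INR (fact (S n)))) (Cpow (Cmult (RtoC (- x)) w) (S n))))).
    rewrite part_cint. fold f2.
    transitivity (RInt f1 0 N + RInt f3 0 N).
    { rewrite <- (part_cint b (fun x => Cmult (E z0 x) (cexp_sum (S n) (Cmult (RtoC (- x)) w)))).
      unfold f3. rewrite <- (part_cint b). apply part_plus. }
    assert (E3 : forall x, f3 x = f2 x - f1 x).
    { intros x. unfold f1, f2, f3. rewrite <- part_minus. f_equal.
      change (cexp_sum (S (S n)) (Cmult (RtoC (- x)) w)) with
        (Cplus (cexp_sum (S n) (Cmult (RtoC (- x)) w))
          (Cmult (RtoC (/ INR (fact (S n)))) (Cpow (Cmult (RtoC (- x)) w) (S n)))). ring. }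
    rewrite (RInt_ext f3 (fun x => f2 x - f1 x)) by (intros; apply E3).
    assert (Em : RInt (fun x => f2 x - f1 x) 0 N = RInt f2 0 N - RInt f1 0 N).
    { apply (RInt_minus (V := R_CompleteNormedModule)); now apply ex_RInt_cont. }
    rewrite Em. apply Rplus_minus. }
assert (Hbound : exists D, 0 <= D /\ forall b x, 0 <= x <= N -> Rabs (part b (E z0 x)) <= D).
{ destruct (bounded_on_segment _ 0 N (HE z0 true)) as [D1 [HD1 Q1]].
  destruct (bounded_on_segment _ 0 N (HE z0 false)) as [D2 [HD2 Q2]].
  exists (D1 + D2). split; [lra|]. intros [|] x Hx; [specialize (Q1 x Hx)|specialize (Q2 x Hx)]; lra. }
destruct Hbound as [D [HD0 HD]].
apply is_series_of_parts. intros b.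
set (q := Cmod w * N). assert (Hq : 0 <= q) by (apply Rmult_le_pos; [apply Cmod_ge_0|exact HN]).
set (K := N * (2 * D * (q * exp q))).
assert (Hlim : is_lim_seq (fun n => K * (q ^ n / INR (fact n))) 0).
{ replace (Finite 0) with (Rbar_mult K 0) by (simpl; f_equal; ring).
  apply is_lim_seq_scal_l, is_lim_seq_Reals, cv_speed_pow_fact. }
assert (Herr : forall n, Rabs (part b (sum_n (G := C_NormedModule)
   (fun k => scal (pow_n (K := C_AbsRing) w k) (a k)) n) - part b (finite_laplace T N z))
   <= K * (q ^ n / INR (fact n))).
{ intros n. rewrite Hsum, HF, !part_cint.
  assert (Hc1 := ccont_mult _ _ (HE z0) (Hcs (S n)) b).
  assert (Hc2 := HE z b).
  assert (Em : RInt (fun x => part b (Cmult (E z0 x) (cexp_sum (S n) (Cmult (RtoC (- x)) w))) - part b (E z x)) 0 N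
    = RInt (fun x => part b (Cmult (E z0 x) (cexp_sum (S n) (Cmult (RtoC (- x)) w)))) 0 N
      - RInt (fun x => part b (E z x)) 0 N).
  { apply (RInt_minus (V := R_CompleteNormedModule)); now apply ex_RInt_cont. }
  rewrite <- Em.
  replace (K * (q ^ n / INR (fact n))) with ((N - 0) * (2 * D * (q ^ S n / INR (fact n) * exp q)))
    by (unfold K; simpl; field; apply INR_fact_neq_0).
  apply (norm_RInt_le_const (V := R_NormedModule)
    (fun x => part b (Cmult (E z0 x) (cexp_sum (S n) (Cmult (RtoC (- x)) w))) - part b (E z x)) 0 N).
  - exact HN.
  - intros x Hx. change (Rabs (part b (Cmult (E z0 x) (cexp_sum (S n) (Cmult (RtoC (- x)) w))) - part b (E z x))
      <= 2 * D * (q ^ S n / INR (fact n) * exp q)).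
    set (y := Cmult (RtoC (- x)) w).
    assert (Ez : E z x = Cmult (E z0 x) (Cexp y)).
    { unfold E. rewrite <- Cmult_assoc, <- Cexp_plus. f_equal. f_equal. unfold y, w.
      rewrite RtoC_opp. ring. }
    rewrite Ez, <- part_minus.
    replace (Cminus (Cmult (E z0 x) (cexp_sum (S n) y)) (Cmult (E z0 x) (Cexp y)))
      with (Cmult (E z0 x) (Cminus (cexp_sum (S n) y) (Cexp y))) by ring.
    assert (Hy : Cmod y <= q).
    { unfold y, q. rewrite Cmod_mult, Cmod_R, Rabs_Ropp, Rabs_pos_eq by lra.
      rewrite Rmult_comm. apply Rmult_le_compat_l; [apply Cmod_ge_0|lra]. }
    assert (Hy0 := Cmod_ge_0 y).
    set (d := Cminus (cexp_sum (S n) y) (Cexp y)).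
    assert (Hd : forall b', Rabs (part b' d) <= q ^ S n / INR (fact n) * exp q).
    { intros b'. unfold d. rewrite part_minus, Rabs_minus_sym, <- part_minus.
      apply Rle_trans with (1 := Cexp_remainder b' n y).
      apply Rmult_le_compat.
      - apply Rdiv_le_0_compat; [now apply pow_le|apply INR_fact_pos].
      - left; apply exp_pos.
      - apply Rmult_le_compat_r; [left; apply Rinv_0_lt_compat, INR_fact_pos|]. apply pow_incr; lra.
      - now apply exp_le_compat. }
    set (B := q ^ S n / INR (fact n) * exp q) in *.
    assert (P1 := Hd true). assert (P2 := Hd false).
    assert (P3 := HD true x Hx). assert (P4 := HD false x Hx).
    assert (Hpr : forall b1 b2, Rabs (part b1 (E z0 x) * part b2 d) <= D * B).
    { intros b1 b2. rewrite Rabs_mult. apply Rmult_le_compat; try apply Rabs_pos; [now apply HD|apply Hd]. }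
    clearbody d B. set (m := E z0 x) in *. clearbody m.
    destruct b; simpl.
    + assert (H1 := Hpr true true). assert (H2 := Hpr false false). simpl in H1, H2.
      unfold Rminus. apply Rle_trans with (1 := Rabs_triang _ _). rewrite Rabs_Ropp. lra.
    + assert (H1 := Hpr true false). assert (H2 := Hpr false true). simpl in H1, H2.
      apply Rle_trans with (1 := Rabs_triang _ _). lra.
  - apply (RInt_correct (V := R_CompleteNormedModule)), ex_RInt_cont. intros x.
    apply (continuous_minus (V := R_NormedModule)); [apply Hc1|apply Hc2]. }
apply is_lim_seq_spec. intros e.
destruct (proj2 (is_lim_seq_spec _ _) Hlim e) as [M HM]. exists M. intros n Hn.
apply Rle_lt_trans with (1 := Herr n). specialize (HM n Hn). rewrite Rminus_0_r in HM.
apply Rle_lt_trans with (2 := HM). apply Rle_abs.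
Qed.

(** The constant terms cancel; splitting off one factor |w| <= 2 e bounds the others by 4 A D e
    2^(-n), which sum to a multiple of e. *)
Lemma analytic_at_continuous (F : C -> C) (u0 v0 : R) (b : bool) : analytic_at F (u0, v0) ->
  forall eps, 0 < eps -> exists e, 0 < e /\ forall u v, Rabs (u - u0) < e -> Rabs (v - v0) < e ->
    Rabs (part b (F (u, v)) - part b (F (u0, v0))) < eps.
Proof.
intros H eps Heps.
destruct (analytic_at_coef F u0 v0 H) as (a & A & D & R0 & HD & HR0 & Ha & HF).
assert (HA : 0 <= A).
{ specialize (Ha O). rewrite pow_O, Rmult_1_r in Ha. pose proof (Cmod_ge_0 (a O)). lra. }
assert (HAD : 0 <= A * D) by (apply Rmult_le_pos; lra).
set (e := Rmin R0 (Rmin (/ (4 * D)) (eps / (16 * (A * D + 1))))).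
assert (He : 0 < e).
{ repeat apply Rmin_pos; try lra; [apply Rinv_0_lt_compat; lra|apply Rdiv_lt_0_compat; lra]. }
exists e. split; [exact He|]. intros u v Hu Hv.
assert (E0 : e <= R0) by apply Rmin_l.
assert (E1 : e <= / (4 * D)) by (apply Rle_trans with (1 := Rmin_r _ _), Rmin_l).
assert (E2 : e <= eps / (16 * (A * D + 1))) by (apply Rle_trans with (1 := Rmin_r _ _), Rmin_r).
rewrite (HF b u v), (HF b u0 v0) by (rewrite ?Rminus_diag, ?Rabs_R0; lra).
rewrite !Rminus_diag.
set (w := (u - u0, v - v0)). assert (Hw : Cmod w <= 2 * e).
{ apply Rle_trans with (1 := Cmod_le_parts _). simpl. lra. }
assert (Hw0 := Cmod_ge_0 w).
assert (E3 : 2 * e <= / (2 * D)).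
{ replace (/ (2 * D)) with (2 * / (4 * D)) by (field; lra). lra. }
destruct (cseries_bound b a A D w HD Ha ltac:(lra)) as [S1 _].
assert (Hz : Cmod (0, 0) <= / (2 * D)).
{ change (Cmod (RtoC 0) <= / (2 * D)). rewrite Cmod_0. left. apply Rinv_0_lt_compat; lra. }
destruct (cseries_bound b a A D (0, 0) HD Ha Hz) as [S0 _].
unfold cseries. rewrite <- (Series_minus _ _ S1 S0).
apply Rle_lt_trans with (2 * (A * (2 * D * (2 * e)))).
- apply series_geom. intros n. rewrite <- part_minus.
  apply Rle_trans with (1 := part_le_Cmod _ _).
  destruct n as [|n].
  + simpl Cpow. replace (Cminus _ _) with (RtoC 0) by ring. rewrite Cmod_0. simpl. nra.
  + replace (Cpow (0, 0) (S n)) with (RtoC 0).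
    2:{ rewrite Cpow_S. change ((0, 0) : C) with (RtoC 0). ring. }
    replace (Cminus _ _) with (Cmult (a (S n)) (Cpow w (S n))) by ring.
    rewrite Cmod_mult, Cmod_Cpow.
    apply Rle_trans with (A * D ^ S n * (2 * e * (/ (2 * D)) ^ n)).
    * apply Rmult_le_compat; [apply Cmod_ge_0|apply pow_le; lra|apply Ha|].
      simpl. apply Rmult_le_compat; [lra|apply pow_le; lra|lra|]. apply pow_incr. lra.
    * right. rewrite Rinv_mult, Rpow_mult_distr, !pow_inv. simpl. field.
      split; apply pow_nonzero; lra.
- apply (Rmult_le_compat_r (16 * (A * D + 1))) in E2; [|lra].
  replace (eps / (16 * (A * D + 1)) * (16 * (A * D + 1))) with eps in E2 by (field; lra). nra.
Qed.

Lemma continuous_on_closed_rect (alpha r : R) (F : C -> C) :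
  continuous_on (closed_rect alpha r) F <->
  forall b, cont_within_rect alpha 1 (- r) r (fun s => part b (F s)).
Proof.
split.
- intros H b x y Hx Hy eps Heps.
  assert (Hin : closed_rect alpha r (x, y)) by (split; [exact Hx|apply Rabs_le; exact Hy]).
  destruct (H (x, y) Hin (fun z => Rabs (part b z - part b (F (x, y))) < eps)) as [e He].
  { exists (mkposreal eps Heps). intros z Hz. destruct b; apply Hz. }
  exists e. split; [apply cond_pos|]. intros u v Hu Hv H1 H2.
  apply (He (u, v)); [now split|]. split; [exact Hu|apply Rabs_le; exact Hv].
- intros H [x y] [Hx Hy] P [e He]. simpl in Hx, Hy.
  assert (Hy' : - r <= y <= r) by (now apply Rabs_le_between).
  destruct (H true x y Hx Hy' e (cond_pos e)) as [d1 [Hd1 H1]].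
  destruct (H false x y Hx Hy' e (cond_pos e)) as [d2 [Hd2 H2]].
  exists (mkposreal _ (Rmin_pos _ _ Hd1 Hd2)). intros [u v] [Hu Hv] [Hu2 Hv2].
  change (Rabs (u - x) < Rmin d1 d2) in Hu. change (Rabs (v - y) < Rmin d1 d2) in Hv.
  simpl in Hu2, Hv2. apply Rabs_le_between in Hv2.
  assert (L1 := Rmin_l d1 d2). assert (L2 := Rmin_r d1 d2).
  apply He. split; [apply H1|apply H2]; try easy; lra.
Qed.

(** * Norms and density *)

Lemma analytic_at_minus (F G : C -> C) (z : C) : analytic_at F z -> analytic_at G z ->
  analytic_at (fun s => Cminus (F s) (G s)) z.
Proof.
intros [a Ha] [b Hb].
exists (PS_minus (K := C_AbsRing) (V := C_NormedModule) a b).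
apply filter_imp with (2 := filter_and _ _ Ha Hb). intros s [H1 H2].
exact (is_pseries_minus (K := C_AbsRing) (V := C_NormedModule) a b _ _ _ H1 H2).
Qed.

Lemma analytic_continuous_on_closed_rect (alpha r : R) (F : C -> C) :
  (forall s, closed_rect alpha r s -> analytic_at F s) -> continuous_on (closed_rect alpha r) F.
Proof.
intros HF. apply continuous_on_closed_rect. intros b x y Hx Hy eps Heps.
assert (Hin : closed_rect alpha r (x, y)) by (split; [exact Hx|now apply Rabs_le]).
destruct (analytic_at_continuous F x y b (HF _ Hin) eps Heps) as [e [He H]].
exists e. split; [exact He|]. intros u v _ _. apply H.
Qed.

(** Inside, this is the identity theorem. A boundary point is approached along the segment to the
    centre ((alpha + 1) / 2, 0) of the rectangle, and continuity carries the equality over. *)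
Lemma laplace_ext_unique (alpha r : R) (tau : R -> C) (F G : C -> C) : alpha < 0 -> 0 < r ->
  is_laplace_ext_rect alpha r tau F -> is_laplace_ext_rect alpha r tau G ->
  forall s, closed_rect alpha r s -> F s = G s.
Proof.
intros Ha Hr (HF1 & HF2 & HF3) (HG1 & HG2 & HG3).
assert (Hin : forall s, rect alpha r s -> F s = G s).
{ apply rect_ext_unique; try easy. intros s [Hs1 Hs2] Hs.
  assert (Hc : closed_rect alpha r s) by (split; lra). now rewrite HF3, HG3. }
intros [u v] [Hu Hv]. simpl in Hu, Hv. apply Rabs_le_between in Hv.
apply part_inj. intros b.
apply Rminus_diag_uniq, Rabs_eq_0, Rle_antisym; [|apply Rabs_pos].
apply Rnot_lt_le. intros Hp. set (d := Rabs (part b (F (u, v)) - part b (G (u, v)))) in *.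
destruct (proj1 (continuous_on_closed_rect alpha r F) HF2 b u v Hu Hv (d / 2) ltac:(lra))
  as [e1 [He1 P1]].
destruct (proj1 (continuous_on_closed_rect alpha r G) HG2 b u v Hu Hv (d / 2) ltac:(lra))
  as [e2 [He2 P2]].
set (e := Rmin e1 e2). assert (He : 0 < e) by now apply Rmin_pos.
assert (L1 : e <= e1) by apply Rmin_l. assert (L2 : e <= e2) by apply Rmin_r.
set (K := 1 - alpha + r). assert (HK : 0 < K) by (unfold K; lra).
set (t := Rmin (/ 2) (e / (2 * K))).
assert (Ht0 : 0 < t) by (apply Rmin_pos; [lra|apply Rdiv_lt_0_compat; lra]).
assert (Ht1 : t <= / 2) by apply Rmin_l.
assert (Ht2 : t * K < e).
{ apply Rle_lt_trans with (e / (2 * K) * K); [apply Rmult_le_compat_r; [lra|apply Rmin_r]|].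
  replace (e / (2 * K) * K) with (e / 2) by (field; lra). lra. }
set (u' := u + t * ((alpha + 1) / 2 - u)). set (v' := (1 - t) * v).
assert (Hu' : alpha < u' < 1) by (unfold u'; split; nra).
assert (Hv' : - r < v' < r) by (unfold v'; split; nra).
assert (Du : Rabs (u' - u) < e).
{ unfold u'. replace (u + t * ((alpha + 1) / 2 - u) - u) with (t * ((alpha + 1) / 2 - u)) by ring.
  rewrite Rabs_mult, (Rabs_pos_eq t) by lra. apply Rle_lt_trans with (2 := Ht2).
  apply Rmult_le_compat_l; [lra|]. apply Rabs_le. unfold K. lra. }
assert (Dv : Rabs (v' - v) < e).
{ unfold v'. replace ((1 - t) * v - v) with (t * - v) by ring.
  rewrite Rabs_mult, (Rabs_pos_eq t) by lra. apply Rle_lt_trans with (2 := Ht2).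
  apply Rmult_le_compat_l; [lra|]. apply Rabs_le. unfold K. lra. }
assert (Q1 := P1 u' v' ltac:(lra) ltac:(lra) ltac:(lra) ltac:(lra)).
assert (Q2 := P2 u' v' ltac:(lra) ltac:(lra) ltac:(lra) ltac:(lra)).
simpl in Q1, Q2.
rewrite (Hin (u', v')) in Q1.
2:{ split; [exact Hu'|]. simpl. apply Rabs_def1; lra. }
set (X := part b (G (u', v'))) in *.
assert (Hd : d <= Rabs (X - part b (G (u, v))) + Rabs (X - part b (F (u, v)))).
{ unfold d. replace (part b (F (u, v)) - part b (G (u, v))) with
    ((X - part b (G (u, v))) + - (X - part b (F (u, v)))) by ring.
  apply Rle_trans with (1 := Rabs_triang _ _). rewrite Rabs_Ropp. lra. }
lra.
Qed.

Lemma laplace_ext_rect_eq (alpha r : R) (tau : R -> C) (F : C -> C) (s : C) :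
  alpha < 0 -> 0 < r -> is_laplace_ext_rect alpha r tau F -> closed_rect alpha r s ->
  laplace_ext_rect alpha r tau s = F s.
Proof.
intros Ha Hr HF Hs. apply (iota_unique (V := C_R_CompleteNormedModule)).
- intros w (G & HG & <-). now apply (laplace_ext_unique alpha r tau).
- now exists F.
Qed.

Lemma null_set_empty (A : R -> Prop) : (forall x, ~ A x) -> null_set A.
Proof.
intros HA eps Heps. exists (fun _ => 0), (fun _ => 0), 0.
split; [intros; lra|]. split; [intros x Hx; now destruct (HA x)|]. split; [|lra].
assert (Hg := is_series_geom (/ 2) ltac:(rewrite Rabs_pos_eq; lra)).
apply (is_series_scal_l 0) in Hg.
change (is_series (fun n => 0 * (/ 2) ^ n) (0 * / (1 - / 2))) in Hg.
rewrite Rmult_0_l in Hg. apply is_series_ext with (2 := Hg).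
intros n. change (0 * (/ 2) ^ n = 0 - 0). ring.
Qed.

(** The factor 2 counts the two summands of the norm. A pointwise bound on the derivative makes the
    exceptional set of the essential supremum empty, hence null. *)
Lemma norm_rect_le (alpha r e : R) (tau d : R -> C) (F : C -> C) : alpha < 0 -> 0 < r -> 0 <= e ->
  (forall x, 0 <= x -> is_half_derive tau x (d x)) -> (forall x, 0 <= x -> Cmod (d x) <= e) ->
  is_laplace_ext_rect alpha r tau F -> (forall s, closed_rect alpha r s -> Cmod (F s) <= e) ->
  Rbar_le (norm_rect alpha r tau) (2 * e).
Proof.
intros Ha Hr He Hd Hde HF HFe. unfold norm_rect.
replace (Finite (2 * e)) with (Rbar_plus e e) by (simpl; f_equal; ring).
apply Rbar_plus_le_compat.
- apply Glb_Rbar_correct. split; [exact He|]. apply null_set_empty. intros x [Hx Hlt].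
  rewrite (half_derive_unique tau x (d x) Hx (Hd x Hx)) in Hlt. specialize (Hde x Hx). lra.
- apply Lub_Rbar_correct. intros y (s & Hs & ->). simpl.
  rewrite (laplace_ext_rect_eq alpha r tau F s) by easy. now apply HFe.
Qed.

Lemma compact_support_V_half_plane (s ds : R -> C) (N : R) : 0 <= N -> is_C1 s ds ->
  (forall x, N <= x -> s x = RtoC 0) -> vanishing ds /\ V_half_plane m_infty s.
Proof.
intros HN Hs Hz.
assert (Hds : forall b x, N < x -> part b (ds x) = 0).
{ intros b x Hx. rewrite <- (is_derive_unique _ _ _ (proj1 (Hs b x))).
  rewrite (Derive_ext_loc _ (fun _ => 0)); [apply Derive_const|].
  exists (mkposreal (x - N) ltac:(lra)). intros y Hy. change (Rabs (y - x) < x - N) in Hy.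
  apply Rabs_def2 in Hy. rewrite Hz by lra. now destruct b. }
assert (Hv : vanishing ds).
{ intros b. apply is_lim_ext_loc with (fun _ => 0); [|apply is_lim_const].
  exists N. intros x Hx. now rewrite Hds. }
split; [exact Hv|]. split; [now apply is_C1_half_line with ds|]. split.
- apply vanishing_iff with ds; [|exact Hv]. intros x Hx. apply half_derive_unique; [exact Hx|].
  now apply is_C1_is_half_derive.
- exists (finite_laplace s N). split.
  + intros z _. now apply finite_laplace_analytic with ds.
  + intros [u v] _. symmetry. now apply laplace_compact_support with ds.
Qed.

Lemma is_laplace_ext_rect_minus (alpha r : R) (s t : R -> C) (F G : C -> C) :
  (forall z, closed_rect alpha r z -> 0 < Re z ->
     laplace (fun x => Cminus (s x) (t x)) z = Cminus (laplace s z) (laplace t z)) ->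
  is_laplace_ext_rect alpha r s F -> is_laplace_ext_rect alpha r t G ->
  is_laplace_ext_rect alpha r (fun x => Cminus (s x) (t x)) (fun z => Cminus (F z) (G z)).
Proof.
intros Hl (HF1 & HF2 & HF3) (HG1 & HG2 & HG3). split; [|split].
- intros z Hz. apply analytic_at_minus; auto.
- apply continuous_on_closed_rect. intros b x y Hx Hy eps Heps.
  destruct (proj1 (continuous_on_closed_rect alpha r F) HF2 b x y Hx Hy (eps / 2) ltac:(lra))
    as [e1 [He1 P1]].
  destruct (proj1 (continuous_on_closed_rect alpha r G) HG2 b x y Hx Hy (eps / 2) ltac:(lra))
    as [e2 [He2 P2]].
  exists (Rmin e1 e2). split; [now apply Rmin_pos|]. intros u v Hu Hv H1 H2.
  specialize (P1 u v Hu Hv (Rlt_le_trans _ _ _ H1 (Rmin_l _ _)) (Rlt_le_trans _ _ _ H2 (Rmin_l _ _))).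
  specialize (P2 u v Hu Hv (Rlt_le_trans _ _ _ H1 (Rmin_r _ _)) (Rlt_le_trans _ _ _ H2 (Rmin_r _ _))).
  rewrite !part_minus.
  match goal with |- Rabs ?z < _ => replace z with
    ((part b (F (u, v)) - part b (F (x, y))) + - (part b (G (u, v)) - part b (G (x, y)))) by ring end.
  apply Rle_lt_trans with (1 := Rabs_triang _ _). rewrite Rabs_Ropp. lra.
- intros z Hz Hz0. rewrite Hl, HF3, HG3 by easy. easy.
Qed.

(** One [sigma] is close in the norms of all smaller rectangles at the same time, which is what
    neighbourhoods given by finitely many norms require. For density in the Banach space the smaller
    rectangle is the given one. *)
Lemma V_rect_approximation (alpha r : R) (tau : R -> C) (F : C -> C) (eps : R) :
  alpha < 0 -> 0 < r -> 0 < eps ->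
  C1_half_line tau -> derive_vanishes_at_infty tau -> is_laplace_ext_rect alpha r tau F ->
  exists sigma, V_half_plane m_infty sigma /\
    forall alpha' r', alpha <= alpha' < 0 -> 0 < r' <= r ->
      is_laplace_ext_rect alpha' r' tau F ->
      Rbar_lt (norm_rect alpha' r' (fun x => Cminus (sigma x) (tau x))) eps.
Proof.
intros Ha Hr Heps HC HV HF.
destruct (C1_half_line_extension tau HC) as (T & dT & HT & HTt).
assert (HvT : vanishing dT).
{ apply (vanishing_iff tau dT); [|exact HV]. intros x Hx. symmetry. now apply HTt. }
assert (Etau : forall x, 0 <= x -> tau x = T x) by (intros x Hx; symmetry; now apply HTt).
assert (HF' := HF). destruct HF' as (HF1 & HF2 & HF3).
(* An error eps / 8 per component gives eps / 4 for the modulus and eps / 2 for the norm, strictly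
   below eps. *)
destruct (compact_support_approximation alpha r T dT F Ha Hr HT HvT HF1
  (proj1 (continuous_on_closed_rect alpha r F) HF2)) with (eps := eps / 8)
  as (s & ds & N & HN & Hs & Hsz & Hsd & HsF).
{ intros b u w Hu Hw. rewrite HF3.
  - now apply laplace_of_vanishing_derive with dT.
  - split; simpl; [lra|exact Hw].
  - simpl; lra. }
{ lra. }
destruct (compact_support_V_half_plane s ds N HN Hs Hsz) as [Hvs HVs].
exists s. split; [exact HVs|]. intros a' r' Ha' Hr' HFe.
apply Rbar_le_lt_trans with (2 * (eps / 4)); [|simpl; lra].
assert (Hext : is_laplace_ext_rect a' r' s (finite_laplace s N)).
{ split; [|split].
  - intros z _. now apply finite_laplace_analytic with ds.
  - apply analytic_continuous_on_closed_rect. intros z _. now apply finite_laplace_analytic with ds.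
  - intros [u v] _ _. symmetry. now apply laplace_compact_support with ds. }
assert (Hderiv : forall x, 0 <= x -> is_half_derive tau x (dT x)).
{ intros x Hx. rewrite (proj2 (HTt x Hx)). destruct (proj1 HC x Hx) as [l Hl].
  now rewrite (half_derive_unique tau x l). }
apply norm_rect_le with (fun x => Cminus (ds x) (dT x)) (fun z => Cminus (finite_laplace s N z) (F z)).
- lra.
- lra.
- lra.
- intros x Hx. apply is_half_derive_minus; [exact Hx| |now apply Hderiv].
  now apply is_C1_is_half_derive.
- intros x Hx. specialize (Hsd x Hx). lra.
- apply is_laplace_ext_rect_minus; [|exact Hext|exact HFe].
  intros [u v] _ Hu. now apply (laplace_minus s tau s ds T dT).
- intros [u v] [Hu Hv]. simpl in Hu, Hv.
  apply Rle_trans with (1 := Cmod_le_parts _).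
  assert (Q1 := HsF u v true ltac:(lra) ltac:(lra)). assert (Q2 := HsF u v false ltac:(lra) ltac:(lra)).
  rewrite <- part_finite_laplace, <- part_minus in Q1, Q2.
  change (Rabs (part true (Cminus (finite_laplace s N (u, v)) (F (u, v)))) +
    Rabs (part false (Cminus (finite_laplace s N (u, v)) (F (u, v)))) <= eps / 4). lra.
Qed.

Lemma half_plane_ext_rect (beta : Rbar) (alpha r : R) (tau : R -> C) (F : C -> C) :
  Rbar_lt beta alpha -> is_laplace_ext_half_plane beta tau F -> is_laplace_ext_rect alpha r tau F.
Proof.
intros Hb [HF1 HF2].
assert (Han : forall s, alpha <= Re s -> analytic_at F s).
{ intros s Hs. apply HF1. apply Rbar_lt_le_trans with (1 := Hb). exact Hs. }
split; [|split].
- intros s [Hs _]. apply Han. lra.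
- apply analytic_continuous_on_closed_rect. intros s [Hs _]. apply Han. lra.
- intros s _. apply HF2.
Qed.

(** Finitely many rectangles fit into one whose left side is still strictly right of alpha; the
    values alpha / 2 and 1 only start the induction. *)
Lemma frechet_norms_common_rect (alpha : R) (ps : list ((R -> C) -> Rbar)) : alpha < 0 ->
  (forall p, In p ps -> frechet_norms alpha p) ->
  exists a0 r0, alpha < a0 < 0 /\ 0 < r0 /\ forall p, In p ps ->
    exists a r, a0 <= a < 0 /\ 0 < r <= r0 /\ p = norm_rect a r.
Proof.
intros Ha. induction ps as [|p ps IH]; intros Hps.
- exists (alpha / 2), 1. split; [lra|split; [lra|]]. intros p [].
- destruct IH as (a0 & r0 & Ha0 & Hr0 & H); [intros q Hq; apply Hps; now right|].
  destruct (Hps p (or_introl eq_refl)) as (a & r & Ha1 & Ha2 & Hr1 & Hp). simpl in Ha1.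
  exists (Rmin a a0), (Rmax r r0).
  assert (L1 := Rmin_l a a0). assert (L2 := Rmin_r a a0).
  assert (L3 := Rmax_l r r0). assert (L4 := Rmax_r r r0).
  split; [split; [apply Rmin_glb_lt; lra|lra]|]. split; [lra|].
  intros q [<-|Hq].
  + exists a, r. repeat split; try easy; lra.
  + destruct (H q Hq) as (a' & r' & H1 & H2 & H3). exists a', r'. repeat split; try easy; lra.
Qed.

Theorem theorem2p1 :
  forall alpha r : R, alpha < 0 -> 0 < r ->
    dense_in (V_rect alpha r) (banach_norm alpha r) (V_half_plane m_infty) /\
    dense_in (V_half_plane alpha) (frechet_norms alpha) (V_half_plane m_infty).
Proof.
intros alpha r Ha Hr. split; split.
- intros tau (H1 & H2 & F & HF). split; [exact H1|split; [exact H2|]].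
  exists F. now apply half_plane_ext_rect with m_infty.
- intros U [HUE HU] [tau Htau].
  destruct (HU tau Htau) as (ps & eps & Hps & Heps & Hball).
  destruct (HUE tau Htau) as (H1 & H2 & F & HF).
  destruct (V_rect_approximation alpha r tau F eps Ha Hr Heps H1 H2 HF) as (s & Hs & Hn).
  exists s. split; [|exact Hs]. apply Hball.
  + destruct Hs as (S1 & S2 & G & HG). split; [exact S1|split; [exact S2|]].
    exists G. now apply half_plane_ext_rect with m_infty.
  + intros p Hp. rewrite (Hps p Hp). apply Hn; try lra. exact HF.
- intros tau (H1 & H2 & F & HF1 & HF2). split; [exact H1|split; [exact H2|]].
  exists F. split; [|exact HF2]. intros s _. now apply HF1.
- intros U [HUE HU] [tau Htau].
  destruct (HU tau Htau) as (ps & eps & Hps & Heps & Hball).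
  destruct (HUE tau Htau) as (H1 & H2 & F & HF).
  destruct (frechet_norms_common_rect alpha ps Ha Hps) as (a0 & r0 & Ha0 & Hr0 & Hcommon).
  (* The approximation takes place right of a0 > alpha: analyticity on the open half-plane covers
     this closed rectangle, hence the continuity required on it. *)
  destruct (V_rect_approximation a0 r0 tau F eps ltac:(lra) Hr0 Heps H1 H2) as (s & Hs & Hn).
  { apply half_plane_ext_rect with alpha; [simpl; lra|exact HF]. }
  exists s. split; [|exact Hs]. apply Hball.
  + destruct Hs as (S1 & S2 & G & HG1 & HG2). split; [exact S1|split; [exact S2|]].
    exists G. split; [|exact HG2]. intros z _. now apply HG1.
  + intros p Hp. destruct (Hcommon p Hp) as (a & r' & Hp1 & Hp2 & ->).
    apply Hn; try lra. apply half_plane_ext_rect with alpha; [simpl; lra|exact HF].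
Qed.
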